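(* Let $p>2$ and $b>1$, and let $X=D^{1,2}L^p_\omega(\mathbb R^2)$ with norm $\|\cdot\|$ as in the context. For any $\alpha<4\pi$, $$\sup_{u\in X,\ \|u\|^2\le1}\int_{\mathbb R^2}|u|^p e^{\alpha u^2}\ln(b+|x|)\,dx<+\infty.$$ The inequality is sharp, in the sense that for any $\alpha>4\pi$, $$\sup_{u\in X,\ \|u\|^2\le1}\int_{\mathbb R^2}|u|^p e^{\alpha u^2}\ln(b+|x|)\,dx=+\infty.$$
   Context: $X=D^{1,2}L^p_\omega(\mathbb R^2)$ is the space of $u\in L^1_{\rm loc}(\mathbb R^2)$ with $\nabla u\in L^2(\mathbb R^2)$ and $\|u\|_{*,p}:=\big(\int_{\mathbb R^2}|u|^p\ln(b+|x|)\,dx\big)^{1/p}<+\infty$, with norm $\|u\|=\big(\|\nabla u\|_2^2+\|u\|_{*,p}^2\big)^{1/2}$. *)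

(* Defs.v *)
From HB Require Import structures.
From mathcomp Require Import all_boot all_order all_algebra.
From mathcomp Require Import all_classical all_reals all_analysis.
Set Implicit Arguments.
Unset Strict Implicit.
Unset Printing Implicit Defensive.
Import Order.TTheory GRing.Theory Num.Theory.
Import numFieldNormedType.Exports.
Local Open Scope classical_set_scope.
Local Open Scope ring_scope.

(* Lebesgue measure on the Borel sets of R^2 (modelled as R * R). *)
Definition mu2 (R : realType) :
    {measure set (measurableTypeR R * measurableTypeR R) -> \bar R} :=
  (@lebesgue_measure R \x @lebesgue_measure R)%E.

(* The library norm on R * R is the sup norm; |x| here is Euclidean. *)
Definition enorm2 (R : realType) (x : R * R) : R :=
  Num.sqrt (x.1 ^+ 2 + x.2 ^+ 2).

Definition loc_integrable2 (R : realType) (u : R * R -> R) : Prop :=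
  forall K : set (R * R), compact K -> (mu2 R).-integrable K (EFin \o u).

Definition partial1 (R : realType) (f : R * R -> R) (x : R * R) : R :=
  'D_((1, 0) : R * R) f x.

Definition partial2 (R : realType) (f : R * R -> R) (x : R * R) : R :=
  'D_((0, 1) : R * R) f x.

Fixpoint Ck2 (R : realType) (k : nat) (f : R * R -> R) : Prop :=
  if k is k'.+1 then
    [/\ forall x, derivable f x ((1, 0) : R * R),
        forall x, derivable f x ((0, 1) : R * R),
        Ck2 k' (partial1 f) & Ck2 k' (partial2 f)]
  else continuous f.

Definition test_function2 (R : realType) (phi : R * R -> R) : Prop :=
  (forall k, Ck2 k phi) /\ compact (closure [set x | phi x != 0]).

Definition is_weak_gradient (R : realType) (u : R * R -> R)
    (g : R * R -> R * R) : Prop :=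
  [/\ loc_integrable2 (fun x => (g x).1),
      loc_integrable2 (fun x => (g x).2) &
      forall phi : R * R -> R, test_function2 phi ->
        (\int[mu2 R]_x (u x * partial1 phi x))%R =
          - (\int[mu2 R]_x ((g x).1 * phi x))%R /\
        (\int[mu2 R]_x (u x * partial2 phi x))%R =
          - (\int[mu2 R]_x ((g x).2 * phi x))%R].

Definition has_weak_gradient (R : realType) (u : R * R -> R) : Prop :=
  exists g, is_weak_gradient u g.

(* A representative of the weak gradient, which is unique up to a null set;
   the zero field when u has no weak gradient. *)
Definition weak_gradient (R : realType) (u : R * R -> R) : R * R -> R * R :=
  xget (fun=> (0, 0)) [set g | is_weak_gradient u g].

Definition gradient_norm (R : realType) (u : R * R -> R) : \bar R :=
  ('N[mu2 R]_2%:E[EFin \o (@enorm2 R \o weak_gradient u)])%E.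

Definition weighted_norm (R : realType) (b p : R) (u : R * R -> R) : \bar R :=
  (poweR (\int[mu2 R]_x (`|u x| `^ p * ln (b + enorm2 x))%:E) p^-1)%E.

Definition DLspace (R : realType) (b p : R) : set (R * R -> R) :=
  [set u | [/\ loc_integrable2 u, has_weak_gradient u,
               (gradient_norm u < +oo)%E & (weighted_norm b p u < +oo)%E]].

Definition DLnorm (R : realType) (b p : R) (u : R * R -> R) : \bar R :=
  (poweR (gradient_norm u ^+ 2 + weighted_norm b p u ^+ 2) 2^-1)%E.

Definition TM_functional (R : realType) (b p alpha : R) (u : R * R -> R) :
    \bar R :=
  (\int[mu2 R]_x
     (`|u x| `^ p * expR (alpha * u x ^+ 2) * ln (b + enorm2 x))%:E)%E.

Definition TM_sup (R : realType) (b p alpha : R) : \bar R :=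
  ereal_sup [set TM_functional b p alpha u |
             u in DLspace b p `&` [set u | (DLnorm b p u ^+ 2 <= 1)%E]].

(* Main.v *)
(* Write [w x = ln (b + |x|)]. Fix [x], put [r = 1 / w x], and test the weak
   gradient [g] of [u] against the fields [(y - x) m(|y - x|^2)] whose divergence
   is a mollifier at squared radius [e] minus one at squared radius [r]. For [e]
   small this gives, at every [x],
     |u_e x| <= |u_r x| + (2 pi)^-1 * int_{|y - x|^2 < r} |g y| / |y - x| dy.
   The first term is bounded since [w] is nearly constant on the disc and
   [int |u|^p w <= 1]. AM-GM with the weight [1 + v |y - x|^(-2 th)] bounds the
   second one by [sqrt ((1 + de) / (4 pi th) * ln (1 + (G x + 1) / de))] with
   [G x = r^th * int_{|y - x|^2 < r} |g y|^2 |y - x|^(-2 th) dy], and Tonelli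
   bounds [int w G]. Letting [e] tend to 0, [exp (al u^2) <= C (1 + G)] a.e. as
   soon as [al (1 + de)^2 <= 4 pi th].
   For sharpness, [k (ln (|x|^2 + 1) - ln (|x|^2 + eps))] has squared gradient
   norm at most [4 pi k^2 ln (1 / eps)], while its weighted norm is [O(k)]
   uniformly in [eps]. *)
From HB Require Import structures.
Require Import Defs.
From mathcomp Require Import all_boot all_order all_algebra.
From mathcomp Require Import all_classical all_reals all_analysis.
From mathcomp Require Import measurable_realfun ring lra.
Set Implicit Arguments.
Unset Strict Implicit.
Unset Printing Implicit Defensive.
Import Order.TTheory GRing.Theory Num.Theory.
Import numFieldNormedType.Exports.
Local Open Scope classical_set_scope.
Local Open Scope ring_scope.

(** * Lebesgue measure on the plane *)

(** Two obstacles shape the bound. The kernel [1 / |y - x|] just fails to be square integrable, so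
    plain Cauchy-Schwarz against the gradient diverges logarithmically; and [w] has infinite total
    mass, so a mere bound [exp (al u^2) <= C] could not be integrated. The factor [1 + v s^(-th)],
    with [s = |y - x|^2], answers the first: the squared kernel divided by it is a multiple of
    [s^(th - 1) / (s^th + v)], whose integral is exactly a logarithm with coefficient
    [1 / (4 pi th)]. Letting [v] depend on the local energy puts [G x] inside this logarithm, and
    the exponential undoes it. Integrability of [s^(-th)] in the plane asks for [th < 1], whence the
    strict inequality [alpha < 4 pi]. The radius [r = 1 / w x] answers the second: the disc has
    [w]-mass of order 1, so averages of [u] are bounded uniformly in [x] and the powers of [w]
    cancel in [int w G]. The constant term of [C (1 + G)] is used only where [|u| > 1], where
    [w <= |u|^p w]. Radial functions depend on the squared distance, a polynomial: they stay smooth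
    at the centre, and polar integration reduces to [pi ds]. *)

Section continuous_pointwise.
Variables (R : realType) (T : topologicalType).
Implicit Types f g : T -> R.

Lemma continuous_mul f g :
  continuous f -> continuous g -> continuous (fun x => f x * g x).
Proof. by move=> cf cg x; apply: (@cvgM R T); [exact: cf|exact: cg]. Qed.

Lemma continuous_add f g :
  continuous f -> continuous g -> continuous (fun x => f x + g x).
Proof. by move=> cf cg x; apply: (@cvgD R R T); [exact: cf|exact: cg]. Qed.

Lemma continuous_opp f : continuous f -> continuous (fun x => - f x).
Proof. by move=> cf x; apply: (@cvgN R R T); exact: cf. Qed.

Lemma continuous_sub f g :
  continuous f -> continuous g -> continuous (fun x => f x - g x).
Proof. by move=> cf cg; apply: continuous_add => //; exact: continuous_opp. Qed.

Lemma continuous_exprn f n : continuous f -> continuous (fun x => f x ^+ n).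
Proof.
move=> cf; elim: n => [|n IH]; first by move=> x; exact: cvg_cst.
by under eq_fun do rewrite exprS; exact: continuous_mul.
Qed.

Lemma continuous_fcomp f (g : R -> R) :
  continuous f -> continuous g -> continuous (fun x => g (f x)).
Proof. by move=> cf cg x; apply: continuous_comp; [exact: cf|exact: cg]. Qed.

End continuous_pointwise.

(** The same product measure as [mu2], under a name on which sigma-finiteness can be registered, as
    Fubini and Tonelli require. *)
Definition leb2 (R : realType) :
    set (measurableTypeR R * measurableTypeR R)%type -> \bar R :=
  (@lebesgue_measure R \x @lebesgue_measure R)%E.
HB.instance Definition _ (R : realType) :=
  Measure.copy (@leb2 R) (@lebesgue_measure R \x @lebesgue_measure R)%E.

Definition box (R : realType) (n : nat) : set (R * R) :=
  `[- n%:R, n%:R] `*` `[- n%:R, n%:R].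

Section plane.
Variable R : realType.
Implicit Types (u f : R * R -> R) (n : nat).
Local Notation T2 := (measurableTypeR R * measurableTypeR R)%type.

Lemma measurable_box n : measurable (@box R n : set T2).
Proof. exact: measurableX. Qed.

Lemma boxP n (x : R * R) : box n x <-> `|x.1| <= n%:R /\ `|x.2| <= n%:R.
Proof. by rewrite /box/= !in_itv/= -!ler_norml. Qed.

Lemma box_cover (x : R * R) : exists n, box n x.
Proof.
exists (Num.truncn (Num.max `|x.1| `|x.2|)).+1; apply/boxP; split; apply: ltW;
  apply: le_lt_trans (Num.Theory.truncnS_gt _); rewrite le_max lexx ?orbT//.
Qed.

Lemma leb2_box_lty n : (leb2 (@box R n) < +oo)%E.
Proof.
rewrite /leb2 product_measure1E//=.
by rewrite !lebesgue_measure_itv/=; case: ifP => // _; rewrite ?mule0 ?ltry// -?EFinD -?EFinM ltry.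
Qed.

Lemma leb2_sigma_finite : sigma_finite setT (@leb2 R).
Proof.
exists (@box R); last by move=> k; split; [exact: measurable_box|exact: leb2_box_lty].
by apply/esym; rewrite -subTset => x _; have [n xn] := box_cover x; exists n.
Qed.

(** Links the topology to the product sigma-algebra: an open set is the union of the countably many
    open rectangles with rational corners that it contains. *)
Lemma open_measurable2 (U : set (R * R)) : open U -> measurable (U : set T2).
Proof.
move=> oU.
pose B (q : (rat * rat) * (rat * rat)) : set (R * R) :=
  `]ratr q.1.1, ratr q.1.2[ `*` `]ratr q.2.1, ratr q.2.2[.
pose C := [set q | B q `<=` U].
have -> : U = \bigcup_(q in C) B q.
  apply/seteqP; split; last by move=> x [q qC Bq]; exact: qC.
  move=> [x y] Uxy; have /nbhs_ballP[e /= e0 eU] : nbhs (x, y) U by move: oU; rewrite openE; apply.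
  have H (z : R) : exists a b : rat, [/\ ratr a < z, z < ratr b & forall t : R, ratr a < t < ratr b -> ball z e t].
    have [a] := @rat_in_itvoo R (z - e) z ltac:(lra); rewrite in_itv/= => /andP[a1 a2].
    have [b] := @rat_in_itvoo R z (z + e) ltac:(lra); rewrite in_itv/= => /andP[b1 b2].
    exists a, b; split => // t /andP[ta tb]; rewrite /ball/= ltr_norml; apply/andP; split; lra.
  have [a [b [ax xb abx]]] := H x; have [c [d [cy yd cdy]]] := H y.
  exists ((a, b), (c, d)); last by split; rewrite /= in_itv/=; apply/andP.
  move=> [s t] [/=]; rewrite !in_itv/= => sab tcd; apply: eU; split => /=; [exact: abx|exact: cdy].
rewrite bigcup_mkcond; apply: countable_bigcupT_measurable => // q.
by case: ifP => // _; exact: measurableX.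
Qed.

Lemma continuous_measurable2 f : continuous f -> measurable_fun (setT : set T2) f.
Proof.
move=> /continuousP cf; apply: (measurability _ (measurable_realfun.RGenOpens.measurableE R)) => //=.

move=> _ [_ [a [b ->] <-]]; rewrite setTI; apply: open_measurable2.
by apply: cf; exact: interval_open.
Qed.

Lemma compact_measurable2 (K : set (R * R)) : compact K -> measurable (K : set T2).
Proof.
move=> /(compact_closed (@norm_hausdorff R _)) /closed_openC /open_measurable2.
by move=> /measurableC; rewrite setCK.
Qed.

Lemma compact_sub_box (K : set (R * R)) : compact K -> exists n, K `<=` @box R n.
Proof.
move=> /compact_bounded[M [_ /(_ (`|M| + 1))]] /(_ ltac:(rewrite ltr_pwDr// ler_norm)) KM.
exists (Num.truncn (`|M| + 1)).+1 => x Kx; apply/boxP.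
have := KM isT x Kx; rewrite /= prod_normE ge_max => /andP[h1 h2].
by split; apply/ltW; [apply: le_lt_trans h1 _|apply: le_lt_trans h2 _];
  exact: Num.Theory.truncnS_gt.
Qed.

Lemma compact_box n : compact (@box R n).
Proof. by apply: compact_setX; exact: segment_compact. Qed.

Lemma bigcup_box : \bigcup_n @box R n = setT.
Proof. by rewrite -subTset => x _; have [n xn] := box_cover x; exists n. Qed.

Lemma loc_integrable2_measurable u :
  loc_integrable2 u -> measurable_fun (setT : set T2) u.
Proof.
move=> lu; rewrite -bigcup_box.
apply/(measurable_fun_bigcup _ (fun n => measurable_box n)) => n.
exact/measurable_EFinP/measurable_int/lu/compact_box.
Qed.

Lemma loc_integrable2_box u n :
  loc_integrable2 u -> (@leb2 R).-integrable (@box R n) (EFin \o u).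
Proof. by move=> lu; exact/lu/compact_box. Qed.

Lemma loc_integrable2P u : measurable_fun (setT : set T2) u ->
  (forall n, (@leb2 R).-integrable (@box R n) (EFin \o u)) -> loc_integrable2 u.
Proof.
move=> mu iu K cK; have [n Kn] := compact_sub_box cK.
apply: (integrableS (measurable_box n)) => //; first exact: compact_measurable2.
Qed.

End plane.
HB.instance Definition _ (R : realType) :=
  Measure_isSigmaFinite.Build _ _ _ (@leb2 R) (@leb2_sigma_finite R).

Lemma ftc_derive (R : realType) (F f : R -> R) (a b : R) : a < b ->
  {in `[a, b], forall x, is_derive x (1 : R) F (f x)} ->
  {within `[a, b], continuous f} ->
  (\int[lebesgue_measure]_(x in `[a, b]) (f x)%:E = (F b - F a)%:E)%E.
Proof.
move=> ab dF cf.
have cF x : x \in `[a, b] -> F y @[y --> x] --> F x.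
  by move=> xab; apply: differentiable_continuous; apply/derivable1_diffP; have [] := dF _ xab.
rewrite (@continuous_FTC2 _ f F)//.
- split.
  + by move=> x /subset_itv_oo_cc xab; have [] := dF _ xab.
  + by apply: cvg_at_right_filter; apply: cF; rewrite in_itv/= lexx ltW.
  + by apply: cvg_at_left_filter; apply: cF; rewrite in_itv/= lexx ltW.
- by move=> x /subset_itv_oo_cc xab; rewrite derive1E; case: (dF _ xab).
Qed.

(* Radial kernels below take the squared distance as their argument. *)
Definition sqdist (R : realType) (y c : R * R) : R :=
  (y.1 - c.1) ^+ 2 + (y.2 - c.2) ^+ 2.

(** * Integration of functions of the squared distance *)

Section radial.
Variable R : realType.
Local Notation T2 := (measurableTypeR R * measurableTypeR R)%type.
Local Notation leb := (@lebesgue_measure R).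

Lemma sqdist_ge0 (y c : R * R) : 0 <= sqdist y c.
Proof. by rewrite addr_ge0 ?sqr_ge0. Qed.

Lemma sqdistC (y c : R * R) : sqdist y c = sqdist c y.
Proof. rewrite /sqdist; ring. Qed.

Lemma measurable_sqdist (c : R * R) : measurable_fun (setT : set T2) (fun y => sqdist y c).
Proof.
apply: measurable_funD; apply: measurable_funX; apply: measurable_funB => //.
Qed.

(** Substitution [x = c + r sin z] with [r = sqrt t], after which the integrand [2 r^2 cos^2 z] has
    the antiderivative [r^2 (z + sin z cos z)]. *)
Lemma integral_half_circle (c t : R) : 0 < t ->
  (\int[leb]_x (2 * Num.sqrt (t - (x - c) ^+ 2))%:E = (pi * t)%:E)%E.
Proof.
move=> t0; pose G (x : R) : R := 2 * Num.sqrt (t - (x - c) ^+ 2).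
rewrite -[LHS]/(\int[leb]_x (G x)%:E)%E; set r := Num.sqrt t.
have r0 : 0 < r by rewrite sqrtr_gt0.
have tE : t = r ^+ 2 by rewrite sqr_sqrtr// ltW.
pose F x := c + r * sin x : R.
have cG : continuous G.
  rewrite /G; apply: continuous_mul; first exact: cst_continuous.
  apply: continuous_fcomp; last exact: sqrt_continuous.
  apply: continuous_sub; first exact: cst_continuous.
  apply: continuous_exprn; apply: continuous_sub => x; [exact: cvg_id|exact: cvg_cst].
have dF x : is_derive x (1:R) F (r * cos x).
  by rewrite /F; apply: is_derive_eq; rewrite /GRing.scale/= ?mulr1 ?mulr0 ?addr0 ?add0r; ring.
have F'E : F^`()%classic = fun x => r * cos x.
  by apply/funext => x; rewrite derive1E derive_val.
have cF' : continuous (F^`()%classic).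
  by rewrite F'E; apply: continuous_mul; [exact: cst_continuous|exact: continuous_cos].
have cF : continuous F.
  by move=> x; apply: differentiable_continuous; apply/derivable1_diffP; have [] := dF x.
have p0 := pi_gt0 R.
(* The square root of a negative number is 0 here, so the integrand vanishes off
   [[c - r, c + r]]. *)
have -> : (\int[leb]_x (G x)%:E = \int[leb]_(x in `[F (- (pi / 2))%R, F (pi / 2)%R]) (G x)%:E)%E.
  rewrite [RHS]integral_mkcond; apply: eq_integral => x _; rewrite patchE.
  case: ifPn => // /negP xn; congr EFin; rewrite /G ler0_sqrtr ?mulr0//.
  rewrite subr_le0 tE; apply: contrapT => /negP; rewrite -ltNge => h; apply: xn.
  rewrite inE/= in_itv/= /F sinN sin_pihalf mulr1 mulrN1.
  move: h; rewrite -ltr_sqrt ?exprn_gt0// !sqrtr_sqr (gtr0_norm r0) ltr_norml.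
  by move=> /andP[h1 h2]; apply/andP; split; lra.
rewrite integration_by_substitution_increasing; first last.
- by apply: continuous_subspaceT.
- split.
  + by move=> x _; have [] := dF x.
  + exact/cvg_at_right_filter/cF.
  + exact/cvg_at_left_filter/cF.
- by apply/cvg_ex; eexists; apply/cvg_at_left_filter/cF'.
- by apply/cvg_ex; eexists; apply/cvg_at_right_filter/cF'.
- by move=> x _; exact: cF'.
- by move=> x y xi yi xy; rewrite /F ltrD2l ltr_pM2l// ltr_sin.
- lra.
transitivity (\int[leb]_(x in `[(- (pi / 2))%R, (pi / 2)%R]) (2 * r ^+ 2 * cos x ^+ 2)%:E)%E.
  apply: eq_integral.
  move=> x; rewrite inE/= => xi; congr EFin; rewrite F'E /G /F tE.
  change (2 * Num.sqrt (r ^+ 2 - (c + r * sin x - c) ^+ 2) * (r * cos x) = 2 * r ^+ 2 * cos x ^+ 2).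
  have -> : r ^+ 2 - (c + r * sin x - c) ^+ 2 = (r * cos x) ^+ 2.
    by rewrite [in RHS]exprMn cos2sin2; ring.
  have cx : 0 <= cos x by apply: cos_ge0_pihalf; move: xi; rewrite in_itv.
  by rewrite sqrtr_sqr ger0_norm ?mulr_ge0 ?(ltW r0)//; ring.
pose H x := r ^+ 2 * (x + sin x * cos x) : R.
rewrite (@ftc_derive _ H).
- congr EFin; rewrite /H sinN cosN sin_pihalf cos_pihalf tE; lra.
- lra.
- move=> x _; rewrite /H; apply: is_derive_eq.
  have := cos2Dsin2 x; rewrite /GRing.scale/= => h; rewrite -[in RHS](mul1r (cos x ^+ 2)); nra.
- apply: continuous_subspaceT; apply: continuous_mul; first exact: cst_continuous.
  by apply: continuous_exprn; exact: continuous_cos.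
Qed.

(** Cavalieri: each section is an interval of length [2 sqrt (t - (x - c.1)^2)]. The convention for
    roots of negative numbers makes the empty sections fit the same formula. *)
Lemma disc_area (c : R * R) (t : R) : 0 < t ->
  leb2 [set y | sqdist y c < t] = (pi * t)%:E.
Proof.
move=> t0; rewrite -(integral_half_circle c.1 t0) /leb2 /product_measure1.
apply: eq_integral => x _ /=.
have -> : xsection [set y | sqdist y c < t] x =
    `]c.2 - Num.sqrt (t - (x - c.1) ^+ 2), c.2 + Num.sqrt (t - (x - c.1) ^+ 2)[%classic.
  apply/seteqP; split => y; rewrite /xsection/= inE/= in_itv/= /sqdist/=.
    move=> h; have h1 : (y - c.2) ^+ 2 < t - (x - c.1) ^+ 2 by lra.
    have h2 : 0 < t - (x - c.1) ^+ 2 by apply: le_lt_trans h1; exact: sqr_ge0.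
    move: h1; rewrite -ltr_sqrt// sqrtr_sqr ltr_norml => /andP[a b].
    by apply/andP; split; lra.
  move=> h; have : `|y - c.2| < Num.sqrt (t - (x - c.1) ^+ 2).
    by rewrite ltr_norml; move: h => /andP[a b]; apply/andP; split; lra.
  have [h0|h0] := ltP 0 (t - (x - c.1) ^+ 2).
    by rewrite -sqrtr_sqr ltr_sqrt//; lra.
  by rewrite (ler0_sqrtr h0) ltNge normr_ge0.
rewrite lebesgue_measure_itv/= lte_fin.
have s0 := sqrtr_ge0 (t - (x - c.1) ^+ 2).
case: ifPn => h; first by rewrite -EFinB; congr EFin; ring.
by congr EFin; move: h; rewrite -leNgt => h; lra.
Qed.

(** The image of the plane measure under [sqdist _ c] is [pi] times Lebesgue measure on the
    half-line: by [disc_area] both agree on the half-lines []-oo, x[], which are stable under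
    intersection and generate the Borel sets. *)
Lemma radial_integral (c : R * R) (h : R -> \bar R) :
  measurable_fun setT h -> (forall s, (0 <= h s)%E) ->
  (\int[@leb2 R]_y h (sqdist y c) = pi%:E * \int[leb]_(s in `]0%R, +oo[) h s)%E.
Proof.
move=> mh h0.
pose phi : T2 -> measurableTypeR R := fun y => sqdist y c.
have mphi : measurable_fun setT phi by exact: measurable_sqdist.
have D : measurable (`[0%R, +oo[ : set (measurableTypeR R)) by [].
have p0 := pi_ge0 R.
pose nu1 : {measure set (measurableTypeR R) -> \bar R} :=
  measure_function_pushforward__canonical__measure_function_Measure (@leb2 R) mphi.
pose nu2 : {measure set (measurableTypeR R) -> \bar R} := mscale (NngNum p0) (mrestr leb D).
have nuE (A : set (measurableTypeR R)) : measurable A -> nu1 A = nu2 A.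
  have nut (x : R) : nu1 `]-oo, x[%classic = (pi * Num.max x 0)%:E /\ nu2 `]-oo, x[%classic = (pi * Num.max x 0)%:E.
    rewrite /nu1 /nu2 /= /mscale /mrestr /pushforward /=.
    rewrite {1}/mrestr.
    rewrite [_ `&` _](_ : _ = `[0, x[%classic); last first.
      by apply/seteqP; split => z /=; rewrite !in_itv/= andbT; [move=> [zx z0]; apply/andP|move=> /andP[z0 zx]].
    have [x0|x0] := ltP 0 x.
      rewrite lebesgue_measure_itv/= lte_fin x0 oppr0 adde0 -EFinM; split => //.
      rewrite -(disc_area c x0); congr (leb2 _).
    rewrite lebesgue_measure_itv/= lte_fin ltNge x0/= mule0 mulr0; split => //.
    rewrite [phi @^-1` _](_ : _ = set0) ?measure0//.
    apply/seteqP; split => y //=; rewrite in_itv/= => yx0.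
    by have := sqdist_ge0 y c; rewrite leNgt (lt_le_trans yx0 x0).
  refine (@measure_unique _ R (measurableTypeR R) (@measurable_realfun.RGenInftyO.G R) (fun k => `]-oo, k%:R[%classic) _ _ _ _ nu1 nu2 _ _ A).
  - exact: measurable_realfun.RGenInftyO.measurableE.
  - move=> _ _ [x ->] [y ->]; exists (Num.min x y).
    by apply/seteqP; split => z /=; rewrite !in_itv/= lt_min; [move=> [-> ->]|move=> /andP[]].
  - by move=> k; exists k%:R.
  - rewrite -subTset => x _; exists (Num.truncn `|x|).+1 => //=; rewrite in_itv/=.
    by apply: le_lt_trans (ler_norm x) _; exact: Num.Theory.truncnS_gt.
  - by move=> _ [x ->]; have [-> ->] := nut x.
  - by move=> k; have [-> _] := nut k%:R; rewrite ltry.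
transitivity (\int[nu1]_(s in `[0%R, +oo[) h s)%E.
  rewrite (@ge0_integral_pushforward _ _ _ _ _ _ mphi)//; last exact: measurable_funTS.
  rewrite (_ : phi @^-1` _ = setT)//; apply/seteqP; split => // y _ /=.
  by rewrite in_itv/= sqdist_ge0.
rewrite (eq_measure_integral (mscale (NngNum p0) leb)); last first.
  move=> A mA AD; rewrite nuE// /nu2 /= /mscale /mrestr/=.
  by congr (_ * leb _)%E; exact: (@setIidl R).
rewrite ge0_integral_mscale//; last exact: measurable_funTS.
by rewrite /= integral_itv_obnd_cbnd//; exact: measurable_funTS.
Qed.

End radial.

(** * Rules for directional derivatives *)

Section derive_pointwise.
Variables (R : realType) (V : normedModType R).
Implicit Types (f g : V -> R) (x v : V).

Lemma is_derive_mul f g x v (df dg : R) : is_derive x v f df -> is_derive x v g dg ->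
  is_derive x v (fun y => f y * g y) (f x * dg + g x * df).
Proof. by move=> df' dg'; exact: (is_deriveM df' dg'). Qed.

Lemma is_derive_add f g x v (df dg : R) : is_derive x v f df -> is_derive x v g dg ->
  is_derive x v (fun y => f y + g y) (df + dg).
Proof. by move=> df' dg'; exact: (is_deriveD df' dg'). Qed.

Lemma is_derive_sub f g x v (df dg : R) : is_derive x v f df -> is_derive x v g dg ->
  is_derive x v (fun y => f y - g y) (df - dg).
Proof. by move=> df' dg'; exact: (is_deriveB df' dg'). Qed.

(** Restricting to the line through [x] with direction [v] reduces the chain rule for directional
    derivatives to the one-variable one. *)
Lemma is_derive_line f x v (df : R) :
  is_derive x v f df <-> is_derive (0 : R) (1 : R) (fun h : R => f (h *: v + x)) df.
Proof.
have E : (fun h : R => h^-1 *: (((fun h : R => f (h *: v + x)) \o shift (0 : R)) (h *: (1 : R))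
    - f ((0 : R) *: v + x))) = (fun h : R => h^-1 *: ((f \o shift x) (h *: v) - f x)).
  by apply/funext => h /=; rewrite addr0 scale0r add0r /GRing.scale/= mulr1.
by split => -[d1 d2]; split; move: d1 d2; rewrite /derivable /derive E.
Qed.

Lemma is_derive_chain (f : R -> R) g x v (df dg : R) :
  is_derive (g x) (1 : R) f df -> is_derive x v g dg ->
  is_derive x v (fun y => f (g y)) (df * dg).
Proof.
move=> df' /is_derive_line dg'; apply/is_derive_line.
apply: (@is_derive1_comp _ f (fun h : R => g (h *: v + x))) => //.
by rewrite scale0r add0r.
Qed.

Lemma is_derive_inv g x v (dg : R) : is_derive x v g dg -> g x != 0 ->
  is_derive x v (fun y => (g y)^-1) (- (g x) ^- 2 * dg).
Proof.
move=> dg' g0; apply: is_derive_chain dg'.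
apply: is_derive_eq (is_deriveV g0 (is_derive_id (g x) (1 : R))) _.
by rewrite /GRing.scale/= mulr1.
Qed.

Lemma is_derive_exprn f n x v (df : R) : is_derive x v f df ->
  is_derive x v (fun y => f y ^+ n) (n%:R * f x ^+ n.-1 * df).
Proof.
move=> df'; elim: n => [|n IH].
  by rewrite !mul0r; exact: is_derive_cst.
under eq_fun do rewrite exprS.
apply: is_derive_eq (is_derive_mul df' IH) _.
by case: n {IH} => [|n] /=; rewrite ?exprS ?expr0 -?natr1; ring.
Qed.

End derive_pointwise.

(** * One-variable calculus and a smooth step *)

Section calculus.
Variable R : realType.
Implicit Types (F f : R -> R).
Local Notation leb := (@lebesgue_measure R).

Lemma is_derive1_continuous f df (x : R) :
  is_derive x (1 : R) f df -> {for x, continuous f}.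
Proof. by move=> [/derivable1_diffP df' _]; exact: differentiable_continuous. Qed.

Lemma continuous_pos_measurable f : (forall s, 0 < s -> {for s, continuous f}) ->
  measurable_fun (`]0, +oo[ : set R) f.
Proof.
move=> cf; apply: open_continuous_measurable_fun; first exact: interval_open.
by move=> x; rewrite inE/= in_itv/= andbT; exact: cf.
Qed.

(** Exhaust []0, c]] by the intervals [[c / (n + 2), c]] and drop the nonnegative value of [F] at
    the left end. Stating an inequality dispenses with the limit of [F] at 0, where [f] may be
    singular. *)
Lemma integral_le_ftc F f (c : R) : 0 < c ->
  (forall s : R, 0 < s -> is_derive s (1 : R) F (f s)) ->
  (forall s, 0 < s -> {for s, continuous f}) ->
  (forall s, 0 < s -> 0 <= f s) -> (forall s, 0 < s -> 0 <= F s) ->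
  (\int[leb]_(s in `]0%R, c]) (f s)%:E <= (F c)%:E)%E.
Proof.
move=> c0 dF cf f0 F0.
pose D n : set R := `[c / n.+2%:R, c]%classic.
have a0 n : 0 < c / n.+2%:R by rewrite divr_gt0.
have ac n : c / n.+2%:R < c by rewrite ltr_pdivrMr// ltr_pMr// ltr1n.
have mf n : measurable_fun (D n) (EFin \o f).
  apply/measurable_EFinP; apply: measurable_funS (continuous_pos_measurable cf) => //.
  by move=> x; rewrite /D/= !in_itv/= andbT => /andP[/(lt_le_trans (a0 n))].
have DU : \bigcup_n D n = `]0, c]%classic.
  apply/seteqP; split => x /=.
    by move=> [n _]; rewrite /D/= !in_itv/= => /andP[/(lt_le_trans (a0 n)) -> ->].
  rewrite in_itv/= => /andP[x0 xc]; exists (Num.truncn (c / x)) => //.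
  rewrite /D/= in_itv/= xc andbT ler_pdivrMr// mulrC -ler_pdivrMr//.
  apply/ltW/(lt_trans (Num.Theory.truncnS_gt (c / x))); rewrite ltr_nat//.
rewrite -DU.
apply: (@cvge_to_le nat \oo _ _ (fun n => \int[leb]_(s in D n) (f s)%:E)%E).
  apply: ge0_nondecreasing_set_cvg_integral => //.
  - move=> m n mn; apply/subsetPset => x; rewrite /D/= !in_itv/= => /andP[xm ->].
    rewrite andbT; apply: le_trans xm; rewrite ler_pM2l// lef_pV2 ?posrE// ler_nat//.
  - by move=> n; exact: measurable_itv.
  - move=> n x; rewrite /D/= in_itv/= => /andP[/(lt_le_trans (a0 n)) x0 _].
    by rewrite lee_fin f0.
near=> n.
rewrite (@ftc_derive _ F)//.
- by rewrite lee_fin lerBlDr lerDl F0.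
- by move=> x; rewrite in_itv/= => /andP[/(lt_le_trans (a0 n)) x0 _]; exact: dF.
- apply: continuous_in_subspaceT => x; rewrite inE/= in_itv/= => /andP[/(lt_le_trans (a0 n)) x0 _].
  exact: cf.
Unshelve. all: by end_near. Qed.

Lemma integral_le_ftcy F f (M : R) :
  (forall s : R, 0 < s -> is_derive s (1 : R) F (f s)) ->
  (forall s, 0 < s -> {for s, continuous f}) ->
  (forall s, 0 < s -> 0 <= f s) -> (forall s, 0 < s -> 0 <= F s) ->
  (forall s, 0 < s -> F s <= M) ->
  (\int[leb]_(s in `]0%R, +oo[) (f s)%:E <= M%:E)%E.
Proof.
move=> dF cf f0 F0 FM.
pose D n : set R := `]0, n.+1%:R]%classic.
have DU : \bigcup_n D n = `]0, +oo[%classic.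
  apply/seteqP; split => x /=.
    by move=> [n _]; rewrite /D/= !in_itv/= => /andP[-> _].
  rewrite in_itv/= => /andP[x0 _]; exists (Num.truncn x) => //.
  by rewrite /D/= in_itv/= x0/=; apply/ltW/Num.Theory.truncnS_gt.
rewrite -DU.
apply: (@cvge_to_le nat \oo _ _ (fun n => \int[leb]_(s in D n) (f s)%:E)%E).
  apply: ge0_nondecreasing_set_cvg_integral => //.
  - move=> m n mn; apply/subsetPset => x; rewrite /D/= !in_itv/= => /andP[-> xm]/=.
    by apply: (le_trans xm); rewrite ler_nat.
  - by move=> n; exact: measurable_itv.
  - move=> n; apply/measurable_EFinP; apply: measurable_funS (continuous_pos_measurable cf) => //.
    by move=> x; rewrite /D/= !in_itv/= andbT => /andP[].
  - by move=> n x; rewrite /D/= in_itv/= => /andP[x0 _]; rewrite lee_fin f0.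
near=> n.
apply: (le_trans (integral_le_ftc (ltr0Sn R n) dF cf f0 F0)).
by rewrite lee_fin FM.
Unshelve. all: by end_near. Qed.

(** The classical function [exp (- 1 / x)], flat at 0, with a factor [x^(- k)]: the span of this
    family is stable under differentiation, which makes smoothness an induction. *)
Definition flat (k : nat) (x : R) : R :=
  if 0 < x then x^-1 ^+ k * expR (- x^-1) else 0.

Lemma flat_ge0 k x : 0 <= flat k x.
Proof.
rewrite /flat; case: ifPn => // x0.
by rewrite mulr_ge0 ?expR_ge0 ?exprn_ge0// invr_ge0 ltW.
Qed.

Lemma flat0_gt0 x : 0 < x -> 0 < flat 0 x.
Proof. by move=> x0; rewrite /flat x0 expr0 mul1r expR_gt0. Qed.

Lemma flat_le0 k x : x <= 0 -> flat k x = 0.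
Proof. by rewrite /flat leNgt => /negbTE ->. Qed.

Lemma flat_le k x : flat k x <= k.+1`!%:R * `|x|.
Proof.
rewrite /flat; case: ifPn => x0; last by rewrite mulr_ge0.
rewrite (gtr0_norm x0) expRN.
set y := x^-1; have y0 : 0 < y by rewrite invr_gt0.
have -> : x = y^-1 by rewrite invrK.
rewrite ler_pdivrMr ?expR_gt0// mulrAC ler_pdivlMr// -exprSr.
rewrite mulrC -ler_pdivrMr ?ltr0n ?fact_gt0//.
by apply: le_trans (expR_ge1Dxn k (ltW y0)); rewrite lerDr.
Qed.

(** Only [x = 0] is delicate: the difference quotient from the right is [flat k.+1 h], which tends
    to 0 by [flat_le]. *)
Lemma is_derive_flat k (x : R) :
  is_derive x (1 : R) (flat k) (flat k.+2 x - k%:R * flat k.+1 x).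
Proof.
have [x0|x0|->] := ltgtP x 0.
- rewrite !flat_le0 ?ltW// mulr0 subr0.
  apply: (@near_eq_is_derive _ _ _ (cst 0)).
  by near=> y; rewrite /= flat_le0// ltW//; near: y; exact: lt_nbhsl.
- apply: (@near_eq_is_derive _ _ _ (fun y : R => y^-1 ^+ k * expR (- y^-1))).
    by near=> y; rewrite /flat ifT//; near: y; exact: lt_nbhsr.
  have xn0 : x != 0 by rewrite gt_eqF.
  have dV := is_derive_inv (is_derive_id x (1 : R)) xn0.
  have dE := is_derive_chain (is_derive_expR _) (is_deriveN dV).
  have dX := is_derive_exprn k dV.
  apply: is_derive_eq (is_derive_mul dX dE) _.
  rewrite /flat x0 /GRing.scale/=.
  by case: k {dX} => [|k]; rewrite -?exprVn ?exprS ?expr0 ?fctE/=; ring.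
- rewrite !flat_le0// mulr0 subr0.
  suff H : h^-1 *: (((flat k \o shift 0) (h *: (1 : R)) - flat k 0) : R) @[h --> 0^'] --> (0 : R).
    by apply: DeriveDef; [apply/cvg_ex; exists 0|exact: cvg_lim].
  apply/cvgr0Pnorm_le => e e0; near=> h.
  have hn0 : h != 0 by near: h; exact: nbhs_dnbhs_neq.
  rewrite /= addr0 (flat_le0 _ (lexx 0)) subr0 /GRing.scale/= mulr1.
  have [h0|h0] := ltP 0 h; last by rewrite flat_le0// mulr0 normr0 ltW.
  have -> : h^-1 * flat k h = flat k.+1 h by rewrite /flat h0 exprS mulrA.
  rewrite ger0_norm ?flat_ge0//; apply: (le_trans (flat_le _ _)).
  rewrite mulrC -ler_pdivlMr ?ltr0n ?fact_gt0//; near: h.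
  apply: dnbhs0_le; rewrite divr_gt0// ltr0n fact_gt0//.
Unshelve. all: by end_near. Qed.

(** A smooth transition from 0 on [s <= 1/2] to 1 on [s >= 1]. The flat part reaching up to 1/2
    makes [step (s / e)] vanish around the centre of a disc, and [dstep] is supported in
    [[1/2, 1]]. *)
Definition step (s : R) : R :=
  flat 0 (s - 2^-1) / (flat 0 (s - 2^-1) + flat 0 (1 - s)).

Definition dstep (s : R) : R :=
  (flat 2 (s - 2^-1) * flat 0 (1 - s) + flat 0 (s - 2^-1) * flat 2 (1 - s)) /
  (flat 0 (s - 2^-1) + flat 0 (1 - s)) ^+ 2.

Lemma step_den_gt0 s : 0 < flat 0 (s - 2^-1) + flat 0 (1 - s).
Proof.
have [h|h] := ltP s 1.
  by rewrite ltr_wpDl ?flat_ge0// flat0_gt0// subr_gt0.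
by rewrite ltr_pwDl ?flat_ge0// flat0_gt0//; lra.
Qed.

Lemma step_ge0 s : 0 <= step s.
Proof. by rewrite divr_ge0 ?flat_ge0// ltW// step_den_gt0. Qed.

Lemma step_le1 s : step s <= 1.
Proof. by rewrite ler_pdivrMr ?step_den_gt0// mul1r lerDl flat_ge0. Qed.

Lemma step0 s : s <= 2^-1 -> step s = 0.
Proof. by move=> h; rewrite /step flat_le0 ?mul0r// subr_le0. Qed.

Lemma step1 s : 1 <= s -> step s = 1.
Proof.
move=> h; rewrite /step (@flat_le0 0 (1 - s)) ?subr_le0// addr0 divff//.
by rewrite gt_eqF// flat0_gt0//; lra.
Qed.

Lemma dstep_ge0 s : 0 <= dstep s.
Proof. by rewrite divr_ge0 ?sqr_ge0// addr_ge0// mulr_ge0// flat_ge0. Qed.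

Lemma dstep0 s : s <= 2^-1 -> dstep s = 0.
Proof. by move=> h; rewrite /dstep !(@flat_le0 _ (s - 2^-1)) ?subr_le0// !mul0r addr0 mul0r. Qed.

Lemma dstep1 s : 1 <= s -> dstep s = 0.
Proof. by move=> h; rewrite /dstep !(@flat_le0 _ (1 - s)) ?subr_le0// !mulr0 addr0 mul0r. Qed.

Lemma is_derive_step (s : R) : is_derive s (1 : R) step (dstep s).
Proof.
have d1 k : is_derive s (1:R) (fun s => flat k (s - 2^-1)) (flat k.+2 (s - 2^-1) - k%:R * flat k.+1 (s - 2^-1)).
  rewrite -[X in is_derive _ _ _ X]mulr1; apply: (@is_derive1_comp _ (flat k) (fun s => s - 2^-1)); first exact: is_derive_flat.
  by apply: is_derive_eq (is_deriveB (is_derive_id s (1 : R)) (is_derive_cst (2^-1 : R) s (1 : R))) _; rewrite subr0.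
have d2 k : is_derive s (1:R) (fun s => flat k (1 - s)) (- (flat k.+2 (1 - s) - k%:R * flat k.+1 (1 - s))).
  rewrite -mulrN1; apply: (@is_derive1_comp _ (flat k) (fun s => 1 - s)); first exact: is_derive_flat.
  by apply: is_derive_eq (is_deriveB (is_derive_cst (1 : R) s (1 : R)) (is_derive_id s (1 : R))) _; rewrite sub0r.
have := step_den_gt0 s; have := d1 0%N; have := d2 0%N.
rewrite !mul0r !subr0 /step /dstep => e1 e2 h.
have := is_derive_mul e2 (is_derive_inv (is_derive_add e2 e1) (lt0r_neq0 h)).
move=> e3; apply: is_derive_eq e3 _.
rewrite /GRing.scale/=; field; exact: lt0r_neq0.
Qed.

Lemma continuous_flat k : continuous (flat k).
Proof. by move=> x; apply: is_derive1_continuous; exact: is_derive_flat. Qed.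

Lemma continuous_dstep : continuous dstep.
Proof.
have c1 k : continuous (fun s : R => flat k (s - 2^-1)).
  apply: continuous_fcomp; last exact: continuous_flat.
  by apply: continuous_sub; [move=> x; exact: cvg_id|exact: cst_continuous].
have c2 k : continuous (fun s : R => flat k (1 - s)).
  apply: continuous_fcomp; last exact: continuous_flat.
  by apply: continuous_sub; [exact: cst_continuous|move=> x; exact: cvg_id].
apply: continuous_mul.
  by apply: continuous_add; apply: continuous_mul.
move=> x; apply: (@cvgV R); first by rewrite expf_neq0// gt_eqF// step_den_gt0.
apply: (@continuous_exprn R R (fun s => flat 0 (s - 2^-1) + flat 0 (1 - s))).
exact: continuous_add.
Qed.

Lemma dstep_bounded : exists C : R, 0 < C /\ forall s, dstep s <= C.
Proof.
have [c _ H] := @EVT_max R dstep 0 1 ler01 (continuous_subspaceT continuous_dstep).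
exists (dstep c + 1); split; first by rewrite ltr_wpDl// dstep_ge0.
move=> s; have [s0|s0] := leP s 0; first by rewrite dstep0 ?addr_ge0 ?dstep_ge0//; lra.
have [s1|s1] := leP 1 s; first by rewrite dstep1 ?addr_ge0 ?dstep_ge0.
by apply: (le_trans (H s _)); rewrite ?lerDl// in_itv/= ltW// ltW.
Qed.

End calculus.

(** * Smoothness calculus in the plane *)

Section Ck.
Variable R : realType.
Implicit Types (f g : R * R -> R).
Local Notation e1 := ((1, 0) : R * R).
Local Notation e2 := ((0, 1) : R * R).

(** [Ck2 n] requires continuity only of the derivatives of order [n]. Collecting all orders up to
    [n] gives a predicate that can be carried through inductions on products and compositions. *)
Definition Ck2_upto (n : nat) f := forall j, (j <= n)%N -> Ck2 j f.

Lemma Ck2_uptoS n f (d1 d2 : R * R -> R) : continuous f ->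
  (forall x, is_derive x e1 f (d1 x)) -> (forall x, is_derive x e2 f (d2 x)) ->
  Ck2_upto n d1 -> Ck2_upto n d2 -> Ck2_upto n.+1 f.
Proof.
move=> cf D1 D2 c1 c2 [|j] // jn /=.
have -> : partial1 f = d1 by apply/funext => x; case: (D1 x).
have -> : partial2 f = d2 by apply/funext => x; case: (D2 x).
by split; [move=> x; case: (D1 x)|move=> x; case: (D2 x)|exact: c1|exact: c2].
Qed.

Lemma Ck2_upto_is_derive n f : Ck2_upto n.+1 f ->
  [/\ forall x, is_derive x e1 f (partial1 f x),
      forall x, is_derive x e2 f (partial2 f x),
      Ck2_upto n (partial1 f) & Ck2_upto n (partial2 f)].
Proof.
move=> cf; have [d1 d2 _ _] := cf n.+1 (leqnn _).
split; [by move=> x; split|by move=> x; split| |].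
  by move=> j jn; have [] := cf j.+1 jn.
by move=> j jn; have [] := cf j.+1 jn.
Qed.

Lemma Ck2_uptoW n f : Ck2_upto n.+1 f -> Ck2_upto n f.
Proof. by move=> cf j jn; apply: cf; exact: leqW. Qed.

Lemma Ck2_upto_continuous n f : Ck2_upto n f -> continuous f.
Proof. by move=> /(_ 0%N (leq0n _)). Qed.

Lemma Ck2_upto0 f : continuous f -> Ck2_upto 0 f.
Proof. by move=> cf [|]. Qed.

Lemma Ck2_upto_cst n (c : R) : Ck2_upto n (fun=> c).
Proof.
elim: n c => [|n IH] c; first by apply: Ck2_upto0; exact: cst_continuous.
by apply: (@Ck2_uptoS _ _ (fun=> 0) (fun=> 0)) => //; try exact: cst_continuous;
  move=> x; exact: is_derive_cst.
Qed.

Lemma Ck2_upto_add n f g : Ck2_upto n f -> Ck2_upto n g -> Ck2_upto n (fun x => f x + g x).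
Proof.
elim: n f g => [|n IH] f g cf cg.
  by apply: Ck2_upto0; apply: continuous_add; apply: Ck2_upto_continuous; eassumption.
have [f1 f2 cf1 cf2] := Ck2_upto_is_derive cf.
have [g1 g2 cg1 cg2] := Ck2_upto_is_derive cg.
apply: (Ck2_uptoS _ _ _ (IH _ _ cf1 cg1) (IH _ _ cf2 cg2)).
  by apply: continuous_add; apply: Ck2_upto_continuous; eassumption.
all: by move=> x; exact: is_derive_add.
Qed.

Lemma Ck2_upto_mul n f g : Ck2_upto n f -> Ck2_upto n g -> Ck2_upto n (fun x => f x * g x).
Proof.
elim: n f g => [|n IH] f g cf cg.
  by apply: Ck2_upto0; apply: continuous_mul; apply: Ck2_upto_continuous; eassumption.
have [f1 f2 cf1 cf2] := Ck2_upto_is_derive cf.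
have [g1 g2 cg1 cg2] := Ck2_upto_is_derive cg.
have cf' := Ck2_uptoW cf; have cg' := Ck2_uptoW cg.
apply: (Ck2_uptoS _ _ _ (Ck2_upto_add (IH _ _ cf' cg1) (IH _ _ cg' cf1))
                        (Ck2_upto_add (IH _ _ cf' cg2) (IH _ _ cg' cf2))).
  by apply: continuous_mul; apply: Ck2_upto_continuous; eassumption.
all: by move=> x; exact: is_derive_mul.
Qed.

Lemma Ck2_upto_opp n f : Ck2_upto n f -> Ck2_upto n (fun x => - f x).
Proof.
move=> cf; under eq_fun do rewrite -mulN1r.
by apply: Ck2_upto_mul => //; exact: Ck2_upto_cst.
Qed.

Lemma Ck2_upto_sub n f g : Ck2_upto n f -> Ck2_upto n g -> Ck2_upto n (fun x => f x - g x).
Proof. by move=> cf cg; apply: Ck2_upto_add => //; exact: Ck2_upto_opp. Qed.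

Lemma Ck2_upto_inv n g : (forall x, g x != 0) -> Ck2_upto n g ->
  Ck2_upto n (fun x => (g x)^-1).
Proof.
move=> g0; have cV : continuous g -> continuous (fun x => (g x)^-1).
  by move=> cg x; apply: (@cvgV R); [exact: g0|exact: cg].
elim: n => [|n IH] cg; first by apply: Ck2_upto0; apply: cV; exact: Ck2_upto_continuous cg.
have [g1 g2 cg1 cg2] := Ck2_upto_is_derive cg.
have cg' := Ck2_uptoW cg.
have c2 : Ck2_upto n (fun x => - (g x) ^- 2).
  apply: Ck2_upto_opp; under eq_fun do rewrite exprS expr1 invfM.
  by apply: Ck2_upto_mul; exact: IH.
apply: (Ck2_uptoS _ _ _ (Ck2_upto_mul c2 cg1) (Ck2_upto_mul c2 cg2)).
- by apply: cV; exact: Ck2_upto_continuous cg.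
- by move=> x; exact: is_derive_inv.
- by move=> x; exact: is_derive_inv.
Qed.

(** Differentiation raises the index [k], so the induction on [n] keeps [k] general. *)
Lemma Ck2_upto_flat n k g : Ck2_upto n g -> Ck2_upto n (fun x => flat k (g x)).
Proof.
have cF i : continuous g -> continuous (fun x => flat i (g x)).
  by move=> cg; apply: continuous_fcomp => //; exact: continuous_flat.
elim: n k => [|n IH] k cg; first by apply: Ck2_upto0; apply: cF; exact: Ck2_upto_continuous cg.
have [g1 g2 cg1 cg2] := Ck2_upto_is_derive cg.
have cg' := Ck2_uptoW cg.
have c2 : Ck2_upto n (fun x => flat k.+2 (g x) - k%:R * flat k.+1 (g x)).
  apply: Ck2_upto_sub; first exact: IH.
  by apply: Ck2_upto_mul; [exact: Ck2_upto_cst|exact: IH].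
apply: (Ck2_uptoS _ _ _ (Ck2_upto_mul c2 cg1) (Ck2_upto_mul c2 cg2)).
- by apply: cF; exact: Ck2_upto_continuous cg.
- by move=> x; apply: is_derive_chain => //; exact: is_derive_flat.
- by move=> x; apply: is_derive_chain => //; exact: is_derive_flat.
Qed.

Lemma is_derive_affine (a b s : R) : is_derive s (1 : R) (fun h => h * a + b) a.
Proof.
have dM := is_derive_mul (is_derive_id s (1 : R)) (is_derive_cst (a : R) s (1 : R)).
apply: is_derive_eq (is_derive_add dM (is_derive_cst (b : R) s (1 : R))) _.
by rewrite /= mulr0 addr0 add0r mulr1.
Qed.

Lemma is_derive_fst (x v : R * R) : is_derive x v (fun y : R * R => y.1) v.1.
Proof.
apply/is_derive_line => /=.
exact: is_derive_affine.
Qed.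

Lemma is_derive_snd (x v : R * R) : is_derive x v (fun y : R * R => y.2) v.2.
Proof.
apply/is_derive_line => /=.
exact: is_derive_affine.
Qed.

Lemma Ck2_upto_fst n : Ck2_upto n (fun x : R * R => x.1).
Proof.
have c : continuous (fun x : R * R => x.1) by move=> x; exact: cvg_fst.
case: n => [|n]; first exact: Ck2_upto0.
by apply: (Ck2_uptoS c _ _ (@Ck2_upto_cst n 1) (@Ck2_upto_cst n 0)) => x; exact: is_derive_fst.
Qed.

Lemma Ck2_upto_snd n : Ck2_upto n (fun x : R * R => x.2).
Proof.
have c : continuous (fun x : R * R => x.2) by move=> x; exact: cvg_snd.
case: n => [|n]; first exact: Ck2_upto0.
by apply: (Ck2_uptoS c _ _ (@Ck2_upto_cst n 0) (@Ck2_upto_cst n 1)) => x; exact: is_derive_snd.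
Qed.

Lemma Ck2_upto_sqdist n (c : R * R) : Ck2_upto n (fun x => sqdist x c).
Proof.
have d1 : Ck2_upto n (fun x : R * R => x.1 - c.1).
  by apply: Ck2_upto_sub; [exact: Ck2_upto_fst|exact: Ck2_upto_cst].
have d2 : Ck2_upto n (fun x : R * R => x.2 - c.2).
  by apply: Ck2_upto_sub; [exact: Ck2_upto_snd|exact: Ck2_upto_cst].
rewrite /sqdist; under eq_fun do rewrite !expr2.
by apply: Ck2_upto_add; exact: Ck2_upto_mul.
Qed.

Lemma is_derive_sqdist (c x v : R * R) :
  is_derive x v (fun y => sqdist y c) (2 * (x.1 - c.1) * v.1 + 2 * (x.2 - c.2) * v.2).
Proof.
have d1 := is_derive_sub (is_derive_fst x v) (is_derive_cst (c.1 : R) x v).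
have d2 := is_derive_sub (is_derive_snd x v) (is_derive_cst (c.2 : R) x v).
apply: is_derive_eq (is_derive_add (is_derive_exprn 2 d1) (is_derive_exprn 2 d2)) _.
by rewrite /= !subr0 !expr1.
Qed.

Lemma Ck2_upto_step n g : Ck2_upto n g -> Ck2_upto n (fun x => step (g x)).
Proof.
move=> cg.
have cA : Ck2_upto n (fun x => flat 0 (g x - 2^-1)).
  by apply: Ck2_upto_flat; apply: Ck2_upto_sub => //; exact: Ck2_upto_cst.
have cB : Ck2_upto n (fun x => flat 0 (1 - g x)).
  by apply: Ck2_upto_flat; apply: Ck2_upto_sub => //; exact: Ck2_upto_cst.
apply: Ck2_upto_mul => //; apply: Ck2_upto_inv; last exact: Ck2_upto_add.
by move=> x; rewrite gt_eqF// step_den_gt0.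
Qed.

End Ck.

(** * Radial test fields *)

Section field.
Variable R : realType.
Variables (e r : R).
Hypotheses (e0 : 0 < e) (er : e <= r).
Let r0 : 0 < r := lt_le_trans e0 er.
Let pi0 : 0 < pi :> R := pi_gt0 R.
Let pn0 : pi != 0 :> R := lt0r_neq0 pi0.
Local Notation e1 := ((1, 0) : R * R).
Local Notation e2 := ((0, 1) : R * R).

(* [cutden] agrees with the identity wherever [step (s / e)] is nonzero and never
   vanishes, so that [profile] is [(step (s / e) - step (s / r)) / (2 pi s)], smooth at 0. *)
Definition cutden (s : R) : R := s * step (2 * s / e) + (1 - step (2 * s / e)).

Definition profile (s : R) : R :=
  (step (s / e) - step (s / r)) / (2 * pi * cutden s).

(** [cutden s] is a convex combination of [s] and 1, and [s] enters with nonzero weight only when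
    [2 s / e > 1/2], in particular for [s > 0]. *)
Lemma cutden_gt0 s : 0 < cutden s.
Proof.
rewrite /cutden; have [h|h] := leP (2 * s / e) 2^-1.
  by rewrite step0// mulr0 subr0 add0r.
have s0 : 0 < s.
  by have : 0 < 2 * s / e; [lra|rewrite pmulr_lgt0 ?invr_gt0// pmulr_rgt0].
have h1 := step_ge0 (2 * s / e); have h2 := step_le1 (2 * s / e).
have [h3|h3] := ltP (step (2 * s / e)) 1.
  by rewrite ltr_wpDl ?subr_gt0// mulr_ge0// ltW.
have -> : step (2 * s / e) = 1 by apply/le_anti; rewrite h2 h3.
by rewrite mulr1 subrr addr0.
Qed.

(** The factor 2 inside [step (2 * s / e)] completes this transition at [s = e / 2], exactly where
    [step (s / e)] begins to rise. *)
Lemma cutden_id s : e / 2 <= s -> cutden s = s.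
Proof.
move=> h; rewrite /cutden step1; first by rewrite mulr1 subrr addr0.
by rewrite ler_pdivlMr// mul1r mulrC -ler_pdivrMr.
Qed.

Lemma step_diff0 s : s < e / 2 -> step (s / e) - step (s / r) = 0.
Proof.
move=> h; rewrite !step0 ?subrr// ler_pdivrMr// mulrC ltW//.
by apply: lt_le_trans h _; rewrite ler_pM2r// invr_gt0.
Qed.

Lemma step_diff0r s : r <= s -> step (s / e) - step (s / r) = 0.
Proof.
move=> h; rewrite !step1 ?subrr//; rewrite ler_pdivlMr// mul1r//.
exact: le_trans h.
Qed.

Lemma mul_profile s : s * profile s = (step (s / e) - step (s / r)) / (2 * pi).
Proof.
rewrite /profile; have [h|h] := ltP s (e / 2).
  by rewrite step_diff0// !mul0r mulr0.
rewrite cutden_id//; have s0 : s != 0 by rewrite gt_eqF//; apply: lt_le_trans h; rewrite divr_gt0.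
by move: (pn0); move: (@pi R) => q qn0; field; rewrite s0 qn0.
Qed.

Lemma is_derive_scaled_step (s k : R) :
  is_derive s (1 : R) (fun s => step (s / k)) (dstep (s / k) / k).
Proof.
apply: is_derive_chain; first exact: is_derive_step.
have := is_derive_affine k^-1 0 s.
by under eq_fun do rewrite addr0.
Qed.

Lemma profile_derivable (s : R) : derivable profile s (1 : R).
Proof.
have dS := is_derive_sub (is_derive_scaled_step s e) (is_derive_scaled_step s r).
have d2 : is_derive s (1 : R) (fun s => step (2 * s / e)) (2 * (dstep (2 * s / e) / e)).
  have dl : is_derive s (1 : R) (fun s => 2 * s / e) (2 / e).
    have := is_derive_affine (2 / e) 0 s; under eq_fun do rewrite addr0 mulrCA mulrA; exact.
  by apply: is_derive_eq (is_derive_chain (is_derive_step _) dl) _; ring.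
have dq := is_derive_add (is_derive_mul (is_derive_id s (1 : R)) d2)
  (is_derive_sub (is_derive_cst (1 : R) s (1 : R)) d2).
have dp := is_derive_mul (is_derive_cst (2 * pi : R) s (1 : R)) dq.
have [] // := is_derive_mul dS (is_derive_inv dp _).
by apply: lt0r_neq0; rewrite mulr_gt0 ?cutden_gt0//; exact: mulr_gt0 (ltr0Sn _ 1) pi0.
Qed.

Let dprofile (s : R) : R := 'D_1 profile s.

Let is_derive_profile (s : R) : is_derive s (1 : R) profile (dprofile s).
Proof. by split => //; exact: profile_derivable. Qed.

(** The left side is the planar divergence of [(y - c) * profile (|y - c|^2)]. It equals twice the
    derivative of [s * profile s], which [mul_profile] makes explicit. *)
Lemma profile_divergence (s : R) : 2 * profile s + 2 * s * dprofile s =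
  dstep (s / e) / (pi * e) - dstep (s / r) / (pi * r).
Proof.
have [_ h1] := is_derive_mul (is_derive_id s (1 : R)) (is_derive_profile s).
have [_ h2] := is_derive_mul (is_derive_sub (is_derive_scaled_step s e) (is_derive_scaled_step s r)) (is_derive_cst ((2 * pi)^-1 : R) s (1 : R)).
have E : (fun s => s * profile s) = (fun s => (step (s / e) - step (s / r)) / (2 * pi)).
  by apply/funext => t; exact: mul_profile.
have {h1 h2} h : s * dprofile s + profile s * 1 = (step (s / e) - step (s / r)) * 0 + (2 * pi)^-1 * (dstep (s / e) / e - dstep (s / r) / r).
  by rewrite -h1 -h2; congr ('D_1 _ s); exact: E.
rewrite mulr1 mulr0 add0r in h.
rewrite -mulrA -mulrDr addrC h.
by move: (pn0); move: (@pi R) => q qn0; field; rewrite qn0 !gt_eqF.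
Qed.

Lemma profile0 s : r <= s -> profile s = 0.
Proof. by move=> h; rewrite /profile step_diff0r// mul0r. Qed.

Lemma dprofile0 s : r < s -> dprofile s = 0.
Proof.
move=> h; have := is_derive_cst (0 : R) s (1 : R).
have nE : \near s, (cst 0 : R -> R) s = profile s.
  near=> t; rewrite profile0//; apply: ltW; near: t; exact: lt_nbhsr.
by move=> /(near_eq_is_derive nE)[].
Unshelve. all: by end_near. Qed.

(** With [e <= r / 2] the two transitions do not overlap: for [s < e] the step at scale [r] is still
    0, and for [s >= e] the step at scale [e] is already 1. Hence their difference lies in
    [[0, 1]]. *)
Lemma profile_le s : 0 < s -> e <= r / 2 -> 0 <= profile s <= (2 * pi * s)^-1.
Proof.
move=> s0 er2.
have H : s != 0 by rewrite gt_eqF.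
have -> : profile s = (step (s / e) - step (s / r)) * (2 * pi * s)^-1.
  by apply: (mulfI H); rewrite mul_profile; move: (pn0); move: (@pi R) => q qn0; field; rewrite H qn0.
have i0 : 0 < (2 * pi * s)^-1 by rewrite invr_gt0; exact: mulr_gt0 (mulr_gt0 (ltr0Sn _ 1) pi0) s0.
have m : 0 <= step (s / e) - step (s / r) <= 1.
  have [h|h] := leP e s.
    have -> : step (s / e) = 1 by rewrite step1// ler_pdivlMr// mul1r.
    by rewrite subr_ge0 step_le1/= gerBl step_ge0.
  have -> : step (s / r) = 0 by rewrite step0// ler_pdivrMr//; lra.
  by rewrite subr0 step_ge0 step_le1.
move: m => /andP[m1 m2]; apply/andP; split; first exact: mulr_ge0 m1 (ltW i0).
by rewrite ger_pMl.
Qed.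

Variable c : R * R.

Definition field1 (y : R * R) : R := (y.1 - c.1) * profile (sqdist y c).
Definition field2 (y : R * R) : R := (y.2 - c.2) * profile (sqdist y c).

Lemma Ck2_upto_profile n : Ck2_upto n (fun y => profile (sqdist y c)).
Proof.
have cs k : Ck2_upto n (fun y => step (sqdist y c / k)).
  by apply: Ck2_upto_step; apply: Ck2_upto_mul; [exact: Ck2_upto_sqdist|exact: Ck2_upto_cst].
have c2 : Ck2_upto n (fun y => step (2 * sqdist y c / e)).
  apply: Ck2_upto_step; apply: Ck2_upto_mul; last exact: Ck2_upto_cst.
  by apply: Ck2_upto_mul; [exact: Ck2_upto_cst|exact: Ck2_upto_sqdist].
apply: Ck2_upto_mul; first exact: Ck2_upto_sub.
apply: Ck2_upto_inv.
  by move=> x; apply: lt0r_neq0; rewrite mulr_gt0 ?cutden_gt0//; exact: mulr_gt0 (ltr0Sn _ 1) pi0.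
apply: Ck2_upto_mul; first exact: Ck2_upto_cst.
apply: Ck2_upto_add; first by apply: Ck2_upto_mul => //; exact: Ck2_upto_sqdist.
by apply: Ck2_upto_sub => //; exact: Ck2_upto_cst.
Qed.

Lemma sqdist_lt_compact (phi : R * R -> R) :
  (forall y, r <= sqdist y c -> phi y = 0) -> compact (closure [set y | phi y != 0]).
Proof.
move=> phi0; pose t := Num.sqrt r.
pose B : set (R * R) := `[c.1 - t, c.1 + t]%classic `*` `[c.2 - t, c.2 + t]%classic.
have cB : compact B by apply: compact_setX; exact: segment_compact.
apply: (subclosed_compact _ cB); first exact: closed_closure.
have clB : closed B by apply: compact_closed => //; exact: norm_hausdorff.
rewrite [X in _ `<=` X](closure_id B).1//; apply: closureS => y /= yn.
have yr : sqdist y c < r by rewrite ltNge; apply: contra yn => /phi0 ->.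
have H (a b : R) : (a - b) ^+ 2 < r -> a \in `[b - t, b + t].
  rewrite -ltr_sqrt// sqrtr_sqr ltr_norml => /andP[h1 h2].
  by rewrite in_itv/=; apply/andP; rewrite /t; split; lra.
split; apply: H; apply: le_lt_trans yr; rewrite /sqdist.
  by rewrite lerDl sqr_ge0.
by rewrite lerDr sqr_ge0.
Qed.

Lemma test_function_field1 : test_function2 field1.
Proof.
split; last by apply: sqdist_lt_compact => y h; rewrite /field1 profile0// mulr0.
move=> k; apply: (_ : Ck2_upto k _) => //; apply: Ck2_upto_mul; last exact: Ck2_upto_profile.
by apply: Ck2_upto_sub; [exact: Ck2_upto_fst|exact: Ck2_upto_cst].
Qed.

Lemma test_function_field2 : test_function2 field2.
Proof.
split; last by apply: sqdist_lt_compact => y h; rewrite /field2 profile0// mulr0.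
move=> k; apply: (_ : Ck2_upto k _) => //; apply: Ck2_upto_mul; last exact: Ck2_upto_profile.
by apply: Ck2_upto_sub; [exact: Ck2_upto_snd|exact: Ck2_upto_cst].
Qed.

Let partial1_field1 y : partial1 field1 y =
  profile (sqdist y c) + 2 * (y.1 - c.1) ^+ 2 * dprofile (sqdist y c).
Proof.
have d1 : is_derive y e1 (fun y : R * R => y.1 - c.1) (1 - 0).
  exact: is_derive_sub (is_derive_fst y e1) (is_derive_cst (c.1 : R) y e1).
have d2 := is_derive_chain (g := fun y => sqdist y c) (is_derive_profile (sqdist y c)) (is_derive_sqdist c y e1).
have [_ h] := is_derive_mul d1 d2; rewrite [LHS]h /=; ring.
Qed.

Let partial2_field2 y : partial2 field2 y =
  profile (sqdist y c) + 2 * (y.2 - c.2) ^+ 2 * dprofile (sqdist y c).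
Proof.
have d1 : is_derive y e2 (fun y : R * R => y.2 - c.2) (1 - 0).
  exact: is_derive_sub (is_derive_snd y e2) (is_derive_cst (c.2 : R) y e2).
have d2 := is_derive_chain (g := fun y => sqdist y c) (is_derive_profile (sqdist y c)) (is_derive_sqdist c y e2).
have [_ h] := is_derive_mul d1 d2; rewrite [LHS]h /=; ring.
Qed.

Lemma field_divergence y : partial1 field1 y + partial2 field2 y =
  dstep (sqdist y c / e) / (pi * e) - dstep (sqdist y c / r) / (pi * r).
Proof.
rewrite partial1_field1 partial2_field2 -profile_divergence [in RHS]/sqdist; ring.
Qed.

Lemma partial1_field1_0 y : r < sqdist y c -> partial1 field1 y = 0.
Proof. by move=> h; rewrite partial1_field1 profile0 ?ltW// dprofile0// mulr0 addr0. Qed.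

Lemma partial2_field2_0 y : r < sqdist y c -> partial2 field2 y = 0.
Proof. by move=> h; rewrite partial2_field2 profile0 ?ltW// dprofile0// mulr0 addr0. Qed.

End field.

(** * Mollification against the weak gradient *)

Section mollifier.
Variable R : realType.
Local Notation T2 := (measurableTypeR R * measurableTypeR R)%type.
Local Notation leb := (@lebesgue_measure R).
Implicit Types (u phi : R * R -> R) (e r s : R).

Lemma measurable_fcomp d (T : measurableType d) (f : T -> R) (g : R -> R) :
  measurable_fun setT f -> measurable_fun setT g -> measurable_fun setT (fun x => g (f x)).
Proof. by move=> mf mg; exact: (measurableT_comp mg mf). Qed.

Lemma integral_vanish d (T : measurableType d) (mu : {measure set T -> \bar R})
    (D : set T) (f : T -> \bar R) : (forall x, ~ D x -> f x = 0%E) ->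
  (\int[mu]_x f x = \int[mu]_(x in D) f x)%E.
Proof.
move=> f0; rewrite [RHS]integral_mkcond; apply: eq_integral => x _; rewrite patchE.
by case: ifPn => // /negP xD; apply: f0 => Dx; apply: xD; rewrite inE.
Qed.

Lemma measurable_sqdist_comp (c : R * R) (h : R -> R) : measurable_fun setT h ->
  measurable_fun (setT : set T2) (fun y => h (sqdist y c)).
Proof. by apply: measurable_fcomp; exact: measurable_sqdist. Qed.

Lemma sqdist_box (N : nat) (r : R) : exists n : nat, forall c, box N c ->
  forall y, sqdist y c <= r -> box n y.
Proof.
exists (N + (Num.truncn (Num.sqrt r)).+1)%N => c /boxP[c1 c2] y h; apply/boxP.
have := Num.Theory.truncnS_gt (Num.sqrt r); set t := _.+1%:R => rt.
rewrite natrD -/t.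
have H (a b : R) : `|b| <= N%:R -> (a - b) ^+ 2 <= r -> `|a| <= N%:R + t.
  move=> bN ab; have r0 : 0 <= r := le_trans (sqr_ge0 _) ab.
  have : `|a - b| <= Num.sqrt r by rewrite -sqrtr_sqr ler_sqrt.
  have := ler_normD (a - b) b; rewrite subrK => h1 h2.
  apply: (le_trans h1); rewrite addrC lerD//.
  by apply: (le_trans h2); exact: ltW.
split; [apply: H c1 _|apply: H c2 _]; apply: le_trans h; rewrite /sqdist ?lerDl ?lerDr sqr_ge0//.
Qed.

Lemma integrable_mul_bounded u phi (C : R) n : loc_integrable2 u ->
  measurable_fun (setT : set T2) phi -> (forall y, `|phi y| <= C) ->
  (forall y, ~ box n y -> phi y = 0) ->
  (@leb2 R).-integrable setT (fun y => (u y * phi y)%:E).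
Proof.
move=> lu mphi phiC phi0; have mu := loc_integrable2_measurable lu.
have mup : measurable_fun (setT : set T2) (fun y => (u y * phi y)%:E).
  by apply/measurable_EFinP; exact: measurable_funM.
have -> : (fun y => (u y * phi y)%:E) = (fun y => (u y * phi y)%:E) \_ (@box R n) :> (T2 -> \bar R).
  apply/funext => y; rewrite patchE; case: ifPn => // /negP yn.
  by rewrite phi0 ?mulr0// => bn; apply: yn; rewrite inE.
apply/(integrable_restrict _ (measurable_box n) measurableT); rewrite setTI.
apply: (le_integrable (measurable_box n) _ _ (integrableZl (measurable_box n) C (loc_integrable2_box n lu))).
  exact: measurable_funTS.
move=> y _; rewrite lee_fin normrM mulrC normrM ler_wpM2r//.
by apply: (le_trans (phiC y)); rewrite ler_norm.
Qed.

Lemma continuous_box_bounded phi n : continuous phi ->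
  exists C : R, forall y, box n y -> `|phi y| <= C.
Proof.
move=> cphi; have : compact (phi @` (@box R n)).
  apply: continuous_compact; last exact: compact_box.
  exact: continuous_subspaceT.
move=> /compact_bounded[M [_ /(_ (`|M| + 1))]] /(_ ltac:(rewrite ltr_pwDr// ler_norm)) H.
by exists (`|M| + 1) => y yn; apply: (H isT); exists y.
Qed.

Lemma integrable_mul_compact u phi n : loc_integrable2 u -> continuous phi ->
  (forall y, ~ box n y -> phi y = 0) ->
  (@leb2 R).-integrable setT (EFin \o (fun y => u y * phi y)).
Proof.
move=> lu cphi phi0; have [C HC] := continuous_box_bounded n cphi.
apply: (@integrable_mul_bounded _ _ `|C| n lu _ _ phi0).
  exact: continuous_measurable2.
move=> y; have [yn|yn] := pselect (box n y); first exact: le_trans (HC y yn) (ler_norm C).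
by rewrite phi0// normr0.
Qed.

(** [dstep (s / e) / e] is a probability density in the squared distance [s]; dividing by [pi]
    compensates the factor of [radial_integral], so the mass in the plane is 1. *)
Definition moll e s : R := dstep (s / e) / (pi * e).

Lemma moll_ge0 e s : 0 < e -> 0 <= moll e s.
Proof. by move=> e0; rewrite divr_ge0 ?dstep_ge0// mulr_ge0 ?pi_ge0// ltW. Qed.

Lemma moll0 e s : 0 < e -> e <= s -> moll e s = 0.
Proof. by move=> e0 es; rewrite /moll dstep1 ?mul0r// ler_pdivlMr// mul1r. Qed.

Lemma moll_le0 e s : 0 < e -> s <= 0 -> moll e s = 0.
Proof.
move=> e0 s0; rewrite /moll dstep0 ?mul0r// ler_pdivrMr//.
by apply: (le_trans s0); rewrite mulr_ge0// ltW.
Qed.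

Lemma moll_bounded : exists C : R, 0 < C /\ forall e s, 0 < e -> moll e s <= C / e.
Proof.
have [C [C0 HC]] := dstep_bounded R.
exists (C / pi); split; first by rewrite divr_gt0 ?pi_gt0.
move=> e s e0; rewrite /moll invfM mulrA ler_wpM2r// ?invr_ge0 ?(ltW e0)//.
by rewrite ler_wpM2r// invr_ge0 pi_ge0.
Qed.

Lemma continuous_moll e : continuous (moll e).
Proof.
apply: continuous_mul; last exact: cst_continuous.
apply: continuous_fcomp; last exact: continuous_dstep.
by apply: continuous_mul; [move=> x; exact: cvg_id|exact: cst_continuous].
Qed.

Lemma measurable_moll e : measurable_fun setT (moll e).
Proof. apply: continuous_measurable_fun; exact: continuous_moll. Qed.

Lemma integral_moll (c : R * R) e : 0 < e ->
  (\int[@leb2 R]_y (moll e (sqdist y c))%:E = 1)%E.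
Proof.
move=> e0; have m := measurable_moll e.
rewrite (radial_integral c (h := EFin \o moll e)); first last.
- by move=> s; rewrite lee_fin moll_ge0.
- exact/measurable_EFinP.
have -> : (\int[leb]_(s in `]0%R, +oo[) (EFin \o moll e) s = \int[leb]_(s in `[0%R, e]) (moll e s)%:E)%E.
  transitivity (\int[leb]_s (moll e s)%:E)%E.
    apply/esym/integral_vanish => s /=; rewrite in_itv/= andbT => /negP.
    by rewrite -leNgt => s0; rewrite moll_le0.
  apply/integral_vanish => s /=; rewrite in_itv/= => /negP; rewrite negb_and -!ltNge => /orP[s0|es].
    by rewrite moll_le0// ltW.
  by rewrite moll0// ltW.
rewrite (@ftc_derive _ (fun s => step (s / e) / pi))//.
- rewrite mul0r divff ?gt_eqF// step1// step0 ?invr_ge0// mul0r subr0 mul1r -EFinM.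
  by rewrite divff// gt_eqF// pi_gt0.
- move=> s _; apply: is_derive_eq (is_derive_mul (is_derive_scaled_step s e) (is_derive_cst (pi^-1 : R) s (1 : R))) _.
  by rewrite mulr0 add0r /moll invfM/=; ring.
- exact/continuous_subspaceT/continuous_moll.
Qed.

Lemma moll_sqdist_box (c : R * R) e : 0 < e ->
  exists n, forall y, ~ box n y -> moll e (sqdist y c) = 0.
Proof.
move=> e0; have [N cN] := box_cover c; have [n H] := sqdist_box N e.
exists n => y yn; rewrite moll0// leNgt; apply/negP => /ltW h.
by apply: yn; exact: H h.
Qed.

Lemma integrable_moll u (c : R * R) e : loc_integrable2 u -> 0 < e ->
  (@leb2 R).-integrable setT (fun y => (u y * moll e (sqdist y c))%:E).
Proof.
move=> lu e0; have [C [C0 HC]] := moll_bounded.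
have [n Hn] := moll_sqdist_box c e0.
apply: (@integrable_mul_bounded _ _ (C / e) n) => //.
- by apply: measurable_sqdist_comp; exact: measurable_moll.
- by move=> y; rewrite ger0_norm ?moll_ge0// HC.
Qed.

(** As a function of the squared distance [s], this is [1 / (2 pi |y - x|)], the length of the
    gradient of the planar Newtonian potential, cut off at squared radius [r]. *)
Definition riesz r s : R := if s < r then (2 * pi)^-1 * s `^ (- 2^-1) else 0.

Lemma measurable_cut r (h : R -> R) : measurable_fun setT h ->
  measurable_fun setT (fun s => if s < r then h s else 0).
Proof.
by move=> mh; apply: measurable_fun_ifT => //; exact: measurable_fun_ltr.
Qed.

Lemma measurable_riesz r : measurable_fun setT (riesz r).
Proof.
apply: (@measurable_cut r (fun s => (2 * pi)^-1 * s `^ (- 2^-1))).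
by apply: measurable_funM => //; exact: measurable_powR.
Qed.

Lemma riesz_ge0 r s : 0 <= riesz r s.
Proof.
rewrite /riesz; case: ifP => // _; rewrite mulr_ge0 ?powR_ge0//.
by rewrite invr_ge0 mulr_ge0// pi_ge0.
Qed.

Lemma measurable_enorm2 (g : R * R -> R * R) :
  measurable_fun (setT : set T2) (fun y => (g y).1) ->
  measurable_fun (setT : set T2) (fun y => (g y).2) ->
  measurable_fun (setT : set T2) (fun y => enorm2 (g y)).
Proof.
move=> m1 m2; apply: measurable_fcomp; last first.
  apply: continuous_measurable_fun; exact: sqrt_continuous.
by apply: measurable_funD; exact: measurable_funX.
Qed.

Lemma cauchy_schwarz2 (a b c d : R) : `|a * c + b * d| <=
  Num.sqrt (a ^+ 2 + b ^+ 2) * Num.sqrt (c ^+ 2 + d ^+ 2).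
Proof.
rewrite -sqrtrM ?addr_ge0 ?sqr_ge0// -sqrtr_sqr ler_wsqrtr//.
by have := sqr_ge0 (a * d - b * c); nra.
Qed.

Lemma weak_gradient_moll u g (c : R * R) e r : loc_integrable2 u ->
  is_weak_gradient u g -> 0 < e -> e <= r / 2 ->
  (`| \int[@leb2 R]_y (u y * moll e (sqdist y c))%R |%:E <=
   `| \int[@leb2 R]_y (u y * moll r (sqdist y c))%R |%:E +
   \int[@leb2 R]_y (enorm2 (g y) * riesz r (sqdist y c))%:E)%E.
Proof.
move=> lu [lg1 lg2 wg] e0 er2.
have r0 : 0 < r by lra.
have er : e <= r by lra.
have [N cN] := box_cover c; have [n Hn] := sqdist_box N r.
have out y : ~ box n y -> r < sqdist y c.
  by move=> yn; rewrite ltNge; apply/negP => h; apply: yn; exact: Hn h.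
pose F1 := field1 e r c; pose F2 := field2 e r c.
have tF1 : test_function2 F1 := test_function_field1 e0 er c.
have tF2 : test_function2 F2 := test_function_field2 e0 er c.
have F10 y : ~ box n y -> F1 y = 0.
  by move=> /out h; rewrite /F1 /field1 profile0 ?mulr0// ltW.
have F20 y : ~ box n y -> F2 y = 0.
  by move=> /out h; rewrite /F2 /field2 profile0 ?mulr0// ltW.
have iF1 : (@leb2 R).-integrable setT (EFin \o (fun y => (g y).1 * F1 y)).
  by apply: (@integrable_mul_compact _ _ n) => //; case: tF1 => /(_ 0%N).
have iF2 : (@leb2 R).-integrable setT (EFin \o (fun y => (g y).2 * F2 y)).
  by apply: (@integrable_mul_compact _ _ n) => //; case: tF2 => /(_ 0%N).
have idF1 : (@leb2 R).-integrable setT (EFin \o (fun y => u y * partial1 F1 y)).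
  apply: (@integrable_mul_compact _ _ n) => //; first by case: tF1 => /(_ 1%N)[].
  by move=> y /out h; exact: partial1_field1_0.
have idF2 : (@leb2 R).-integrable setT (EFin \o (fun y => u y * partial2 F2 y)).
  apply: (@integrable_mul_compact _ _ n) => //; first by case: tF2 => /(_ 1%N)[].
  by move=> y /out h; exact: partial2_field2_0.
have [w1 _] := wg _ tF1; have [_ w2] := wg _ tF2.
(* Testing the first component of [g] with [field1] and the second with [field2] and adding produces
   the divergence [moll e - moll r] against [u]. *)
have E : \int[@leb2 R]_y (u y * moll e (sqdist y c)) =
    \int[@leb2 R]_y (u y * moll r (sqdist y c)) -
    \int[@leb2 R]_y ((g y).1 * F1 y + (g y).2 * F2 y).
  rewrite RintegralD// opprD -[X in _ + (X + _)]w1 -[X in _ + (_ + X)]w2.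
  rewrite -(RintegralD measurableT idF1 idF2).
  rewrite -RintegralD//; last 2 first.
  - exact: integrable_moll.
  - exact: (integrableD measurableT idF1 idF2).
  apply: eq_Rintegral => y _; rewrite -mulrDr -mulrDr; congr (_ * _).
  by rewrite field_divergence// /moll addrC subrK.
have iF : (@leb2 R).-integrable setT (EFin \o (fun y => (g y).1 * F1 y + (g y).2 * F2 y)).
  exact: (integrableD measurableT iF1 iF2).
rewrite E.
have := ler_normB (\int[@leb2 R]_y (u y * moll r (sqdist y c)))
  (\int[@leb2 R]_y ((g y).1 * F1 y + (g y).2 * F2 y)).
rewrite -lee_fin => /le_trans; apply.
rewrite EFinD leeD2l//.
apply: (@le_trans _ _ (\int[@leb2 R]_y `|((g y).1 * F1 y + (g y).2 * F2 y)%:E|)%E).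
  apply: le_trans (le_abse_integral _ measurableT (measurable_int _ iF)).
  by rewrite /Rintegral -abse_EFin fineK//; exact: integrable_fin_num iF.
have mg1 := loc_integrable2_measurable lg1; have mg2 := loc_integrable2_measurable lg2.
apply: ge0_le_integral => //.
- by apply: measurableT_comp => //; exact: measurable_int iF.
- apply/measurable_EFinP; apply: measurable_funM; first exact: measurable_enorm2.
  by apply: measurable_sqdist_comp; exact: measurable_riesz.
move=> y _; rewrite abse_EFin lee_fin.
apply: (le_trans (cauchy_schwarz2 _ _ _ _)); rewrite ler_wpM2l ?sqrtr_ge0//.
(* The field thus has length [sqrt s * |profile s|], which [profile_le] bounds by
   [1 / (2 pi sqrt s)]. *)
have -> : F1 y ^+ 2 + F2 y ^+ 2 = sqdist y c * profile e r (sqdist y c) ^+ 2.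
  by rewrite /F1 /F2 /field1 /field2 /sqdist; ring.
have s0 := sqdist_ge0 y c; rewrite sqrtrM// sqrtr_sqr.
have [->|sn0] := eqVneq (sqdist y c) 0; first by rewrite sqrtr0 mul0r riesz_ge0.
have sp : 0 < sqdist y c by rewrite lt_def sn0.
rewrite /riesz; case: ltP => [h|h]; last by rewrite profile0// normr0 mulr0.
have /andP[p1 p2] := profile_le e0 er sp er2.
rewrite ger0_norm// powRN powR12_sqrt//.
set t := Num.sqrt _; have t0 : 0 < t by rewrite sqrtr_gt0.
have tE : sqdist y c = t ^+ 2 by rewrite sqr_sqrtr.
rewrite -[leRHS](mulVKf (lt0r_neq0 t0)) ler_pM2l//; apply: (le_trans p2).
by rewrite le_eqVlt; apply/orP; left; apply/eqP; rewrite tE expr2 !invfM; ring.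
Qed.

End mollifier.

(** * Almost everywhere bounds from mollified bounds *)

Section almost_everywhere.
Context {d : measure_display} {T : measurableType d} {R : realType}.
Variable mu : {measure set T -> \bar R}.
Implicit Types P Q : T -> Prop.

Lemma ae_mono P Q : {ae mu, forall x, P x} -> (forall x, P x -> Q x) -> {ae mu, forall x, Q x}.
Proof. by move=> aP PQ; apply: filterS aP. Qed.

Lemma ae_mono2 P P' Q : {ae mu, forall x, P x} -> {ae mu, forall x, P' x} ->
  (forall x, P x -> P' x -> Q x) -> {ae mu, forall x, Q x}.
Proof. by move=> aP aP' PQ; apply: filterS2 aP aP'. Qed.

End almost_everywhere.

(** * Nonnegativity tested on dyadic cells *)

Section boxes.
Variable R : realType.
Local Notation T2 := (measurableTypeR R * measurableTypeR R)%type.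
Local Notation leb := (@lebesgue_measure R).

Definition dyadic (k : int) (n : nat) : set R := `[k%:~R / 2 ^+ n, (k + 1)%:~R / 2 ^+ n[%classic.

Lemma dyadic_nicely_shrinking (x : R) :
  nicely_shrinking x (fun n => dyadic (Num.floor (x * 2 ^+ n)) n).
Proof.
split; first by move=> n; exact: measurable_itv.
have p n : 0 < 2 / 2 ^+ n :> R by rewrite divr_gt0// exprn_gt0.
(* The cell of length [2^-n] containing [x] lies in the ball of radius [2 / 2^n], whose length is 4
   times that of the cell. *)
exists (4, fun n => PosNum (p n)); split => //=.
- rewrite -(mulr0 2); apply: cvgMl_tmp.
  under eq_fun do rewrite -exprVn.
  by apply: cvg_expr; rewrite ger0_norm ?invr_ge0// invf_lt1// ltr1n.
- move=> n y; rewrite /dyadic/= in_itv/= /ball/= => /andP[h1 h2].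
  have q : 0 < 2 ^+ n :> R by rewrite exprn_gt0.
  have f1 := Num.Theory.floor_le_tmp (x * 2 ^+ n); have f2 := Num.Theory.floorD1_gt (x * 2 ^+ n).
  have h3 : (Num.floor (x * 2 ^+ n))%:~R / 2 ^+ n <= x by rewrite ler_pdivrMr.
  have h4 : x < (Num.floor (x * 2 ^+ n) + 1)%:~R / 2 ^+ n by rewrite ltr_pdivlMr.
  have h5 : (Num.floor (x * 2 ^+ n) + 1)%:~R / 2 ^+ n = (Num.floor (x * 2 ^+ n))%:~R / 2 ^+ n + (2 ^+ n)^-1 :> R.
    by rewrite intrD mulrDl div1r.
  have i0 : 0 < (2 ^+ n)^-1 :> R by rewrite invr_gt0.
  rewrite ltr_norml; apply/andP; split; lra.
- move=> n; rewrite lebesgue_measure_ball ?(ltW (p n))// /dyadic lebesgue_measure_itv/= lte_fin.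
  have q : 0 < (2 ^+ n)^-1 :> R by rewrite invr_gt0 exprn_gt0.
  rewrite ltr_pM2r// ltr_int ltrDl ltr01 -EFinB -EFinM lee_fin -mulrBl.
  rewrite intrD [X in X - _]addrC addrK mul1r mulr2n.
  by set i := (2 ^+ n)^-1; lra.
Qed.

(** At a Lebesgue point, [f x] is the limit of the averages over the dyadic cells containing [x].
    These cells form a countable family, which the two-dimensional version exploits. *)
Lemma dyadic_ae_ge0 (f : R -> R) : leb.-integrable setT (EFin \o f) ->
  (forall k n, 0 <= \int[leb]_(x in dyadic k n) (f x)%:E)%E ->
  {ae leb, forall x, 0 <= f x}.
Proof.
move=> intf f0.
have locf : locally_integrable setT f.
  have := integrable_locally measurableT intf; rewrite patch_setT; exact.
apply: (ae_mono (lebesgue_differentiation locf)) => x lx.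
have := nice_lebesgue_differentiation dyadic_nicely_shrinking locf lx.
move=> cv; rewrite -lee_fin; apply: (cvge_ge _ cv).
apply: nearW => n; rewrite mule_ge0//; first by rewrite inve_ge0.
Qed.

(** The one-dimensional criterion is applied twice. For a fixed cell in the second variable the
    partial integral is nonnegative for almost every [x]; this holds for all cells at once outside a
    null set; for the remaining [x] the criterion in [y] shows that the section of the set where
    [f < 0] is null. *)
Lemma dyadic2_ae_ge0 (f : R * R -> R) : (@leb2 R).-integrable setT (EFin \o f) ->
  (forall k n k' n', 0 <= \int[@leb2 R]_(x in dyadic k n `*` dyadic k' n') (f x)%:E)%E ->
  {ae (@leb2 R), forall x, 0 <= f x}.
Proof.
move=> intf f0.
have mD k n : measurable (dyadic k n : set (measurableTypeR R)) by exact: measurable_itv.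
pose g k n : T2 -> \bar R := (EFin \o f) \_ (setT `*` dyadic k n).
have intg k n : (leb \x leb)%E.-integrable setT (g k n).
  by apply/(integrable_restrict _ _ measurableT) => //; [exact: measurableX|rewrite setTI; apply: integrableS intf => //; exact: measurableX].
have gE k n x y : g k n (x, y) = ((fun y => (f (x, y))%:E) \_ (dyadic k n)) y.
  rewrite /g !patchE; congr (if _ then _ else _).
  by apply/idP/idP; rewrite !inE/=; [move=> []|].
have ae1 k n : {ae leb, forall x, (0 <= \int[leb]_(y in dyadic k n) (f (x, y))%:E)%E}.
  have intF : leb.-integrable setT (fubini_F leb (g k n)) := integrable_fubini_F (intg k n).
  have FE : fubini_F leb (g k n) = fun x => (\int[leb]_(y in dyadic k n) (f (x, y))%:E)%E.
    apply/funext => x; rewrite /fubini_F [RHS]integral_mkcond; apply: eq_integral => y _.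
    exact: gE.
  have fin := integrable_ae measurableT intF.
  (* The partial integral may be infinite on a null set; [fine] gives a real-valued function equal
     to it almost everywhere. *)
  have intfF : leb.-integrable setT (EFin \o (fine \o fubini_F leb (g k n))).
    apply: (@le_integrable _ _ _ leb setT measurableT _ _ _ _ intF).
      apply/measurable_EFinP; apply: measurableT_comp (measurable_int _ intF).
      exact: fine_measurable.
    by move=> x _ /=; case: fubini_F => [r||] //=; rewrite leey.
  have : {ae leb, forall x, 0 <= (fine \o fubini_F leb (g k n)) x}.
    apply: (dyadic_ae_ge0 intfF) => k' n'.
    suff -> : (\int[leb]_(x in dyadic k' n') ((fine \o fubini_F leb (g k n)) x)%:E = \int[@leb2 R]_(x in dyadic k' n' `*` dyadic k n) (f x)%:E)%E by [].
    rewrite [RHS]integral_mkcond.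
    have mDD : measurable (dyadic k' n' `*` dyadic k n : set T2) by exact: measurableX.
    have int2 : (leb \x leb)%E.-integrable setT ((EFin \o f) \_ (dyadic k' n' `*` dyadic k n)).
      by apply/(integrable_restrict _ mDD measurableT); rewrite setTI; exact: integrableS intf.
    rewrite -[RHS](integral12_prod_meas1 int2).
    transitivity (\int[leb]_(x in dyadic k' n') fubini_F leb (g k n) x)%E.
      apply: ae_eq_integral; first exact: mD.
      - by apply: (@measurable_funTS _ _ _ _ (dyadic k' n')); exact: measurable_int intfF.
      - by apply: (@measurable_funTS _ _ _ _ (dyadic k' n')); exact: measurable_int intF.
      - by apply: (ae_mono fin) => x fx _ /=; rewrite fineK// fx.
    rewrite integral_mkcond; apply: eq_integral => x _; rewrite patchE /fubini_F.
    case: ifPn => xk; last first.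
      apply/esym/integral0_eq => y _; rewrite patchE ifF//; apply/negP; rewrite inE => -[/= h _].
      by move/negP: xk; apply; rewrite inE.
    apply: eq_integral => y _; rewrite gE !patchE; congr (if _ then _ else _).
    by move: xk; rewrite inE => xk; apply/idP/idP; rewrite !inE/=; [move=> h; split|move=> []].
  by move=> ae0; apply: (ae_mono2 ae0 fin) => x; rewrite -lee_fin => h fx; rewrite fineK ?fx// FE in h.
have ae2 : {ae leb, forall x, forall k n, (0 <= \int[leb]_(y in dyadic k n) (f (x, y))%:E)%E}.
  (* The cells are enumerated by natural numbers, so that a countable union of null sets
     suffices. *)
  have : {ae leb, forall x, forall m, match unpickle m : option (int * nat) with Some kn => is_true (0 <= \int[leb]_(y in dyadic kn.1 kn.2) (f (x, y))%:E)%E | None => True end}.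
    apply: ae_foralln => m; case: (unpickle m) => [[k n]|]; last exact: aeW.
    exact: ae1.
  by move=> ae0; apply: (ae_mono ae0) => x H k n; have := H (pickle (k, n)); rewrite pickleK.
pose A : set T2 := [set x | f x < 0].
have mf : measurable_fun (setT : set T2) f by apply/measurable_EFinP; exact: measurable_int intf.
have mA : measurable A.
  have -> : A = f @^-1` `]-oo, 0[ by apply/seteqP; split => x; rewrite /A/= in_itv.
  by rewrite -[X in measurable X]setTI; apply: mf => //; exact: measurable_itv.
have ae3 : {ae leb, forall x, leb (xsection A x) = 0%E}.
  apply: (ae_mono2 ae2 (ae_integrable1 intf)) => x fx ix.
  have h := dyadic_ae_ge0 (ix : leb.-integrable setT (EFin \o (fun y => f (x, y)))) fx.
  apply/(negligibleP _ (measurable_xsection x mA)); apply: negligibleS h => y.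
  by rewrite /xsection/= inE /A/= => fy; apply/negP; rewrite -ltNge.
exists A; split => //.
  rewrite /leb2 /product_measure1 (ae_eq_integral (cst 0%E))//; last 2 first.
  - exact: measurable_fun_xsection.
  - by apply: (ae_mono ae3) => x.
  by rewrite integral_cst// mul0e.
by move=> x /= /negP; rewrite -ltNge.
Qed.

End boxes.

(** * Removing the mollifier *)

Section mollified_limit.
Variable R : realType.
Local Notation T2 := (measurableTypeR R * measurableTypeR R)%type.
Local Notation leb := (@lebesgue_measure R).
Implicit Types (a b c d e : R) (h H : R * R -> R).

(** Half-open like the dyadic cells, so that the intersection with a product of two cells is again
    of this form. *)
Definition rect a b c d : set (R * R) := `[a, b[ `*` `[c, d[.

Lemma measurable_rect a b c d : measurable (rect a b c d : set T2).
Proof. by apply: measurableX; exact: measurable_itv. Qed.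

Lemma rect_sub_box a b c d : exists n, rect a b c d `<=` @box R n.
Proof.
have [n /boxP[n1 n2]] := box_cover (a, b); have [m /boxP[m1 m2]] := box_cover (c, d).
exists (maxn n m) => x [] /=; rewrite !in_itv/= => /andP[h1 h2] /andP[h3 h4]; apply/boxP.
have hn : n%:R <= (maxn n m)%:R :> R by rewrite ler_nat leq_maxl.
have hm : m%:R <= (maxn n m)%:R :> R by rewrite ler_nat leq_maxr.
move: n1 n2 m1 m2; rewrite /= !ler_norml => /andP[? ?] /andP[? ?] /andP[? ?] /andP[? ?].
by split; apply/andP; split; lra.
Qed.

Lemma line1_ae a : {ae (@leb2 R), forall y, y.1 != a}.
Proof.
exists ([set a] `*` setT); split; first by apply: measurableX.
  by rewrite /leb2 product_measure1E//= lebesgue_measure_set1 mul0e.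
by move=> y /= /negP; rewrite negbK => /eqP.
Qed.

Lemma line2_ae a : {ae (@leb2 R), forall y, y.2 != a}.
Proof.
exists (setT `*` [set a]); split; first by apply: measurableX.
  by rewrite /leb2 product_measure1E//= lebesgue_measure_set1 mule0.
by move=> y /= /negP; rewrite negbK => /eqP.
Qed.

Lemma itv_locally_constant a b y : y != a -> y != b ->
  exists2 e, 0 < e & forall x, `|y - x| < e -> (a <= x < b) = (a <= y < b).
Proof.
move=> ya yb; exists (Num.min `|y - a| `|y - b|).
  by rewrite lt_min !normr_gt0 !subr_eq0 ya.
move=> x; rewrite lt_min => /andP[].
have [ay|ay|/eqP] := ltgtP a y; last by rewrite eq_sym (negbTE ya).
  rewrite (gtr0_norm (_ : 0 < y - a)) ?subr_gt0// ltr_norml => /andP[h1 h2].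
  have -> : a <= x by lra.
  have [yb'|yb'|/eqP] := ltgtP y b; last by rewrite (negbTE yb).
    rewrite (ltr0_norm (_ : y - b < 0)) ?subr_lt0// ltr_norml => /andP[h3 h4].
    by have -> : x < b by lra.
  rewrite (gtr0_norm (_ : 0 < y - b)) ?subr_gt0// ltr_norml => /andP[h3 h4].
  by apply/negbTE; rewrite -leNgt; lra.
rewrite (ltr0_norm (_ : y - a < 0)) ?subr_lt0// ltr_norml => /andP[h1 h2] _.
by rewrite leNgt (_ : x < a)//; lra.
Qed.

(** Off the four lines carrying the sides, a null set, a small disc lies entirely inside or entirely
    outside. A mollified indicator is therefore eventually constant at almost every point. *)
Lemma rect_locally_constant a b c d : {ae (@leb2 R), forall y,
  exists2 e, 0 < e & forall x, sqdist y x < e -> (x \in rect a b c d) = (y \in rect a b c d)}.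
Proof.
have ae1 := ae_mono2 (line1_ae a) (line1_ae b) (fun y => @conj _ _).
have ae2 := ae_mono2 (line2_ae c) (line2_ae d) (fun y => @conj _ _).
apply: (ae_mono2 ae1 ae2) => y [ya yb] [yc yd].
have [e1 e10 H1] := itv_locally_constant ya yb.
have [e2 e20 H2] := itv_locally_constant yc yd.
exists (Num.min e1 e2 ^+ 2); first by rewrite exprn_gt0// lt_min e10.
have m0 : 0 <= Num.min e1 e2 by rewrite le_min !ltW.
have sub (s t : R) : s ^+ 2 < Num.min e1 e2 ^+ 2 -> `|s| < Num.min e1 e2.
  by rewrite -ltr_sqrt ?sqrtr_sqr ?(ger0_norm m0)// exprn_gt0// lt_min e10.
move=> x xy; have x1 : `|y.1 - x.1| < e1.
  suff : `|y.1 - x.1| < Num.min e1 e2 by rewrite lt_min => /andP[].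
  by apply: (sub _ 0); apply: le_lt_trans xy; rewrite /sqdist lerDl sqr_ge0.
have x2 : `|y.2 - x.2| < e2.
  suff : `|y.2 - x.2| < Num.min e1 e2 by rewrite lt_min => /andP[].
  by apply: (sub _ 0); apply: le_lt_trans xy; rewrite /sqdist lerDr sqr_ge0.
by apply/idP/idP; rewrite !inE /rect/= !in_itv/= (H1 _ x1) (H2 _ x2).
Qed.

Lemma measurable_sqdist2 :
  measurable_fun (setT : set (T2 * T2)) (fun p : T2 * T2 => sqdist p.2 p.1).
Proof.
have m1 (f : T2 -> R) : measurable_fun (setT : set T2) f -> measurable_fun (setT : set (T2 * T2)) (fun p => f p.1).
  by move=> mf; exact: (measurableT_comp mf measurable_fst).
have m2 (f : T2 -> R) : measurable_fun (setT : set T2) f -> measurable_fun (setT : set (T2 * T2)) (fun p => f p.2).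
  by move=> mf; exact: (measurableT_comp mf measurable_snd).
by apply: measurable_funD; apply: measurable_funX; apply: measurable_funB; do [exact: m1|exact: m2].
Qed.

(** Fubini moves the mollifier from [h] to the indicator of the rectangle, where convergence is
    elementary, and dominated convergence concludes. Working with integrals lets the exceptional set
    of the hypothesis depend on [e]. *)
Lemma rect_moll_le h H a b c d : loc_integrable2 h ->
  measurable_fun (setT : set T2) H -> (forall x, 0 <= H x) ->
  (forall N, exists2 e0 : R, 0 < e0 & forall e, 0 < e -> e < e0 ->
    {ae (@leb2 R), forall x, box N x ->
      `| \int[@leb2 R]_y (h y * moll e (sqdist y x))%R | <= H x}) ->
  (`| \int[@leb2 R]_(x in rect a b c d) (h x)%:E | <=
   \int[@leb2 R]_(x in rect a b c d) (H x)%:E)%E.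
Proof.
move=> lh mH H0 hH.
pose A : set T2 := rect a b c d; have mA : measurable A by exact: measurable_rect.
have [N AN] := rect_sub_box a b c d; have [n Hn] := sqdist_box N (1 : R).
have mh := loc_integrable2_measurable lh.
pose ek (k : nat) : R := k.+1%:R^-1.
have ek0 k : 0 < ek k by rewrite invr_gt0.
have ek1 k : ek k <= 1 by rewrite invf_le1// ler1n.
pose G k (p : T2 * T2) : R := \1_A p.1 * (h p.2 * moll (ek k) (sqdist p.2 p.1)).
(* The mollified indicator: at most 1, supported in the fixed box [n] because [ek k <= 1], so [|h|]
   on that box is the dominating function. *)
pose W k (y : T2) : \bar R := (\int[@leb2 R]_x (\1_A x * moll (ek k) (sqdist y x))%:E)%E.
have mWx k (y : T2) : measurable_fun (setT : set T2) (fun x => (\1_A x * moll (ek k) (sqdist y x))).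
  apply: measurable_funM; first exact: measurable_indic.
  by under eq_fun do rewrite sqdistC; apply: measurable_sqdist_comp; exact: measurable_moll.
have W0 k y : (0 <= W k y)%E.
  by apply: integral_ge0 => x _; rewrite lee_fin mulr_ge0// moll_ge0.
have W1 k y : (W k y <= 1)%E.
  rewrite -(integral_moll y (ek0 k)); apply: ge0_le_integral => //.
  - by move=> x _; rewrite lee_fin mulr_ge0// moll_ge0.
  - by apply/measurable_EFinP; exact: mWx.
  - by apply/measurable_EFinP; apply: measurable_sqdist_comp; exact: measurable_moll.
  - move=> x _; rewrite lee_fin sqdistC ler_piMl ?moll_ge0//.
have Wout k y : ~ box n y -> W k y = 0%E.
  move=> yn; apply: integral0_eq => x _; rewrite indicE.
  have [|] := boolP (x \in A); last by rewrite mul0r.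
  rewrite inE => /AN xN; rewrite moll0 ?mulr0//.
  by rewrite leNgt; apply/negP => /ltW yx; apply: yn; apply: Hn xN _ (le_trans yx (ek1 k)).
have mW k : measurable_fun (setT : set T2) (W k).
  apply: (measurable_fun_fubini_tonelli_G (fun p : T2 * T2 => (\1_A p.1 * moll (ek k) (sqdist p.2 p.1))%:E)).
    apply/measurable_EFinP; apply: measurable_funM.
      exact: (measurableT_comp (measurable_indic mA) measurable_fst).
    exact: (measurableT_comp (measurable_moll (ek k)) measurable_sqdist2).
  by move=> p; rewrite lee_fin mulr_ge0// moll_ge0.
have mG k : measurable_fun (setT : set (T2 * T2)) (G k).
  apply: measurable_funM.
    exact: (measurableT_comp (measurable_indic mA) measurable_fst).
  apply: measurable_funM; first exact: (measurableT_comp mh measurable_snd).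
  exact: (measurableT_comp (measurable_moll (ek k)) measurable_sqdist2).
have intG k : (@leb2 R \x @leb2 R)%E.-integrable setT (EFin \o G k).
  apply/integrable21ltyP; first exact/measurable_EFinP.
  have -> : (\int[@leb2 R]_y \int[@leb2 R]_x `|(EFin \o G k) (x, y)| = \int[@leb2 R]_y (`|h y|%:E * W k y))%E.
    apply: eq_integral => y _; rewrite -ge0_integralZl_EFin//; last 2 first.
    - by move=> x _; rewrite lee_fin mulr_ge0// moll_ge0.
    - by apply/measurable_EFinP; exact: mWx.
    apply: eq_integral => x _; rewrite -EFinM; congr EFin.
    have m0 := moll_ge0 (sqdist y x) (ek0 k).
    have i0 : 0 <= \1_A x :> R by [].
    transitivity (`|\1_A x * (h y * moll (ek k) (sqdist y x))|) => //.
    by rewrite normrM normrM (ger0_norm m0) (ger0_norm i0) mulrCA.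
  rewrite (@integral_vanish R _ T2 (@leb2 R) (@box R n)); last by move=> y /Wout ->; rewrite mule0.
  have /integrableP[_] := loc_integrable2_box n lh; apply: le_lt_trans.
  apply: ge0_le_integral; first exact: measurable_box.
  - by move=> y _; rewrite mule_ge0.
  - apply: emeasurable_funM; last exact: measurable_funTS (mW k).
    by apply: measurable_funTS; apply/measurable_EFinP; exact: measurableT_comp.
  - by apply: measurable_funTS; apply: measurableT_comp => //; exact/measurable_EFinP.
  - by move=> y _; rewrite -[leRHS]mule1 lee_wpmul2l.
pose F k := fubini_F (@leb2 R) (EFin \o G k).
have mF k : measurable_fun (setT : set T2) (F k) := measurable_fubini_F (intG k).
have FE k x : F k x = (\1_A x * \int[@leb2 R]_y (h y * moll (ek k) (sqdist y x))%R)%:E.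
  have im := integrable_moll x lh (ek0 k).
  rewrite EFinM /Rintegral fineK; last exact: integrable_fin_num im.
  by rewrite /F /fubini_F -integralZl.
have FW k : (\int[@leb2 R]_x F k x = \int[@leb2 R]_y ((h y)%:E * W k y))%E.
  rewrite (integral12_prod_meas1 (intG k)) -(integral21_prod_meas1 (intG k)).
  apply: eq_integral => y _; rewrite /fubini_G /W -integralZl//; last first.
    apply/integrableP; split; first by apply/measurable_EFinP; exact: mWx.
    apply: (@le_lt_trans _ _ (W k y)); last exact: le_lt_trans (W1 k y) (ltry _).
    rewrite le_eqVlt; apply/orP; left; apply/eqP; apply: eq_integral => x _.
    by rewrite gee0_abs// lee_fin mulr_ge0// moll_ge0.
  by apply: eq_integral => x _; rewrite -EFinM /= /G /= mulrCA.
have lim : (\int[@leb2 R]_y ((h y)%:E * W k y) @[k --> \oo] --> \int[@leb2 R]_(y in A) (h y)%:E)%E.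
  rewrite [X in _ --> X]integral_mkcond.
  have [] := @dominated_convergence _ _ _ (@leb2 R) setT measurableT
    (fun k y => ((h y)%:E * W k y)%E) ((EFin \o h) \_ A) ((fun y => `|h y|%:E) \_ (@box R n)).
  - move=> k; apply: emeasurable_funM => //; exact/measurable_EFinP.
  - apply/(measurable_restrictT _ mA).
    by apply: measurable_funTS; exact/measurable_EFinP.
  - apply: (ae_mono (rect_locally_constant a b c d)) => y [e e0 He] _.
    apply: cvg_near_cst; near=> k.
    have eke : ek k < e by near: k; exact: near_infty_natSinv_lt (PosNum e0).
    have -> : W k y = (\1_A y)%:E.
      transitivity (\int[@leb2 R]_x ((\1_A y)%:E * (moll (ek k) (sqdist x y))%:E))%E.
        apply: eq_integral => x _; rewrite -EFinM; congr EFin; rewrite (sqdistC x y).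
        have [xy|xy] := ltP (sqdist y x) e; first by rewrite !indicE (He _ xy).
        by rewrite moll0 ?mulr0// (le_trans (ltW eke)).
      rewrite ge0_integralZl_EFin//; last 2 first.
      - by move=> x _; rewrite lee_fin moll_ge0.
      - by apply/measurable_EFinP; apply: measurable_sqdist_comp; exact: measurable_moll.
      by rewrite integral_moll// mule1.
    by rewrite patchE indicE; case: (y \in A); rewrite ?mule1 ?mule0.
  - apply/(integrable_restrict _ (measurable_box n) measurableT); rewrite setTI.
    have := integrable_abse (loc_integrable2_box n lh); exact.
  - apply: aeW => y k _; rewrite patchE; case: ifPn => [_|/negP yn].
      by rewrite abseM (gee0_abs (W0 k y)) -[leRHS]mule1 lee_wpmul2l.
    by rewrite Wout ?mule0 ?abse0// => yb; apply: yn; rewrite inE.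
  by move=> _ _; exact.
have {}lim := cvg_abse lim.
apply: (cvge_to_le (lim _)).
have [e0 e00 He0] := hH N.
near=> k; rewrite -FW.
apply: le_trans (le_abse_integral _ measurableT (mF k)) _.
rewrite [leRHS]integral_mkcond; apply: ae_ge0_le_integral => //.
- by apply: measurableT_comp.
- by move=> x _; rewrite patchE; case: ifP => // _; rewrite lee_fin.
- by apply/(measurable_restrictT _ mA); apply: measurable_funTS; exact/measurable_EFinP.
- have eke : ek k < e0 by near: k; exact: near_infty_natSinv_lt (PosNum e00).
  apply: (ae_mono (He0 _ (ek0 k) eke)) => x Hx _; rewrite FE patchE indicE.
  have [xA|xA] := boolP (x \in A); last by rewrite mul0r abse0.
  by rewrite mul1r abse_EFin lee_fin; apply/Hx/AN; rewrite inE in xA.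
Unshelve. all: by end_near. Qed.

Lemma rect_setI a b c d a' b' c' d' : rect a b c d `&` rect a' b' c' d' =
  rect (Num.max a a') (Num.min b b') (Num.max c c') (Num.min d d').
Proof.
apply/seteqP; split => x; rewrite /rect/= !in_itv/= !ge_max !lt_min.
  by move=> [[/andP[-> ->] /andP[-> ->]] [/andP[-> ->] /andP[-> ->]]].
by move=> [/andP[/andP[-> ->] /andP[-> ->]] /andP[/andP[-> ->] /andP[-> ->]]].
Qed.

(** [rect_moll_le] makes the integrals of [H + h] and [H - h] over rectangles nonnegative, and
    [dyadic2_ae_ge0] turns this into a pointwise bound. *)
Lemma moll_ae_le h H : loc_integrable2 h -> loc_integrable2 H -> (forall x, 0 <= H x) ->
  (forall N, exists2 e0 : R, 0 < e0 & forall e, 0 < e -> e < e0 ->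
    {ae (@leb2 R), forall x, box N x ->
      `| \int[@leb2 R]_y (h y * moll e (sqdist y x))%R | <= H x}) ->
  {ae (@leb2 R), forall x, `|h x| <= H x}.
Proof.
move=> lh lH H0 hH; have mH := loc_integrable2_measurable lH.
have key (s : R) (N : nat) : `|s| = 1 ->
    {ae (@leb2 R), forall x, box N x -> 0 <= H x + s * h x}.
  (* Localisation to [Q] gives the integrability on the whole plane that [dyadic2_ae_ge0] requires;
     with [N + 1] the half-open square contains the closed box [N]. *)
  move=> s1; pose M : R := N.+1%:R; pose Q : set T2 := rect (- M) M (- M) M.
  have mQ : measurable Q by exact: measurable_rect.
  have [n Qn] := rect_sub_box (- M) M (- M) M.
  have iD (D : set T2) (v : R * R -> R) : measurable D -> D `<=` Q -> loc_integrable2 v ->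
      (@leb2 R).-integrable D (EFin \o v).
    move=> mD DQ lv; apply: (integrableS (measurable_box n) mD _ (loc_integrable2_box n lv)).
    exact: subset_trans DQ Qn.
  have iHh (D : set T2) : measurable D -> D `<=` Q ->
      (@leb2 R).-integrable D (fun x => (H x)%:E + s%:E * (h x)%:E)%E.
    move=> mD DQ; apply: integrableD => //; first exact: iD.
    by apply: integrableZl => //; exact: iD.
  pose f x : R := ((fun x => H x + s * h x) \_ Q) x.
  have fE : EFin \o f = (fun x => (H x)%:E + s%:E * (h x)%:E)%E \_ Q.
    by apply/funext => x /=; rewrite /f !patchE; case: ifP.
  have intf : (@leb2 R).-integrable setT (EFin \o f).
    by rewrite fE; apply/(integrable_restrict _ mQ measurableT); rewrite setTI; exact: iHh.
  suff : {ae (@leb2 R), forall x, 0 <= f x}.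
    move=> ae; apply: (ae_mono ae) => x + /boxP[x1 x2]; rewrite /f patchE ifT//.
    rewrite inE; split; rewrite /= in_itv/= /M -natr1.
      by move: x1; rewrite ler_norml => /andP[h1 h2]; apply/andP; split; lra.
    by move: x2; rewrite ler_norml => /andP[h1 h2]; apply/andP; split; lra.
  apply: (dyadic2_ae_ge0 intf) => k m k' m'.
  pose P : set T2 := dyadic k m `*` dyadic k' m'.
  pose D : set T2 := P `&` Q.
  have DE : D = rect _ _ _ _ := rect_setI _ _ _ _ _ _ _ _.
  have mD : measurable D by rewrite DE; exact: measurable_rect.
  have DQ : D `<=` Q by move=> x [].
  have -> : (\int[@leb2 R]_(x in dyadic k m `*` dyadic k' m') (f x)%:E =
      \int[@leb2 R]_(x in D) ((H x)%:E + s%:E * (h x)%:E))%E.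
    rewrite integral_mkcond [RHS]integral_mkcond; apply: eq_integral => x _.
    have := congr1 (fun g => g x) fE; rewrite /= => fx.
    rewrite !patchE fx patchE.
    have -> : (x \in D) = (x \in P) && (x \in Q) by exact: in_setI.
    by case: (x \in Q); [rewrite andbT|rewrite andbF; case: ifP].
  rewrite integralD//; last 2 first.
  - exact: iD.
  - by apply: integrableZl => //; exact: iD.
  rewrite integralZl//; last exact: iD.
  have := rect_moll_le (Num.max (k%:~R / 2 ^+ m) (- M)) (Num.min ((k + 1)%:~R / 2 ^+ m) M)
    (Num.max (k'%:~R / 2 ^+ m') (- M)) (Num.min ((k' + 1)%:~R / 2 ^+ m') M) lh mH H0 hH.
  rewrite -[rect _ _ _ _]DE.
  have /fineK <- := integrable_fin_num mD (iD _ _ mD DQ lh).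
  have /fineK <- := integrable_fin_num mD (iD _ _ mD DQ lH).
  rewrite abse_EFin -EFinM -EFinD !lee_fin; set A := fine _; set B := fine _ => AB.
  have : `|s * A| <= B by rewrite normrM s1 mul1r.
  by rewrite ler_norml => /andP[h1 h2]; lra.
have k1 : {ae (@leb2 R), forall x, forall N, box N x -> 0 <= H x + 1 * h x}.
  by apply: ae_foralln => N; apply: key; rewrite normr1.
have k2 : {ae (@leb2 R), forall x, forall N, box N x -> 0 <= H x + (- 1) * h x}.
  by apply: ae_foralln => N; apply: key; rewrite normrN1.
apply: (ae_mono2 k1 k2) => x h1 h2; have [N xN] := box_cover x.
have := h1 _ xN; have := h2 _ xN; rewrite ler_norml => a1 a2.
by apply/andP; split; lra.
Qed.

Lemma Ck2_upto_dstep n (g : R * R -> R) : Ck2_upto n g -> Ck2_upto n (fun x => dstep (g x)).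
Proof.
move=> cg.
have cA k : Ck2_upto n (fun x => flat k (g x - 2^-1)).
  by apply: Ck2_upto_flat; apply: Ck2_upto_sub => //; exact: Ck2_upto_cst.
have cB k : Ck2_upto n (fun x => flat k (1 - g x)).
  by apply: Ck2_upto_flat; apply: Ck2_upto_sub => //; exact: Ck2_upto_cst.
apply: Ck2_upto_mul; first by apply: Ck2_upto_add; exact: Ck2_upto_mul.
under eq_fun do rewrite expr2.
apply: Ck2_upto_inv; last by apply: Ck2_upto_mul; exact: Ck2_upto_add.
by move=> x; rewrite -expr2 expf_neq0// gt_eqF// step_den_gt0.
Qed.

Lemma test_function_moll e (c : R * R) : 0 < e -> test_function2 (fun y => moll e (sqdist y c)).
Proof.
move=> e0; split; last by apply: (@sqdist_lt_compact _ e e e0 (lexx e) c) => y h; exact: moll0.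
move=> k; apply: (_ : Ck2_upto k _) => //; apply: Ck2_upto_mul; last exact: Ck2_upto_cst.
apply: Ck2_upto_dstep; apply: Ck2_upto_mul; last exact: Ck2_upto_cst.
exact: Ck2_upto_sqdist.
Qed.

(** The fundamental lemma of the calculus of variations: mollifiers are test functions, so every
    mollification of [v - w] vanishes and [moll_ae_le] applies with [H = 0]. *)
Lemma test_function_unique (v w : R * R -> R) : loc_integrable2 v -> loc_integrable2 w ->
  (forall phi, test_function2 phi ->
    \int[@leb2 R]_x (v x * phi x) = \int[@leb2 R]_x (w x * phi x)) ->
  {ae (@leb2 R), forall x, v x = w x}.
Proof.
move=> lv lw vw.
have lvw : loc_integrable2 (fun x => v x - w x).
  move=> K cK; have mK := compact_measurable2 cK.
  exact: (integrableB mK (lv _ cK) (lw _ cK)).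
have l0 : loc_integrable2 (fun=> 0 : R).
  by move=> K cK; exact: integrable0.
have ae : {ae (@leb2 R), forall x, `|v x - w x| <= 0}.
  apply: moll_ae_le => // N; exists 1 => // e e0 _; apply: aeW => x _.
  under eq_Rintegral do rewrite mulrBl.
  rewrite RintegralB//; [|exact: integrable_moll|exact: integrable_moll].
  by rewrite vw ?subrr ?normr0//; exact: test_function_moll.
by apply: (ae_mono ae) => x; rewrite normr_le0 subr_eq0 => /eqP.
Qed.

Lemma weak_gradient_unique u g g' : is_weak_gradient u g -> is_weak_gradient u g' ->
  {ae (@leb2 R), forall x, enorm2 (g x) = enorm2 (g' x)}.
Proof.
move=> [l1 l2 w] [l1' l2' w'].
have a1 : {ae (@leb2 R), forall x, (g x).1 = (g' x).1}.
  apply: test_function_unique => // phi tphi; apply: oppr_inj.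
  by have [<- _] := w _ tphi; have [<- _] := w' _ tphi.
have a2 : {ae (@leb2 R), forall x, (g x).2 = (g' x).2}.
  apply: test_function_unique => // phi tphi; apply: oppr_inj.
  by have [_ <-] := w _ tphi; have [_ <-] := w' _ tphi.
by apply: (ae_mono2 a1 a2) => x; rewrite /enorm2 => -> ->.
Qed.

End mollified_limit.

(** * Norms and weak gradients of smooth functions *)

Section norms.
Variable R : realType.
Local Notation T2 := (measurableTypeR R * measurableTypeR R)%type.
Local Notation leb := (@lebesgue_measure R).
Implicit Types (u phi : R * R -> R) (g : R * R -> R * R).
Local Notation e1 := ((1, 0) : R * R).
Local Notation e2 := ((0, 1) : R * R).

Lemma sqr_poweR12 (x : \bar R) : (0 <= x -> (x `^ 2^-1) ^+ 2 = x)%E.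
Proof. by move=> x0; rewrite poweR12_sqrt// sqr_sqrte. Qed.

(** [gradient_norm] is built on a representative picked by choice; almost everywhere uniqueness lets
    any weak gradient at hand compute it. *)
Lemma sqr_gradient_norm u g : is_weak_gradient u g ->
  (gradient_norm u ^+ 2 = \int[@leb2 R]_x (enorm2 (g x) ^+ 2)%:E)%E.
Proof.
move=> wg.
have wg' : is_weak_gradient u (weak_gradient u).
  by apply: (@xgetPex _ (fun=> (0, 0)) [set g | is_weak_gradient u g]); exists g.
have m (v : R * R -> R * R) : is_weak_gradient u v ->
    measurable_fun (setT : set T2) (fun x => (enorm2 (v x) ^+ 2)%:E).
  move=> [l1 l2 _]; apply/measurable_EFinP; apply: measurable_funX.
  by apply: measurable_enorm2; exact: loc_integrable2_measurable.
rewrite /gradient_norm unlock sqr_poweR12; last first.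
  by apply: integral_ge0 => x _; exact: poweR_ge0.
transitivity (\int[@leb2 R]_x (enorm2 (weak_gradient u x) ^+ 2)%:E)%E.
  apply: eq_integral => x _.
  transitivity (`|(enorm2 (weak_gradient u x))%:E| `^ 2)%E => //.
  by rewrite abse_EFin poweR_EFin powR_mulrn// real_normK// num_real.
apply: ae_eq_integral => //; [exact: m|exact: m|].
by apply: (ae_mono (weak_gradient_unique wg' wg)) => x -> _.
Qed.

Lemma sqr_DLnorm (b p : R) u : (DLnorm b p u ^+ 2 = gradient_norm u ^+ 2 + weighted_norm b p u ^+ 2)%E.
Proof.
rewrite /DLnorm sqr_poweR12// adde_ge0// expe_ge0//; first exact: Lnorm_ge0.
exact: poweR_ge0.
Qed.

Lemma continuous_loc_integrable2 u : continuous u -> loc_integrable2 u.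
Proof.
move=> cu; apply: loc_integrable2P; first exact: continuous_measurable2.
move=> n; have [C HC] := continuous_box_bounded n cu.
apply: measurable_bounded_integrable; first exact: measurable_box.
- exact: leb2_box_lty.
- by apply: measurable_funTS; exact: continuous_measurable2.
- exists `|C|; split; first exact: num_real.
  by move=> M CM y yn /=; apply: le_trans (HC y yn) _; apply: le_trans (ler_norm C) (ltW CM).
Qed.

Lemma test_function_box phi : test_function2 phi -> exists n,
  [/\ forall y, ~ box n y -> phi y = 0,
      forall y, ~ box n y -> partial1 phi y = 0 &
      forall y, ~ box n y -> partial2 phi y = 0].
Proof.
move=> [_ /compact_sub_box[n Hn]]; exists n.
have phi0 y : ~ box n y -> phi y = 0.
  move=> yn; apply/eqP/negPn/negP => h; apply: yn; apply: Hn.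
  exact: subset_closure.
have phi0n y : ~ box n y -> \near y, phi y = 0.
  move=> yn; have oB : open (~` @box R n).
    apply: closed_openC; apply: compact_closed; first exact: norm_hausdorff.
    exact: compact_box.
  by apply: filterS (open_nbhs_nbhs (conj oB yn)) => z; exact: phi0.
have d0 v y : ~ box n y -> 'D_v phi y = 0.
  move=> /phi0n yn; have := is_derive_cst (0 : R) y v.
  have nE : \near y, (cst 0 : R * R -> R) y = phi y by apply: filterS yn => z ->.
  by move=> /(near_eq_is_derive nE)[].
by split => // y yn; exact: d0.
Qed.

Lemma is_derive_slice1 (f : R * R -> R) (t s d : R) :
  is_derive (t, s) e1 f d -> is_derive t (1 : R) (fun t => f (t, s)) d.
Proof.
move=> /is_derive_line H; apply/is_derive_line.
have <- : (fun h : R => f (h *: e1 + (t, s))) = (fun h : R => f (h *: (1 : R) + t, s)) => //.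
apply/funext => h; have -> : h *: e1 + (t, s) = (h *: (1 : R) + t, h * 0 + s) by [].
by rewrite mulr0 add0r.
Qed.

Lemma is_derive_slice2 (f : R * R -> R) (t s d : R) :
  is_derive (t, s) e2 f d -> is_derive s (1 : R) (fun s => f (t, s)) d.
Proof.
move=> /is_derive_line H; apply/is_derive_line.
have <- : (fun h : R => f (h *: e2 + (t, s))) = (fun h : R => f (t, h *: (1 : R) + s)) => //.
apply/funext => h; have -> : h *: e2 + (t, s) = (h * 0 + t, h *: (1 : R) + s) by [].
by rewrite mulr0 add0r.
Qed.

Lemma integral_compact_derive (F f : R -> R) (n : nat) : continuous f ->
  (forall t : R, is_derive t (1 : R) F (f t)) ->
  (forall t, n%:R < `|t| -> F t = 0) -> (forall t, n%:R < `|t| -> f t = 0) ->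
  (\int[leb]_t (f t)%:E = 0)%E.
Proof.
move=> cf dF F0 f0; pose M : R := n.+1%:R.
have M0 : 0 < M by rewrite ltr0n.
have nM : n%:R < M by rewrite ltr_nat.
rewrite (@integral_vanish R _ (measurableTypeR R) leb `[- M, M]%classic); last first.
  move=> t /= /negP; rewrite in_itv/= -ler_norml -ltNge => h.
  by rewrite f0// (lt_trans nM).
rewrite (@ftc_derive _ F)//.
- by rewrite !F0 ?subrr// ?normrN gtr0_norm.
- by rewrite gtrN.
- exact: continuous_subspaceT.
Qed.

Lemma continuous_pair1 (f : R * R -> R) (s : R) : continuous f -> continuous (fun t => f (t, s)).
Proof.
move=> cf t; have h : (fun t : R => (t, s)) @ nbhs t --> nbhs ((t, s) : R * R).
  by move=> A nA; apply: (@cvg_pair _ _ _ (nbhs t) (nbhs t) (nbhs s) _ _ _ _ _ cvg_id (cvg_cst s) A nA).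
exact: cvg_comp h (cf (t, s)).
Qed.

Lemma continuous_pair2 (f : R * R -> R) (t : R) : continuous f -> continuous (fun s => f (t, s)).
Proof.
move=> cf s; have h : (fun s : R => (t, s)) @ nbhs s --> nbhs ((t, s) : R * R).
  by move=> A nA; apply: (@cvg_pair _ _ _ (nbhs s) (nbhs t) (nbhs s) _ _ _ _ _ (cvg_cst t) cvg_id A nA).
exact: cvg_comp h (cf (t, s)).
Qed.

Lemma integral_compact_partial1 (psi d : R * R -> R) n : continuous d ->
  (forall x, is_derive x e1 psi (d x)) -> (forall y, ~ box n y -> psi y = 0) ->
  (forall y, ~ box n y -> d y = 0) -> \int[@leb2 R]_x d x = 0.
Proof.
move=> cd dpsi psi0 d0.
have intd : (leb \x leb)%E.-integrable setT (EFin \o d).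
  have := integrable_mul_compact (continuous_loc_integrable2 (@cst_continuous _ _ (1 : R))) cd d0.
  by apply: eq_integrable => // x _ /=; rewrite mul1r.
rewrite /Rintegral -[X in fine X](integral21_prod_meas1 intd) integral0_eq// => s _.
rewrite /fubini_G; have out t : n%:R < `|t| -> ~ box n (t, s).
  by move=> nt /boxP[]; rewrite /= leNgt nt.
apply: (@integral_compact_derive (fun t => psi (t, s)) (fun t => d (t, s)) n).
- exact: continuous_pair1.
- by move=> t; exact: is_derive_slice1.
- by move=> t /out; exact: psi0.
- by move=> t /out; exact: d0.
Qed.

Lemma integral_compact_partial2 (psi d : R * R -> R) n : continuous d ->
  (forall x, is_derive x e2 psi (d x)) -> (forall y, ~ box n y -> psi y = 0) ->
  (forall y, ~ box n y -> d y = 0) -> \int[@leb2 R]_x d x = 0.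
Proof.
move=> cd dpsi psi0 d0.
have intd : (leb \x leb)%E.-integrable setT (EFin \o d).
  have := integrable_mul_compact (continuous_loc_integrable2 (@cst_continuous _ _ (1 : R))) cd d0.
  by apply: eq_integrable => // x _ /=; rewrite mul1r.
rewrite /Rintegral -[X in fine X](integral12_prod_meas1 intd) integral0_eq// => t _.
rewrite /fubini_F; have out s : n%:R < `|s| -> ~ box n (t, s).
  by move=> nt /boxP[_]; rewrite /= leNgt nt.
apply: (@integral_compact_derive (fun s => psi (t, s)) (fun s => d (t, s)) n).
- exact: continuous_pair2.
- by move=> s; exact: is_derive_slice2.
- by move=> s /out; exact: psi0.
- by move=> s /out; exact: d0.
Qed.

(** The product rule reduces each identity to the vanishing of the integral of a partial derivative
    of [u * phi], which is compactly supported. *)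
Lemma C1_weak_gradient u (d1 d2 : R * R -> R) :
  continuous u -> continuous d1 -> continuous d2 ->
  (forall x, is_derive x e1 u (d1 x)) -> (forall x, is_derive x e2 u (d2 x)) ->
  is_weak_gradient u (fun x => (d1 x, d2 x)).
Proof.
move=> cu cd1 cd2 du1 du2.
split; [exact: continuous_loc_integrable2|exact: continuous_loc_integrable2|].
move=> phi tphi; have [n [p0 p10 p20]] := test_function_box tphi.
have [cphi _] := tphi.
have [dp1 dp2 cp1 cp2] : [/\ forall x, is_derive x e1 phi (partial1 phi x),
    forall x, is_derive x e2 phi (partial2 phi x),
    continuous (partial1 phi) & continuous (partial2 phi)].
  by have [a1 a2 a3 a4] := cphi 1%N; split => // x; split.
have cp0 : continuous phi := cphi 0%N.
have lu := continuous_loc_integrable2 cu.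
have l1 := continuous_loc_integrable2 cd1; have l2 := continuous_loc_integrable2 cd2.
split; apply/eqP; rewrite -addr_eq0; apply/eqP.
- rewrite -[LHS](@RintegralD _ _ _ (@leb2 R))//; last 2 first.
  + exact: integrable_mul_compact p10.
  + exact: integrable_mul_compact p0.
  apply: (@integral_compact_partial1 (fun x => u x * phi x) _ n).
  + by apply: continuous_add; apply: continuous_mul => //.
  + move=> x; apply: is_derive_eq (is_derive_mul (du1 x) (dp1 x)) _.
    by rewrite [phi x * _]mulrC.
  + by move=> y yn; rewrite p0// mulr0.
  + by move=> y yn; rewrite p0// p10// !mulr0 addr0.
- rewrite -[LHS](@RintegralD _ _ _ (@leb2 R))//; last 2 first.
  + exact: integrable_mul_compact p20.
  + exact: integrable_mul_compact p0.
  apply: (@integral_compact_partial2 (fun x => u x * phi x) _ n).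
  + by apply: continuous_add; apply: continuous_mul => //.
  + move=> x; apply: is_derive_eq (is_derive_mul (du2 x) (dp2 x)) _.
    by rewrite [phi x * _]mulrC.
  + by move=> y yn; rewrite p0// mulr0.
  + by move=> y yn; rewrite p0// p20// !mulr0 addr0.
Qed.

Lemma enorm2_sqdist (x : R * R) : enorm2 x = Num.sqrt (sqdist x (0, 0)).
Proof. by rewrite /enorm2 /sqdist /= !subr0. Qed.

Lemma measurable_weight (b : R) :
  measurable_fun (setT : set T2) (fun x => ln (b + enorm2 x)).
Proof.
apply: measurable_fcomp; last exact: measurable_ln.
apply: measurable_funD => //; apply: (@measurable_enorm2 _ id).
- exact: measurable_fst.
- exact: measurable_snd.
Qed.

Lemma weight_ge0 (b : R) (x : R * R) : 1 < b -> 0 <= ln (b + enorm2 x).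
Proof. by move=> b1; rewrite ln_ge0// (le_trans (ltW b1))// lerDl sqrtr_ge0. Qed.

Lemma measurable_weighted_powR (b p : R) u : measurable_fun (setT : set T2) u ->
  measurable_fun (setT : set T2) (fun x => (`|u x| `^ p * ln (b + enorm2 x))%:E).
Proof.
move=> mu; apply/measurable_EFinP; apply: measurable_funM; last exact: measurable_weight.
by apply: (measurable_fcomp (g := fun t => t `^ p)); [exact: measurableT_comp|exact: measurable_powR].
Qed.

Lemma measurable_TM (b p alpha : R) u : measurable_fun (setT : set T2) u ->
  measurable_fun (setT : set T2)
    (fun x => (`|u x| `^ p * expR (alpha * u x ^+ 2) * ln (b + enorm2 x))%:E).
Proof.
move=> mu; apply/measurable_EFinP; apply: measurable_funM; last exact: measurable_weight.
apply: measurable_funM.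
  by apply: (measurable_fcomp (g := fun t => t `^ p)); [exact: measurableT_comp|exact: measurable_powR].
apply: measurable_fcomp; last exact: measurable_expR.
by apply: measurable_funM => //; exact: measurable_funX.
Qed.

End norms.

(** * Sharpness *)

Section moser.
Variable R : realType.
Local Notation T2 := (measurableTypeR R * measurableTypeR R)%type.
Local Notation leb := (@lebesgue_measure R).
Local Notation e1 := ((1, 0) : R * R).
Local Notation e2 := ((0, 1) : R * R).

Lemma measurable_disc (c : R * R) (t : R) : measurable [set x : T2 | sqdist x c < t].
Proof.
rewrite (_ : [set x : T2 | _] = setT `&` (fun x : T2 => sqdist x c) @^-1` `]-oo, t[%classic).
  by apply: measurable_sqdist => //; exact: measurable_itv.
by rewrite setTI; apply/seteqP; split => x /=; rewrite in_itv.
Qed.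

Lemma ln_le_sub1 (x : R) : 0 < x -> ln x <= x - 1.
Proof. move=> x0; have := @le_ln1Dx R (x - 1).
by rewrite (_ : 1 + (x - 1) = x); [apply; lra|ring]. Qed.

(** The exponent [1 / (2 p)] is chosen so that the [p]-th power of the bound is a multiple of
    [sqrt y]. It comes from [1 + y <= e y] and [ln z <= z - 1] at [z = y^(1 / (2 p))]. *)
Lemma ln1D_le_powR (p y : R) : 1 < p -> 1 <= y -> ln (1 + y) <= 2 * p * y `^ (2 * p)^-1.
Proof.
move=> p1 y1; have y0 : 0 < y by lra.
have h1 : ln (1 + y) <= 1 + ln y.
  have -> : 1 + ln y = ln (expR 1) + ln y by rewrite expRK.
  rewrite -lnM ?posrE ?expR_gt0// ler_ln ?posrE ?mulr_gt0 ?expR_gt0//; last lra.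
  have := expR_ge1Dx (1 : R); nra.
have h2 := ln_le_sub1 (powR_gt0 (2 * p)^-1 y0).
rewrite ln_powR in h2.
have p0 : 0 < 2 * p by lra.
have h3 : ln y <= 2 * p * (y `^ (2 * p)^-1 - 1).
  by rewrite -ler_pdivrMl.
by lra.
Qed.

(** The right side is chosen for its antiderivative, a multiple of [atan (sqrt s)]. For [s <= 1] the
    logarithm costs [s^(-1/2)] and the weight is bounded; for [s > 1], [p > 2] gives decay [s^(-2)]
    against a weight of order [sqrt s]. *)
Lemma weight_radial_bound (b p s : R) : 1 < b -> 2 < p -> 0 < s ->
  ln (1 + s^-1) `^ p * ln (b + Num.sqrt s) <=
  2 * (b + 1) * ((2 * p) `^ p + 1) * ((Num.sqrt s)^-1 / (1 + s)).
Proof.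
move=> b1 p2 s0; set t := Num.sqrt s; have t0 : 0 < t by rewrite sqrtr_gt0.
have sE : s = t ^+ 2 by rewrite sqr_sqrtr// ltW.
have p0 : 0 < p by lra.
have w1 : ln (b + t) <= b + t by apply: ltW; apply: ln_sublinear; lra.
have w0 : 0 <= ln (b + t) by apply: ln_ge0; lra.
have l0 : 0 <= ln (1 + s^-1) by apply: ln_ge0; rewrite lerDl invr_ge0 ltW.
have K0 : 0 <= (2 * p) `^ p by exact: powR_ge0.
have ti : 0 < t^-1 by rewrite invr_gt0.
have s1 : 0 < 1 + s by lra.
have [sl|sg] := leP s 1.
  have tl : t <= 1 by rewrite /t -sqrtr1 ler_sqrt.
  have si : 1 <= s^-1 by rewrite invf_ge1.
  have h1 : ln (1 + s^-1) `^ p <= (2 * p) `^ p * t^-1.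
    have := ln1D_le_powR (ltac:(lra) : 1 < p) si.
    move=> /(ge0_ler_powR (ltW p0) _ _) -/(_ l0 _) h.
    apply: le_trans (h _) _; first by rewrite nnegrE mulr_ge0 ?powR_ge0//; lra.
    rewrite powRM ?powR_ge0//; last lra.
    rewrite -powRrM (_ : (2 * p)^-1 * p = 2^-1); last by field; lra.
    by rewrite powR12_sqrt ?invr_ge0 ?(ltW s0)// sqrtrV ?(ltW s0)//.
  apply: (@le_trans _ _ ((2 * p) `^ p * t^-1 * (b + 1))).
    apply: ler_pM => //; first exact: powR_ge0.
    by lra.
  set K := _ `^ p in K0 *.
  have h2 : 2^-1 * t^-1 <= t^-1 / (1 + s).
    by rewrite mulrC ler_wpM2l ?(ltW ti)// lef_pV2 ?posrE//; lra.
  apply: (@le_trans _ _ (2 * (b + 1) * (K + 1) * (2^-1 * t^-1))); last first.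
    by rewrite ler_wpM2l// !mulr_ge0//; lra.
  have -> : 2 * (b + 1) * (K + 1) * (2^-1 * t^-1) = K * t^-1 * (b + 1) + (b + 1) * t^-1 by field; exact: lt0r_neq0.
  by rewrite lerDl mulr_ge0 ?(ltW ti)//; lra.
have tg : 1 < t by rewrite /t -sqrtr1 ltr_sqrt.
have si : s^-1 <= 1 by rewrite invf_le1// ltW.
have h1 : ln (1 + s^-1) `^ p <= s^-1 ^+ 2.
  have : ln (1 + s^-1) <= s^-1 by apply: le_ln1Dx; rewrite (lt_trans _ (_ : 0 < s^-1)) ?invr_gt0//; lra.
  move=> /(ge0_ler_powR (ltW p0) _ _) -/(_ l0 _) h.
  apply: le_trans (h _) _; first by rewrite nnegrE invr_ge0 ltW.
  rewrite -powR_mulrn ?invr_ge0 ?(ltW s0)//; apply: ger_powR; last lra.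
  by rewrite invr_gt0 s0.
apply: (@le_trans _ _ (s^-1 ^+ 2 * ((b + 1) * t))).
  apply: ler_pM => //; first exact: powR_ge0.
  by nra.
have -> : s^-1 ^+ 2 * ((b + 1) * t) = (b + 1) * (t^-1 / s).
  by rewrite sE; field; lra.
have h2 : s^-1 <= 2 / (1 + s) by rewrite ler_pdivlMr// ler_pdivrMl//; lra.
have h3 : t^-1 / s <= 2 * (t^-1 / (1 + s)).
  by rewrite mulrCA ler_wpM2l// ltW.
have q0 : 0 <= t^-1 / (1 + s) by rewrite divr_ge0// ltW.
set K := _ `^ p in K0 *; set q := t^-1 / (1 + s) in h3 q0 *.
have : (b + 1) * (t^-1 / s) <= (b + 1) * (2 * q) by rewrite ler_wpM2l//; lra.
have : 0 <= (b + 1) * (K * q) := mulr_ge0 (ltac:(lra) : 0 <= b + 1) (mulr_ge0 K0 q0).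
lra.
Qed.

Lemma integral_atan_sqrt :
  (\int[leb]_(s in `]0%R, +oo[) ((Num.sqrt s)^-1 / (1 + s))%:E <= pi%:E)%E.
Proof.
apply: (@integral_le_ftcy _ (fun s => 2 * atan (Num.sqrt s))).
- move=> s s0; have t0 : 0 < Num.sqrt s by rewrite sqrtr_gt0.
  have dt : is_derive s (1 : R) Num.sqrt (2 * Num.sqrt s)^-1 by exact: is_derive1_sqrt.
  have dA := is_derive_chain (is_derive1_atan (Num.sqrt s)) dt.
  apply: is_derive_eq (is_derive_mul (is_derive_cst (2 : R) s (1 : R)) dA) _.
  by rewrite /= mulr0 addr0 sqr_sqrtr ?(ltW s0)//; field; rewrite !gt_eqF//; lra.
- move=> s s0; apply: (@cvgM R); apply: (@cvgV R).
  + by rewrite gt_eqF// sqrtr_gt0.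
  + exact: sqrt_continuous.
  + by rewrite gt_eqF//; lra.
  + by apply: (@cvgD R R); [exact: cvg_cst|exact: cvg_id].
- move=> s s0; rewrite divr_ge0 ?invr_ge0 ?sqrtr_ge0//; lra.
- move=> s s0; rewrite mulr_ge0//; rewrite -(@atan0 R) le_atan// sqrtr_ge0.
- by move=> s s0; have := atan_ltpi2 (Num.sqrt s); lra.
Qed.

Variables (eps k : R).
Hypotheses (eps0 : 0 < eps) (eps1 : eps < 1) (k0 : 0 < k).

(** Of size [- ln eps] below [eps], close to [- ln s] between [eps] and 1, and of order [1 / s] at
    infinity: the plateau, the logarithmic slope and the tail of Moser's function, smoothly
    joined. *)
Definition log_profile (s : R) : R := ln (s + 1) - ln (s + eps).

(* A smooth substitute for the Moser function: [ln ((|x|^2 + 1) / (|x|^2 + eps))]. *)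
Definition moser (x : R * R) : R := k * log_profile (sqdist x (0, 0)).

Definition log_slope (s : R) : R := (s + 1)^-1 - (s + eps)^-1.

Lemma is_derive_log_profile (s : R) : 0 <= s -> is_derive s (1 : R) log_profile (log_slope s).
Proof.
move=> s0.
have d1 (c : R) : 0 < c -> is_derive s (1 : R) (fun s => ln (s + c)) (s + c)^-1.
  move=> c0; have h : 0 < s + c by lra.
  have da := is_derive_add (is_derive_id s (1 : R)) (is_derive_cst (c : R) s (1 : R)).
  have dl : is_derive ((fun s : R => s + cst c s) s) (1 : R) (@ln R) (s + c)^-1 by exact: is_derive1_ln.
  by apply: is_derive_eq (is_derive_chain (g := fun s => s + c) dl da) _; rewrite addr0 mulr1.
exact: is_derive_sub (d1 1 ltr01) (d1 eps eps0).
Qed.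

Lemma log_profile_ge0 s : 0 <= s -> 0 <= log_profile s.
Proof. by move=> s0; have := eps0; have := eps1; rewrite subr_ge0 => *; rewrite ler_ln ?posrE; lra. Qed.

Lemma log_profile_le s : 0 < s -> log_profile s <= ln (1 + s^-1).
Proof.
move=> s0; have e0 := eps0; rewrite /log_profile -ln_div ?posrE; [|lra|lra].
rewrite ler_ln ?posrE; last 2 first.
- by rewrite divr_gt0//; lra.
- by rewrite addr_gt0 ?invr_gt0.
rewrite ler_pdivrMr; last lra.
have : s^-1 * s = 1 by rewrite mulVf// gt_eqF.
have : 0 < s^-1 by rewrite invr_gt0.
nra.
Qed.

Lemma log_profile_le0 s : 0 <= s -> log_profile s <= - ln eps.
Proof.
move=> s0; have e0 := eps0; have e1 := eps1; rewrite /log_profile lerBlDr (addrC (- ln eps)) -ln_div ?posrE//; last lra.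
rewrite ler_ln ?posrE ?divr_gt0//; [|lra|lra].
by rewrite ler_pdivlMr//; nra.
Qed.

Lemma moser_inner x : sqdist x (0, 0) < eps -> k * (- ln eps - 1) <= moser x.
Proof.
move=> xe; have s0 := sqdist_ge0 x (0, 0); rewrite ler_pM2l// /log_profile.
have h1 : 0 <= ln (sqdist x (0, 0) + 1) by apply: ln_ge0; lra.
have h2 : ln (sqdist x (0, 0) + eps) <= ln (2 * eps) by rewrite ler_ln ?posrE; lra.
have h3 : ln (2 * eps) = ln 2 + ln eps by rewrite lnM ?posrE.
have := @le_ln1Dx R 1; rewrite -[1 + 1]/(2%:R) => /(_ ltac:(lra)) => h4.
by lra.
Qed.

Definition moser_slope1 (x : R * R) : R := k * (log_slope (sqdist x (0, 0)) * (2 * x.1)).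
Definition moser_slope2 (x : R * R) : R := k * (log_slope (sqdist x (0, 0)) * (2 * x.2)).

Lemma is_derive_moser (x v : R * R) : is_derive x v moser
  (k * (log_slope (sqdist x (0, 0)) * (2 * x.1 * v.1 + 2 * x.2 * v.2))).
Proof.
have ds := is_derive_sqdist (0, 0) x v.
have dl := is_derive_chain (g := fun x => sqdist x (0, 0)) (is_derive_log_profile (sqdist_ge0 x (0, 0))) ds.
apply: is_derive_eq (is_derive_mul (is_derive_cst (k : R) x v) dl) _.
by rewrite /= !subr0 mulr0 addr0.
Qed.

Lemma continuous_sqdist0 : continuous (fun x : R * R => sqdist x (0, 0)).
Proof. exact: Ck2_upto_continuous (@Ck2_upto_sqdist R 0 (0, 0)). Qed.

Lemma continuous_log_slope : continuous (fun x : R * R => log_slope (sqdist x (0, 0))).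
Proof.
have c (a : R) : 0 < a -> continuous (fun x : R * R => (sqdist x (0, 0) + a)^-1).
  move=> a0; apply: Ck2_upto_continuous (@Ck2_upto_inv R 0 _ _ _).
    by move=> x; have := sqdist_ge0 x (0, 0) => h; rewrite gt_eqF//; lra.
  by apply: Ck2_upto_add; [exact: Ck2_upto_sqdist|exact: Ck2_upto_cst].
by apply: continuous_sub; exact: c.
Qed.

Lemma continuous_moser : continuous moser.
Proof.
apply: continuous_mul; first exact: cst_continuous.
move=> x; have := is_derive_log_profile (sqdist_ge0 x (0, 0)) => /is_derive1_continuous h.
by apply: (@continuous_comp _ _ _ (fun x : R * R => sqdist x (0, 0)) log_profile) => //; exact: continuous_sqdist0.
Qed.

Lemma moser_weak_gradient : is_weak_gradient moser (fun x => (moser_slope1 x, moser_slope2 x)).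
Proof.
apply: C1_weak_gradient.
- exact: continuous_moser.
- apply: continuous_mul; first exact: cst_continuous.
  apply: continuous_mul; first exact: continuous_log_slope.
  by apply: continuous_mul; [exact: cst_continuous|move=> x; exact: cvg_fst].
- apply: continuous_mul; first exact: cst_continuous.
  apply: continuous_mul; first exact: continuous_log_slope.
  by apply: continuous_mul; [exact: cst_continuous|move=> x; exact: cvg_snd].
- by move=> x; apply: is_derive_eq (is_derive_moser x e1) _; rewrite /= mulr1 mulr0 addr0.
- by move=> x; apply: is_derive_eq (is_derive_moser x e2) _; rewrite /= mulr1 mulr0 add0r.
Qed.

Lemma measurable_moser : measurable_fun (setT : set T2) moser.
Proof. by apply: continuous_measurable2; exact: continuous_moser. Qed.

Lemma continuous_log_slope1 (s : R) : 0 < s -> {for s, continuous log_slope}.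
Proof.
move=> s0; have e0 := eps0; apply: (@cvgB R R); apply: (@cvgV R).
- by rewrite gt_eqF//; lra.
- by apply: (@cvgD R R); [exact: cvg_id|exact: cvg_cst].
- by rewrite gt_eqF//; lra.
- by apply: (@cvgD R R); [exact: cvg_id|exact: cvg_cst].
Qed.

(** Since [0 <= - log_slope s <= 1 / (s + eps)], multiplying by [s] gives at most 1. The energy
    density is thereby dominated by an exact derivative. *)
Lemma log_slope_sqr s : 0 < s -> s * log_slope s ^+ 2 <= - log_slope s.
Proof.
move=> s0; have e0 := eps0; have e1 := eps1; rewrite /log_slope.
have a1 : 0 < (s + 1)^-1 by rewrite invr_gt0; lra.
have a2 : 0 < (s + eps)^-1 by rewrite invr_gt0; lra.
have a3 : s * (s + eps)^-1 <= 1 by rewrite ler_pdivrMr; lra.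
have a4 : (s + 1)^-1 <= (s + eps)^-1 by rewrite lef_pV2 ?posrE; lra.
set x := (s + 1)^-1 in a1 a4 *; set y := (s + eps)^-1 in a2 a3 a4 *.
have h : s * (y - x) <= 1 by nra.
have : s * (y - x) * (y - x) <= 1 * (y - x) by rewrite ler_wpM2r// subr_ge0.
nra.
Qed.

Lemma moser_energy : (gradient_norm moser ^+ 2 <= (4 * pi * k ^+ 2 * - ln eps)%:E)%E.
Proof.
rewrite (sqr_gradient_norm moser_weak_gradient).
(* Absolute values extend the radial density to a continuous nonnegative function on the whole line,
   as [radial_integral] expects. *)
pose h (s : R) : R := 4 * k ^+ 2 * (`|s| * ((`|s| + 1)^-1 - (`|s| + eps)^-1) ^+ 2).
have -> : (\int[@leb2 R]_x (enorm2 (moser_slope1 x, moser_slope2 x) ^+ 2)%:E =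
    \int[@leb2 R]_x (h (sqdist x (0, 0)))%:E)%E.
  apply: eq_integral => x _; congr EFin; rewrite /enorm2 sqr_sqrtr ?addr_ge0 ?sqr_ge0//.
  rewrite /h (ger0_norm (sqdist_ge0 x _)) /moser_slope1 /moser_slope2 -/(log_slope _) /=.
  rewrite [X in _ = _ * (X * _)]/sqdist /= !subr0; ring.
have cn (a : R) : 0 < a -> continuous (fun s : R => (`|s| + a)^-1).
  move=> a0 s; apply: (@cvgV R); first by rewrite gt_eqF// ltr_wpDl.
  by apply: (@cvgD R R); [exact: norm_continuous|exact: cvg_cst].
have ch : continuous h.
  apply: continuous_mul; first exact: cst_continuous.
  apply: continuous_mul; first exact: norm_continuous.
  by apply: continuous_exprn; apply: continuous_sub; exact: cn.
have h0 s : 0 <= h s.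
  by apply: mulr_ge0; apply: mulr_ge0; rewrite ?sqr_ge0.
rewrite (radial_integral (0, 0) (h := EFin \o h)); last 2 first.
- by apply/measurable_EFinP; exact: continuous_measurable_fun.
- by move=> s; rewrite lee_fin.
rewrite mulrAC -mulrA [4 * _]mulrC -!mulrA EFinM lee_pmul2l ?lte_fin ?pi_gt0//.
rewrite mulrA.
have c0 : 0 <= 4 * k ^+ 2 by rewrite mulr_ge0// sqr_ge0.
apply: (@le_trans _ _ (\int[leb]_(s in `]0%R, +oo[) (4 * k ^+ 2 * - log_slope s)%:E)%E).
  apply: ge0_le_integral => //=.
  - by move=> s _; rewrite lee_fin.
  - by apply: measurable_funTS; apply/measurable_EFinP; exact: continuous_measurable_fun.
  - apply/measurable_EFinP; apply: continuous_pos_measurable => s s0.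
    apply: (@cvgM R); first exact: cvg_cst.
    by apply: (@cvgN R R); exact: continuous_log_slope1.
  - move=> s; rewrite in_itv/= andbT => s0; rewrite lee_fin /h gtr0_norm//.
    by rewrite ler_wpM2l// log_slope_sqr.
have -> : 4 * - ln eps * k ^+ 2 = 4 * k ^+ 2 * - ln eps by ring.
(* The shift by [- ln eps], the value of [log_profile] at 0, makes the antiderivative
   nonnegative. *)
apply: (@integral_le_ftcy _ (fun s => 4 * k ^+ 2 * (- ln eps - log_profile s))
  (fun s => 4 * k ^+ 2 * - log_slope s)).
- move=> s s0; apply: is_derive_eq (is_derive_mul (is_derive_cst (4 * k ^+ 2 : R) s (1 : R))
    (is_derive_sub (is_derive_cst (- ln eps : R) s (1 : R)) (is_derive_log_profile (ltW s0)))) _.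
  by rewrite /= mulr0 addr0 sub0r.
- move=> s s0; apply: (@cvgM R); first exact: cvg_cst.
  by apply: (@cvgN R R); exact: continuous_log_slope1.
- move=> s s0; rewrite mulr_ge0//; apply: le_trans (log_slope_sqr s0).
  by rewrite mulr_ge0 ?(ltW s0)// sqr_ge0.
- by move=> s s0; rewrite mulr_ge0// subr_ge0 log_profile_le0// (ltW s0).
- by move=> s s0; rewrite ler_wpM2l// lerBlDr lerDl log_profile_ge0// (ltW s0).
Qed.

(** The outer [pi] comes from [radial_integral], the middle factor from [weight_radial_bound], the
    last [pi] from [integral_atan_sqrt]. *)
Definition moser_const (b p : R) : R := pi * (2 * (b + 1) * ((2 * p) `^ p + 1) * pi).

(** Uniformity in [eps] comes from comparing [log_profile] with its value [ln (1 + 1 / s)] at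
    [eps = 0], whose logarithmic singularity is harmless. *)
Lemma moser_weighted (b p : R) : 1 < b -> 2 < p ->
  (\int[@leb2 R]_x (`|moser x| `^ p * ln (b + enorm2 x))%:E <=
   (k `^ p * moser_const b p)%:E)%E.
Proof.
move=> b1 p2.
pose h (s : R) : R := `|k * log_profile s| `^ p * ln (b + Num.sqrt s).
have mh : measurable_fun (setT : set R) h.
  have ml (a : R) : measurable_fun (setT : set R) (fun s => ln (s + a)).
    by apply: measurable_fcomp; [exact: measurable_funD|exact: measurable_ln].
  apply: measurable_funM.
    apply: (measurable_fcomp (g := fun t => t `^ p)); last exact: measurable_powR.
    apply: measurableT_comp => //; apply: measurable_funM => //.
    by apply: measurable_funB; exact: ml.
  apply: measurable_fcomp; last exact: measurable_ln.
  by apply: measurable_funD => //; exact: (continuous_measurable_fun (@sqrt_continuous R)).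
have h0 s : 0 <= h s.
  rewrite /h mulr_ge0 ?powR_ge0// ln_ge0//; have := sqrtr_ge0 s; lra.
have -> : (\int[@leb2 R]_x (`|moser x| `^ p * ln (b + enorm2 x))%:E =
    \int[@leb2 R]_x (h (sqdist x (0, 0)))%:E)%E.
  by apply: eq_integral => x _; rewrite /h -enorm2_sqdist.
rewrite (radial_integral (0, 0) (h := EFin \o h)); last 2 first.
- by apply/measurable_EFinP.
- by move=> s; rewrite lee_fin.
rewrite /moser_const mulrCA EFinM lee_pmul2l ?lte_fin ?pi_gt0//.
set K := 2 * (b + 1) * _.
have K0 : 0 <= K by rewrite /K !mulr_ge0 ?addr_ge0 ?powR_ge0//; lra.
have kp : 0 <= k `^ p * K by rewrite mulr_ge0// powR_ge0.
have mr : measurable_fun (`]0%R, +oo[ : set R) (fun s : R => (Num.sqrt s)^-1 / (1 + s)).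
  apply: continuous_pos_measurable => s s0; apply: (@cvgM R); apply: (@cvgV R).
  - by rewrite gt_eqF// sqrtr_gt0.
  - exact: sqrt_continuous.
  - by rewrite gt_eqF//; lra.
  - by apply: (@cvgD R R); [exact: cvg_cst|exact: cvg_id].
rewrite mulrA EFinM.
apply: (@le_trans _ _ (\int[leb]_(s in `]0%R, +oo[)
    ((k `^ p * K)%:E * ((Num.sqrt s)^-1 / (1 + s))%:E))%E).
  apply: ge0_le_integral => //=.
  - by move=> s _; rewrite lee_fin.
  - by apply: measurable_funTS; apply/measurable_EFinP.
  - by apply: measurable_funeM; apply/measurable_EFinP.
  - move=> s; rewrite in_itv/= andbT => s0; rewrite -EFinM lee_fin /h.
    have l0 := log_profile_ge0 (ltW s0).
    rewrite ger0_norm ?mulr_ge0 ?(ltW k0)// powRM ?(ltW k0)// -2!(mulrA (k `^ p)).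
    rewrite ler_wpM2l ?powR_ge0//; apply: le_trans (weight_radial_bound b1 p2 s0).
    rewrite ler_wpM2r//.
      by rewrite ln_ge0//; have := sqrtr_ge0 s; lra.
    apply: ge0_ler_powR; [lra|by []| |exact: log_profile_le].
    by rewrite nnegrE; apply: le_trans l0 (log_profile_le s0).
rewrite ge0_integralZl//.
- by rewrite lee_wpmul2l ?lee_fin//; exact: integral_atan_sqrt.
- by apply/measurable_EFinP.
- move=> s; rewrite /= in_itv/= andbT => s0.
  by rewrite lee_fin divr_ge0 ?invr_ge0 ?sqrtr_ge0//; lra.
Qed.

(** Only the disc of squared radius [eps], of area [pi * eps], is kept: there [moser] is at least
    [k * (- ln eps - 1) >= 1], so its [p]-th power is at least 1, and the weight is at least
    [ln b]. *)
Lemma moser_TM (b p alpha : R) : 1 < b -> 0 < alpha -> 0 < p -> 1 <= k * (- ln eps - 1) ->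
  ((expR (alpha * (k * (- ln eps - 1)) ^+ 2) * ln b * (pi * eps))%:E <=
   TM_functional b p alpha moser)%E.
Proof.
move=> b1 a0 p0 m1; set m := k * _ in m1 *.
rewrite /TM_functional.
pose D : set T2 := [set x | sqdist x (0, 0) < eps].
have mD : measurable D.
  exact: measurable_disc.
have -> : ((expR (alpha * m ^+ 2) * ln b * (pi * eps))%:E =
    \int[@leb2 R]_(x in D) (expR (alpha * m ^+ 2) * ln b)%:E)%E.
  by rewrite integral_cst// [X in (_ * X)%E]disc_area.
apply: (@le_trans _ _ (\int[@leb2 R]_(x in D)
    (`|moser x| `^ p * expR (alpha * moser x ^+ 2) * ln (b + enorm2 x))%:E)%E).
  apply: ge0_le_integral => //=.
  - by move=> x _; rewrite lee_fin mulr_ge0 ?expR_ge0// ln_ge0// ltW.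
  - by apply: measurable_funTS; apply: measurable_TM; exact: measurable_moser.
  - move=> x /moser_inner mx; rewrite lee_fin -/m in mx *.
    have lb : 0 <= ln b by rewrite ln_ge0// ltW.
    apply: ler_pM; rewrite ?expR_ge0//.
      rewrite -[leLHS]mul1r; apply: ler_pM; rewrite ?expR_ge0//.
        rewrite ger0_norm; last lra.
        have -> : 1 = 1 `^ p :> R by rewrite powR1.
        by apply: ge0_ler_powR; rewrite ?nnegrE//; lra.
      rewrite ler_expR ler_pM2l// lerXn2r// ?nnegrE; lra.
    rewrite ler_ln ?posrE; [by rewrite lerDl sqrtr_ge0|lra|].
    by have := sqrtr_ge0 (x.1 ^+ 2 + x.2 ^+ 2); rewrite -/(enorm2 _); lra.
apply: ge0_subset_integral => //.
- by apply: measurable_TM; exact: measurable_moser.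
- move=> x _; rewrite lee_fin !mulr_ge0 ?powR_ge0 ?expR_ge0//; exact: weight_ge0.
Qed.

Lemma moser_weighted_norm (b p : R) : 1 < b -> 2 < p ->
  (weighted_norm b p moser ^+ 2 <= (k ^+ 2 * (moser_const b p `^ p^-1) ^+ 2)%:E)%E.
Proof.
move=> b1 p2; have p0 : 0 < p by lra.
have c0 : 0 <= moser_const b p.
  rewrite /moser_const; apply: mulr_ge0; first exact: pi_ge0.
  apply: mulr_ge0; last exact: pi_ge0.
  by apply: mulr_ge0; [lra|rewrite addr_ge0 ?powR_ge0].
have h : (weighted_norm b p moser <= (k * moser_const b p `^ p^-1)%:E)%E.
  rewrite /weighted_norm.
  have -> : (k * moser_const b p `^ p^-1)%:E = (poweR (k `^ p * moser_const b p)%:E p^-1)%E.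
    rewrite poweR_EFin powRM ?powR_ge0// -powRrM mulfV ?gt_eqF// powRr1// ltW//.
  apply: gt0_ler_poweR; rewrite ?invr_ge0 ?(ltW p0)//.
  - rewrite in_itv/= leey andbT integral_ge0// => x _.
    by rewrite lee_fin mulr_ge0 ?powR_ge0// weight_ge0.
  - by rewrite in_itv/= leey andbT lee_fin mulr_ge0// powR_ge0.
  - exact: moser_weighted.
rewrite -exprMn EFin_expe; apply: lee_pmul; rewrite ?poweR_ge0//.
Qed.

Lemma moser_DL (b p : R) : 1 < b -> 2 < p ->
  4 * pi * k ^+ 2 * - ln eps + k ^+ 2 * (moser_const b p `^ p^-1) ^+ 2 <= 1 ->
  (DLspace b p `&` [set u | (DLnorm b p u ^+ 2 <= 1)%E]) moser.
Proof.
move=> b1 p2 h.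
have hn : (DLnorm b p moser ^+ 2 <= 1)%E.
  rewrite sqr_DLnorm; apply: le_trans (_ : _ <= 1%:E)%E _ => //.
  by apply: le_trans (leeD moser_energy (moser_weighted_norm b1 p2)) _; rewrite -EFinD lee_fin.
have fin (x : \bar R) : (0 <= x -> x ^+ 2 <= 1 -> x < +oo)%E.
  by case: x => [r| |] //=; rewrite ?ltry.
have g0 : (0 <= gradient_norm moser)%E by exact: Lnorm_ge0.
have w0 : (0 <= weighted_norm b p moser)%E by exact: poweR_ge0.
split => //; split.
- exact: continuous_loc_integrable2 continuous_moser.
- by exists (fun x => (moser_slope1 x, moser_slope2 x)); exact: moser_weak_gradient.
- apply: fin => //; apply: le_trans hn; rewrite sqr_DLnorm leeDl// expe_ge0//.
- apply: fin => //; apply: le_trans hn; rewrite sqr_DLnorm leeDr// expe_ge0//.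
Qed.

End moser.

(** * Choice of the parameters and divergence of the supremum *)

Section sharpness.
Variable R : realType.

(** Here [L] stands for [- ln eps] and [beta] for [4 pi]. With [k^2 = q / (beta L)] the energy is
    exactly [q < 1], leaving [1 - q] for the weighted norm, while [q > beta / a] makes the exponent
    about [(1 + ga) L], which beats the factor [expR (- L)] of the area. *)
Lemma moser_parameters (a beta M c A : R) : 0 < beta -> beta < a -> 0 <= M -> 0 < c ->
  exists L k, [/\ 0 < L, 0 < k, beta * k ^+ 2 * L + k ^+ 2 * M <= 1, 1 <= k * (L - 1) &
    A <= expR (a * (k * (L - 1)) ^+ 2) * c * expR (- L)].
Proof.
move=> be0 bea M0 c0; have a0 : 0 < a by lra.
pose ga := (a / beta - 1) / 2; pose q := (1 + beta / a) / 2.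
have bea1 : 0 < beta / a by rewrite divr_gt0.
have bea2 : beta / a < 1 by rewrite ltr_pdivrMr// mul1r.
have abe : 1 < a / beta by rewrite ltr_pdivlMr// mul1r.
have ga0 : 0 < ga by rewrite divr_gt0//; lra.
have q0 : 0 < q by rewrite divr_gt0//; lra.
have q1 : q < 1 by rewrite /q; lra.
have aq : a * q = beta * (1 + ga) by rewrite /q /ga; field; rewrite !gt_eqF.
(* One threshold per requirement: [L1] for [k * (L - 1) >= 1], [L2] for the norm constraint, [L3]
   for exceeding [A]. *)
pose L1 := beta / q; pose L2 := q * M / (beta * (1 - q)).
pose L3 := (`|A| / c + 2 + 2 * ga) / ga.
have L10 : 0 <= L1 by rewrite divr_ge0// ltW.
have q1' : 0 < 1 - q by lra.
have L20 : 0 <= L2 by rewrite divr_ge0// mulr_ge0// ltW.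
have L30 : 0 <= L3.
  apply: divr_ge0; last exact: ltW.
  by have : 0 <= `|A| / c := divr_ge0 (normr_ge0 A) (ltW c0); lra.
pose L := 2 + L1 + L2 + L3.
have L0 : 0 < L by rewrite /L; lra.
pose k := Num.sqrt (q / (beta * L)).
have k2 : k ^+ 2 = q / (beta * L) by rewrite sqr_sqrtr// (divr_ge0 (ltW q0) (ltW (mulr_gt0 be0 L0))).
have k0 : 0 < k by rewrite sqrtr_gt0 divr_gt0// mulr_gt0.
(* This is [(L - 1)^2 >= L (L - 2)], the two sides differing by 1. *)
have m2 : q / beta * (L - 2) <= (k * (L - 1)) ^+ 2.
  rewrite exprMn k2 (_ : q / (beta * L) * _ = q / beta * ((L - 1) ^+ 2 / L)); last first.
    by field; rewrite !gt_eqF.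
  apply: ler_wpM2l; first by rewrite divr_ge0// ltW.
  rewrite ler_pdivlMr//.
  by rewrite -subr_ge0 (_ : _ - _ = 1) //; ring.
exists L, k; split => //.
- rewrite k2 (_ : beta * (q / (beta * L)) * L = q); last by field; rewrite !gt_eqF.
  have : q / (beta * L) * M <= 1 - q.
    rewrite mulrAC ler_pdivrMr ?mulr_gt0//.
    have : L2 <= L by rewrite /L; lra.
    rewrite /L2 ler_pdivrMr ?mulr_gt0//.
    by rewrite (_ : (1 - q) * (beta * L) = L * (beta * (1 - q)))//; ring.
  lra.
- have m0 : 0 <= k * (L - 1) by rewrite mulr_ge0 ?(ltW k0)// /L; lra.
  rewrite -(@ler_pXn2r _ 2) ?nnegrE// expr1n; apply: le_trans m2.
  have e1 : q / beta * L1 = 1 by rewrite /L1; field; rewrite !gt_eqF.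
  rewrite -[leLHS]e1.
  by apply: ler_wpM2l; [rewrite divr_ge0// ltW|rewrite /L; lra].
have h1 : (1 + ga) * (L - 2) <= a * (k * (L - 1)) ^+ 2.
  apply: le_trans (_ : a * (q / beta * (L - 2)) <= _); last by rewrite ler_wpM2l// ltW.
  by rewrite 2!mulrA aq [beta * _]mulrC mulfK ?gt_eqF.
have h2 : `|A| / c <= expR (a * (k * (L - 1)) ^+ 2 - L).
  apply: le_trans (expR_ge1Dx _).
  have : ga * L3 = `|A| / c + 2 + 2 * ga by rewrite /L3 mulrC mulfVK ?gt_eqF.
  have : ga * L3 <= ga * (L - 2) by apply: ler_wpM2l; [exact: ltW|rewrite /L; lra].
  lra.
rewrite mulrAC -expRD; apply: le_trans (ler_norm A) _.
by rewrite -ler_pdivrMr.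
Qed.

Lemma TM_sup_infty (p b alpha : R) : 2 < p -> 1 < b -> 4 * pi < alpha ->
  TM_sup b p alpha = +oo%E.
Proof.
move=> p2 b1 al; apply/eqyP => A A0.
have pi40 : 0 < 4 * (pi : R) by rewrite mulr_gt0// pi_gt0.
have M0 : 0 <= (moser_const b p `^ p^-1) ^+ 2 by exact: sqr_ge0.
have c0 : 0 < ln b * pi by rewrite mulr_gt0 ?pi_gt0// ln_gt0.
have [L [k [L0 k0 hD h1 hA]]] := moser_parameters A pi40 al M0 c0.
have e0 : 0 < expR (- L) by exact: expR_gt0.
have e1 : expR (- L) < 1 by rewrite -expR0 ltr_expR oppr_lt0.
have le : - ln (expR (- L)) = L by rewrite expRK opprK.
apply: le_trans (_ : TM_functional b p alpha (moser (expR (- L)) k) <= _)%E; last first.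
  apply: ereal_sup_ubound; exists (moser (expR (- L)) k) => //.
  by apply: moser_DL => //; rewrite le.
have p0 : 0 < p by lra.
have := @moser_TM R (expR (- L)) k e0 k0 b p alpha b1 (lt_trans pi40 al) p0.
rewrite le => h; apply: le_trans (h h1); rewrite lee_fin.
by apply: le_trans hA _; rewrite !mulrA.
Qed.

End sharpness.

(** * The subcritical bound *)

Section potentials.
Variable R : realType.
Local Notation T2 := (measurableTypeR R * measurableTypeR R)%type.
Local Notation leb := (@lebesgue_measure R).

(** With [s] the squared distance this is [|y - x|^(-2 th)] on a disc, locally integrable in the
    plane for [th < 1]. *)
Definition power_kernel (th t s : R) : R := if s < t then s `^ (- th) else 0.

Lemma power_kernel_ge0 th t s : 0 <= power_kernel th t s.
Proof. by rewrite /power_kernel; case: ifP => // _; exact: powR_ge0. Qed.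

Lemma measurable_power_kernel th t : measurable_fun setT (power_kernel th t).
Proof. by apply: (@measurable_cut R t (fun s => s `^ (- th))); exact: measurable_powR. Qed.

Lemma measurable_pos_inv d (T : measurableType d) (f : T -> R) :
  measurable_fun setT f -> (forall x, 0 < f x) -> measurable_fun setT (fun x => (f x)^-1).
Proof.
move=> mf f0; rewrite (_ : (fun x => (f x)^-1) = (fun x => f x `^ (-1))).
  by apply: (measurable_fcomp (g := fun t => t `^ (-1))) => //; exact: measurable_powR.
by apply/funext => x; rewrite powR_inv1// ltW.
Qed.

Lemma radial_le_ftc (c : R * R) (t : R) (h F f : R -> R) : 0 < t ->
  measurable_fun setT h -> (forall s, 0 <= h s) ->
  (forall s, t < s -> h s = 0) ->
  (forall s, 0 < s -> h s <= f s) ->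
  (forall s : R, 0 < s -> is_derive s (1 : R) F (f s)) ->
  (forall s, 0 < s -> {for s, continuous f}) -> (forall s, 0 < s -> 0 <= F s) ->
  (\int[@leb2 R]_y (h (sqdist y c))%:E <= (pi * F t)%:E)%E.
Proof.
move=> t0 mh h0 ht hf dF cf F0; have f0 s : 0 < s -> 0 <= f s.
  by move=> s0; exact: le_trans (h0 s) (hf s s0).
rewrite (radial_integral c (h := EFin \o h)); last 2 first.
- by apply/measurable_EFinP.
- by move=> s; rewrite lee_fin.
rewrite EFinM lee_pmul2l ?lte_fin ?pi_gt0//.
apply: le_trans (integral_le_ftc t0 dF cf f0 F0).
have -> : (\int[leb]_(s in `]0%R, +oo[) (EFin \o h) s = \int[leb]_(s in `]0%R, t]) (h s)%:E)%E.
  rewrite [LHS]integral_mkcond [RHS]integral_mkcond; apply: eq_integral => s _.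
  rewrite !patchE !mem_setE !in_itv/= andbT; case: (ltP 0 s) => //= s0.
  by case: (leP s t) => // st; rewrite ht.
apply: ge0_le_integral => //=.
- by move=> s _; rewrite lee_fin.
- by apply: measurable_funTS; apply/measurable_EFinP.
- apply/measurable_EFinP; apply: measurable_funS (continuous_pos_measurable cf) => //.
  by move=> s /=; rewrite !in_itv/= andbT => /andP[].
- by move=> s; rewrite in_itv/= => /andP[s0 _]; rewrite lee_fin hf.
Qed.

Lemma is_derive_powR (a x : R) : 0 < x -> is_derive x (1 : R) (fun s => s `^ a) (a * x `^ (a - 1)).
Proof. exact: is_derive1_powR. Qed.

Lemma continuous_powR_pos (a x : R) : 0 < x -> {for x, continuous (fun s : R => s `^ a)}.
Proof. by move=> x0; apply: is_derive1_continuous (is_derive_powR a x0). Qed.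

Lemma integral_power_kernel (c : R * R) (th t : R) : th < 1 -> 0 < t ->
  (\int[@leb2 R]_y (power_kernel th t (sqdist y c))%:E <=
   (pi * (t `^ (1 - th) / (1 - th)))%:E)%E.
Proof.
move=> th1 t0; have th0 : 0 < 1 - th by lra.
apply: (@radial_le_ftc _ _ _ (fun s => s `^ (1 - th) / (1 - th)) (fun s => s `^ (- th))) => //.
- exact: measurable_power_kernel.
- exact: power_kernel_ge0.
- by move=> s ts; rewrite /power_kernel ltNge (ltW ts).
- by move=> s s0; rewrite /power_kernel; case: ifP => // _; exact: powR_ge0.
- move=> s s0.
  apply: is_derive_eq (is_derive_mul (is_derive_powR (1 - th) s0)
    (is_derive_cst ((1 - th)^-1 : R) s (1 : R))) _.
  rewrite mulr0 add0r mulrA mulVf ?gt_eqF// mul1r; congr (_ `^ _); ring.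
- by move=> s s0; exact: continuous_powR_pos.
- by move=> s s0; rewrite divr_ge0 ?powR_ge0// ltW.
Qed.

(** The origin of [4 pi]: the squared kernel is [1 / (4 pi^2 s)], and [s^-1 / (1 + v s^(-th))] has
    the antiderivative [th^-1 ln (1 + s^th / v)]; radial integration contributes one factor [pi]. *)
Lemma integral_riesz_sqr (c : R * R) (r th v : R) : 0 < r -> 0 < th -> 0 < v ->
  (\int[@leb2 R]_y (riesz r (sqdist y c) ^+ 2 / (1 + v * sqdist y c `^ (- th)))%:E <=
   ((4 * pi * th)^-1 * ln (1 + r `^ th / v))%:E)%E.
Proof.
move=> r0 th0 v0.
pose C : R := (4 * pi ^+ 2)^-1.
have C0 : 0 <= C by rewrite invr_ge0 mulr_ge0// sqr_ge0.
have q0 s : 0 < 1 + v * s `^ (- th).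
  have := mulr_ge0 (ltW v0) (powR_ge0 s (- th)); lra.
pose f (s : R) := C * (s^-1 / (1 + v * s `^ (- th))).
pose F (s : R) := C / th * ln (1 + v^-1 * s `^ th).
have -> : (4 * pi * th)^-1 * ln (1 + r `^ th / v) = pi * F r.
  rewrite /F /C (mulrC (v^-1)) mulrA; congr (_ * ln _).
  by have := @pi_gt0 R; move: (@pi R) => q qp; field; rewrite !gt_eqF.
apply: (@radial_le_ftc c r (fun s => riesz r s ^+ 2 / (1 + v * s `^ (- th))) F f) => //.
- apply: measurable_funM; first by apply: measurable_funX; exact: measurable_riesz.
  apply: measurable_pos_inv => //.
  apply: measurable_funD => //; apply: measurable_funM => //; exact: measurable_powR.
- by move=> s; rewrite divr_ge0 ?sqr_ge0// ltW.
- by move=> s rs; rewrite /riesz ltNge (ltW rs) expr0n mul0r.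
- move=> s s0; rewrite /f mulrA ler_wpM2r ?invr_ge0 ?(ltW (q0 s))//.
  rewrite /riesz; case: ifP => _; last by rewrite expr0n divr_ge0// ltW.
  have sq : (s `^ (- 2^-1)) ^+ 2 = s^-1.
    rewrite -powR_mulrn ?powR_ge0// -powRrM (_ : - 2^-1 * 2%:R = -1) ?powR_inv1 ?(ltW s0)//.
    by rewrite mulNr mulVf.
  by rewrite exprMn sq exprVn exprMn /C -natrX.
- move=> s s0.
  have d1 := is_derive_mul (is_derive_cst (v^-1 : R) s (1 : R)) (is_derive_powR th s0).
  have d2 := is_derive_add (is_derive_cst (1 : R) s (1 : R)) d1.
  have p0 : 0 < 1 + v^-1 * s `^ th.
    by have : 0 < v^-1 * s `^ th by [rewrite mulr_gt0 ?invr_gt0// powR_gt0]; lra.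
  have dl : is_derive (1 + v^-1 * s `^ th) (1 : R) (@ln R) (1 + v^-1 * s `^ th)^-1.
    exact: is_derive1_ln.
  have d3 := is_derive_chain (g := fun s => 1 + v^-1 * s `^ th) dl d2.
  apply: is_derive_eq (is_derive_mul (is_derive_cst (C / th : R) s (1 : R)) d3) _.
  rewrite /f /= !mulr0 !addr0 add0r powRN.
  have -> : s `^ (th - 1) = s `^ th / s 
    by rewrite powRD ?powR_inv1 ?(ltW s0)// (gt_eqF s0) implybT.
  have : 0 < s `^ th by exact: powR_gt0.
  move: (s `^ th) p0 => z p0 z0; field.
  rewrite !gt_eqF//; nra.
- move=> s s0; apply: (@cvgM R); first exact: cvg_cst.
  apply: (@cvgM R); apply: (@cvgV R).
  + by rewrite gt_eqF.
  + exact: cvg_id.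
  + by rewrite gt_eqF.
  + apply: (@cvgD R R); first exact: cvg_cst.
    by apply: (@cvgM R); [exact: cvg_cst|exact: continuous_powR_pos].
- move=> s s0; rewrite mulr_ge0//; first by rewrite divr_ge0// ltW.
  by rewrite ln_ge0// lerDl mulr_ge0 ?powR_ge0// invr_ge0 ltW.
Qed.

Lemma weighted_amgm (a k q tau : R) : 0 < q -> 0 < tau ->
  a * k <= tau / 2 * (a ^+ 2 * q) + (2 * tau)^-1 * (k ^+ 2 / q).
Proof.
move=> q0 t0; rewrite -subr_ge0.
have -> : tau / 2 * (a ^+ 2 * q) + (2 * tau)^-1 * (k ^+ 2 / q) - a * k =
    (tau * q * a - k) ^+ 2 / (2 * tau * q) by field; rewrite !gt_eqF.
by rewrite divr_ge0 ?sqr_ge0// !mulr_ge0// ltW.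
Qed.

Lemma riesz_potential_bound (a : R * R -> R) (c : R * R) (r th de F : R) :
  measurable_fun (setT : set T2) a -> 
  (\int[@leb2 R]_y (a y ^+ 2)%:E <= 1)%E -> 0 < r -> 0 < th -> 0 < de ->
  (forall y, 0 <= a y) -> 0 <= F ->
  (\int[@leb2 R]_y (a y ^+ 2 * power_kernel th r (sqdist y c))%:E <= F%:E)%E ->
  (\int[@leb2 R]_y (a y * riesz r (sqdist y c))%:E <=
   (Num.sqrt ((1 + de) * ((4 * pi * th)^-1 * ln (1 + (r `^ th * F + 1) / de))))%:E)%E.
Proof.
move=> ma a1 r0 th0 de0 a0 F0 aF.
have rth : 0 < r `^ th by exact: powR_gt0.
(* Chosen so that [v F <= de], whence the weighted energy is at most [1 + de], while [r^th / v] is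
   exactly [(r^th F + 1) / de]; the added [r^(-th)] keeps the denominator positive when [F = 0]. *)
pose v := de / (F + (r `^ th)^-1).
have Fr : 0 < F + (r `^ th)^-1 by rewrite ltr_wpDl// invr_gt0.
have v0 : 0 < v by rewrite divr_gt0.
have vF : v * F <= de by rewrite /v mulrAC ler_pdivrMr// ler_pM2l// lerDl invr_ge0 ltW.
have -> : (r `^ th * F + 1) / de = r `^ th / v.
  have h : 0 < r `^ th * F + 1 by rewrite ltr_wpDl// mulr_ge0// ltW.
  rewrite /v; move: (r `^ th) rth h => z z0 h; field; rewrite !gt_eqF//; lra.
set Y := (4 * pi * th)^-1 * _.
have Y0 : 0 < Y.
  have pi0 := @pi_gt0 R.
  apply: mulr_gt0; first by rewrite invr_gt0 (mulr_gt0 (mulr_gt0 _ pi0) th0).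
  by rewrite ln_gt0// ltrDl divr_gt0.
set S := Num.sqrt _.
have de1 : 0 < 1 + de by lra.
have S0 : 0 < S by rewrite sqrtr_gt0 mulr_gt0.
have S2 : S ^+ 2 = (1 + de) * Y by rewrite sqr_sqrtr// mulr_ge0// ltW.
(* The minimiser of [tau / 2 * (1 + de) + Y / (2 * tau)], whose minimum is [S]. *)
pose tau := S / (1 + de).
have tau0 : 0 < tau by rewrite divr_gt0.
have q0 s : 0 < 1 + v * s `^ (- th).
  have := mulr_ge0 (ltW v0) (powR_ge0 s (- th)); lra.
pose K y : R := riesz r (sqdist y c) ^+ 2 / (1 + v * sqdist y c `^ (- th)).
have K0 y : 0 <= K y by rewrite divr_ge0 ?sqr_ge0// ltW.
have mK : measurable_fun (setT : set T2) K.
  apply: (@measurable_sqdist_comp R c (fun s => riesz r s ^+ 2 / (1 + v * s `^ (- th)))).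
  apply: measurable_funM; first by apply: measurable_funX; exact: measurable_riesz.
  apply: measurable_pos_inv => //.
  by apply: measurable_funD => //; apply: measurable_funM => //; exact: measurable_powR.
have ma2 : measurable_fun (setT : set T2) (fun y => a y ^+ 2) by exact: measurable_funX.
have mP : measurable_fun (setT : set T2) (fun y => a y ^+ 2 * power_kernel th r (sqdist y c)).
  by apply: measurable_funM => //; apply: measurable_sqdist_comp; exact: measurable_power_kernel.
have P0 y : 0 <= a y ^+ 2 * power_kernel th r (sqdist y c).
  by rewrite mulr_ge0 ?sqr_ge0// power_kernel_ge0.
have tp : 0 <= tau / 2 by lra.
have tp' : 0 <= (2 * tau)^-1 by rewrite invr_ge0; lra.
apply: (@le_trans _ _ (\int[@leb2 R]_y ((tau / 2)%:E * ((a y ^+ 2)%:E +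
   v%:E * (a y ^+ 2 * power_kernel th r (sqdist y c))%:E) + (2 * tau)^-1%:E * (K y)%:E))%E).
  apply: ge0_le_integral => //.
  - by move=> y _; rewrite lee_fin mulr_ge0// riesz_ge0.
  - apply/measurable_EFinP; apply: measurable_funM => //.
    by apply: measurable_sqdist_comp; exact: measurable_riesz.
  - apply/measurable_EFinP; apply: measurable_funD; last exact: measurable_funM.
    apply: measurable_funM => //; apply: measurable_funD => //; exact: measurable_funM.
  - move=> y _; rewrite -!EFinM lee_fin.
    have := weighted_amgm (a y) (riesz r (sqdist y c)) (q0 (sqdist y c)) tau0.
    rewrite -/(K y) /power_kernel; case: (ltP (sqdist y c) r) => h.
      by rewrite mulrDr mulr1 (mulrCA v).
    have -> : riesz r (sqdist y c) = 0 by rewrite /riesz ltNge h.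
    by move=> _; rewrite !mulr0 addr0; apply: addr_ge0; apply: mulr_ge0; rewrite ?sqr_ge0.
rewrite ge0_integralD//; last 4 first.
- by move=> y _; rewrite lee_fin mulr_ge0// addr_ge0 ?sqr_ge0// mulr_ge0// ltW.
- apply/measurable_EFinP; apply: measurable_funM => //; apply: measurable_funD => //; exact: measurable_funM.
- by move=> y _; rewrite lee_fin mulr_ge0.
- by apply/measurable_EFinP; exact: measurable_funM.
rewrite ge0_integralZl//; last 2 first.
- by apply/measurable_EFinP; apply: measurable_funD => //; exact: measurable_funM.
- by move=> y _; rewrite lee_fin addr_ge0 ?sqr_ge0// mulr_ge0// ltW.
rewrite ge0_integralZl//; last 2 first.
- exact/measurable_EFinP.
- by move=> y _; rewrite lee_fin.
rewrite ge0_integralD//; last 4 first.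
- by move=> y _; rewrite lee_fin sqr_ge0.
- exact/measurable_EFinP.
- by move=> y _; rewrite lee_fin mulr_ge0// ltW.
- by apply/measurable_EFinP; exact: measurable_funM.
rewrite ge0_integralZl//; last 3 first.
- exact/measurable_EFinP.
- by move=> y _; rewrite lee_fin.
- by rewrite lee_fin ltW.
apply: (@le_trans _ _ ((tau / 2)%:E * (1 + v%:E * F%:E) + (2 * tau)^-1%:E * Y%:E)%E).
  apply: leeD; apply: lee_wpmul2l; rewrite ?lee_fin//.
    by apply: leeD => //; apply: lee_wpmul2l => //; rewrite lee_fin ltW.
  exact: integral_riesz_sqr.
change ((tau / 2 * (1 + v * F) + (2 * tau)^-1 * Y)%:E <= S%:E)%E; rewrite lee_fin.
apply: (@le_trans _ _ (tau / 2 * (1 + de) + (2 * tau)^-1 * Y)).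
  by rewrite lerD2r ler_wpM2l// lerD2l.
have -> : Y = S ^+ 2 / (1 + de) by rewrite S2 mulrC mulKf ?gt_eqF.
by rewrite le_eqVlt; apply/orP; left; apply/eqP; rewrite /tau; field; rewrite !gt_eqF.
Qed.

End potentials.

(** * The logarithmic weight on small discs *)

Section weights.
Variable R : realType.
Local Notation T2 := (measurableTypeR R * measurableTypeR R)%type.
Local Notation leb := (@lebesgue_measure R).
Implicit Types (u : R * R -> R) (g : R * R -> R * R) (x y : R * R).

Definition weight (b : R) x : R := ln (b + enorm2 x).

(* Oscillation of the weight over a disc of radius [weight b x `^ (- 1/2)]. *)
Definition distortion (b : R) : R := 1 + ln (1 + Num.sqrt (ln b)^-1) / ln b.

Lemma enorm2_triangle x y : enorm2 x <= enorm2 y + Num.sqrt (sqdist y x).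
Proof.
set n := enorm2 y; set s := Num.sqrt _.
have n0 : 0 <= n by exact: sqrtr_ge0.
have s0 : 0 <= s by exact: sqrtr_ge0.
have n2 : n ^+ 2 = y.1 ^+ 2 + y.2 ^+ 2 by rewrite sqr_sqrtr// addr_ge0// sqr_ge0.
have s2 : s ^+ 2 = (y.1 - x.1) ^+ 2 + (y.2 - x.2) ^+ 2 by rewrite sqr_sqrtr// sqdist_ge0.
have := cauchy_schwarz2 y.1 y.2 (y.1 - x.1) (y.2 - x.2).
rewrite ler_norml -/(enorm2 y) -/n -/(sqdist y x) -/s => /andP[h _].
rewrite -(ger0_norm (addr_ge0 n0 s0)) -sqrtr_sqr; apply: ler_wsqrtr.
nra.
Qed.

Lemma weight_ge (b : R) x : 1 < b -> ln b <= weight b x.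
Proof.
move=> b1; have e0 : 0 <= enorm2 x by exact: sqrtr_ge0.
by rewrite /weight ler_ln ?posrE; lra.
Qed.

Lemma weight_gt0 (b : R) x : 1 < b -> 0 < weight b x.
Proof. by move=> b1; apply: lt_le_trans (weight_ge x b1); rewrite ln_gt0. Qed.

Lemma distortion_gt0 (b : R) : 1 < b -> 0 < distortion b.
Proof.
move=> b1; rewrite /distortion ltr_wpDr// divr_ge0 ?ln_ge0 ?lerDl ?sqrtr_ge0//.
exact: ltW.
Qed.

(** From [b + |x| <= (b + |y|) (1 + t)] the logarithms differ by at most [ln (1 + t)]; as the weight
    is at least [ln b], this additive error is absorbed into a multiplicative constant. *)
Lemma weight_comparable (b : R) x y : 1 < b -> sqdist y x <= (ln b)^-1 ->
  weight b x <= distortion b * weight b y.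
Proof.
move=> b1 h; have lb : 0 < ln b by rewrite ln_gt0.
set t := Num.sqrt (ln b)^-1.
have t0 : 0 <= t by exact: sqrtr_ge0.
have st : Num.sqrt (sqdist y x) <= t by exact: ler_wsqrtr.
have tri := enorm2_triangle x y.
have x0 : 0 <= enorm2 x by exact: sqrtr_ge0.
have y0 : 0 <= enorm2 y by exact: sqrtr_ge0.
have wy := weight_ge y b1.
have l0 : 0 <= ln (1 + t) by rewrite ln_ge0// lerDl.
have : weight b x <= weight b y + ln (1 + t).
  rewrite /weight -lnM ?posrE; [|lra|lra].
  by rewrite ler_ln ?posrE; [nra|lra|nra].
move=> /le_trans; apply; rewrite /distortion -/t mulrDl mul1r lerD2l.
by rewrite mulrAC ler_pdivlMr// ler_wpM2l.
Qed.

Lemma weight_disc (b : R) x y : 1 < b -> sqdist y x < (weight b x)^-1 ->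
  weight b x <= distortion b * weight b y /\ weight b y <= distortion b * weight b x.
Proof.
move=> b1 h; have h' : sqdist y x <= (ln b)^-1.
  apply: (le_trans (ltW h)); rewrite lef_pV2 ?posrE ?weight_gt0 ?ln_gt0//.
  exact: weight_ge.
by split; apply: weight_comparable => //; rewrite sqdistC.
Qed.

Lemma measurable_weightf (b : R) : measurable_fun (setT : set T2) (weight b).
Proof. exact: measurable_weight. Qed.

(** At squared radius [1 / weight b x] the mollifier is at most [C * weight b x], comparable to the
    weight at every [y] of its support. With [|u| <= 1 + |u|^p], the average is controlled by the
    mass of the mollifier plus the weighted norm. *)
Lemma average_bound (b p : R) : 1 < b -> 1 < p -> exists2 D : R, 0 <= D &
  forall u, loc_integrable2 u ->
  (\int[@leb2 R]_x (`|u x| `^ p * weight b x)%:E <= 1)%E ->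
  forall x, `| \int[@leb2 R]_y (u y * moll (weight b x)^-1 (sqdist y x))%R | <= D.
Proof.
move=> b1 p1; have [C [C0 HC]] := moll_bounded R.
have k0 := distortion_gt0 b1.
exists (1 + C * distortion b); first by rewrite addr_ge0// mulr_ge0// ltW.
move=> u lu hu x; have mu := loc_integrable2_measurable lu.
have wx := weight_gt0 x b1; set r := (weight b x)^-1.
have r0 : 0 < r by rewrite invr_gt0.
have im := integrable_moll x lu r0.
have mm : measurable_fun (setT : set T2) (fun y => moll r (sqdist y x)).
  by apply: measurable_sqdist_comp; exact: measurable_moll.
rewrite -lee_fin.
apply: (@le_trans _ _ (\int[@leb2 R]_y `|(u y * moll r (sqdist y x))%:E|)%E).
  apply: le_trans (le_abse_integral _ measurableT (measurable_int _ im)).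
  by rewrite /Rintegral -abse_EFin fineK//; exact: integrable_fin_num im.
have k1 : 0 <= C * distortion b by rewrite mulr_ge0// ltW.
apply: (@le_trans _ _ (\int[@leb2 R]_y ((moll r (sqdist y x))%:E +
    (C * distortion b)%:E * (`|u y| `^ p * weight b y)%:E))%E).
  apply: ge0_le_integral => //.
  - by apply: measurableT_comp => //; exact: measurable_int im.
  - apply: emeasurable_funD; first exact/measurable_EFinP.
    by apply: measurable_funeM; exact: measurable_weighted_powR.
  move=> y _; rewrite -EFinM -EFinD abse_EFin lee_fin normrM.
  have m0 := moll_ge0 (sqdist y x) r0; rewrite (ger0_norm m0).
  have up : 0 <= `|u y| `^ p by exact: powR_ge0.
  have wy := weight_gt0 y b1.
  have [rs|rs] := leP r (sqdist y x).
    by rewrite moll0// mulr0 add0r mulr_ge0// mulr_ge0// ltW.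
  have [h1 h2] := weight_disc b1 rs.
  have yo : `|u y| <= 1 + `|u y| `^ p.
    have [u1|u1] := leP `|u y| 1; first by lra.
    have := ler_powR (ltW u1) (ltW p1); rewrite powRr1//; lra.
  have hm : moll r (sqdist y x) <= C * weight b x by rewrite -[weight b x]invrK; exact: HC.
  apply: (@le_trans _ _ ((1 + `|u y| `^ p) * moll r (sqdist y x))).
    by rewrite ler_wpM2r.
  rewrite mulrDl mul1r lerD2l.
  apply: (@le_trans _ _ (`|u y| `^ p * (C * (distortion b * weight b y)))).
    by rewrite ler_wpM2l//; apply: le_trans hm _; rewrite ler_pM2l.
  by rewrite le_eqVlt; apply/orP; left; apply/eqP; ring.
rewrite ge0_integralD//; last 4 first.
- by move=> y _; rewrite lee_fin moll_ge0.
- exact/measurable_EFinP.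
- by move=> y _; rewrite mule_ge0 ?lee_fin// mulr_ge0 ?powR_ge0// ltW// weight_gt0.
- by apply: measurable_funeM; exact: measurable_weighted_powR.
rewrite integral_moll// ge0_integralZl//; last 2 first.
- exact: measurable_weighted_powR.
- by move=> y _; rewrite lee_fin mulr_ge0 ?powR_ge0// ltW// weight_gt0.
rewrite EFinD leeD2l// -[leRHS]mule1; exact: lee_wpmul2l.
Qed.

(* The Tonelli theorem is applied to this density: its integral in [x] is
   controlled because [weight b] is nearly constant on the disc. *)
Definition local_energy (b th : R) g x : \bar R :=
  (\int[@leb2 R]_y (enorm2 (g y) ^+ 2 *
     (weight b x `^ (1 - th) * power_kernel th (weight b x)^-1 (sqdist y x)))%:E)%E.

Section local_energy.
Variables (b th : R) (g : R * R -> R * R).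
Hypotheses (b1 : 1 < b) (th0 : 0 < th) (th1 : th < 1)
  (mg : measurable_fun (setT : set T2) (fun y => enorm2 (g y)))
  (g1 : (\int[@leb2 R]_y (enorm2 (g y) ^+ 2)%:E <= 1)%E).

Let dens (z : T2 * T2) : R := enorm2 (g z.2) ^+ 2 *
  (weight b z.1 `^ (1 - th) * power_kernel th (weight b z.1)^-1 (sqdist z.2 z.1)).

Let dens_ge0 z : 0 <= dens z.
Proof. by rewrite /dens mulr_ge0 ?sqr_ge0// mulr_ge0 ?powR_ge0// power_kernel_ge0. Qed.

Let measurable_dens : measurable_fun (setT : set (T2 * T2)) dens.
Proof.
have mw : measurable_fun (setT : set (T2 * T2)) (fun z : T2 * T2 => weight b z.1).
  exact: (measurableT_comp (measurable_weightf b) measurable_fst).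
apply: measurable_funM.
  by apply: measurable_funX; exact: (measurableT_comp mg measurable_snd).
apply: measurable_funM.
  by apply: (measurable_fcomp (g := fun t => t `^ (1 - th))) => //; exact: measurable_powR.
rewrite /power_kernel; apply: measurable_fun_ifT => //.
- apply: measurable_fun_ltr; first exact: measurable_sqdist2.
  by apply: measurable_pos_inv => // z; exact: weight_gt0.
- by apply: (measurable_fcomp (g := fun t => t `^ (- th))); [exact: measurable_sqdist2|exact: measurable_powR].
Qed.

Lemma local_energy_ge0 x : (0 <= local_energy b th g x)%E.
Proof. by apply: integral_ge0 => y _; rewrite lee_fin; exact: (dens_ge0 (x, y)). Qed.

Lemma measurable_local_energy : measurable_fun (setT : set T2) (local_energy b th g).
Proof.
apply: (measurable_fun_fubini_tonelli_F (m2 := @leb2 R) (EFin \o dens)).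
- exact/measurable_EFinP.
- by move=> z; rewrite lee_fin.
Qed.

(** One distortion factor comes from replacing the weight at [x] by that at [y], the other from
    enlarging the disc; [pi / (1 - th)] is the constant of [integral_power_kernel]. *)
Definition local_energy_const : R :=
  distortion b `^ (1 - th) * (pi * (distortion b `^ (1 - th) / (1 - th))).

(** After Tonelli, for fixed [y] the points [x] that contribute lie in a disc around [y] of squared
    radius [distortion b / weight b y]. Its kernel integral scales as the weight to the power
    [th - 1], which cancels the factor of power [1 - th] in the density. *)
Lemma integral_local_energy :
  (\int[@leb2 R]_x local_energy b th g x <= local_energy_const%:E)%E.
Proof.
have th1' : 0 < 1 - th by rewrite subr_gt0.
have k0 := distortion_gt0 b1.
have C0 : 0 <= local_energy_const.
  rewrite /local_energy_const mulr_ge0 ?powR_ge0//; apply: mulr_ge0; first exact: pi_ge0.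
  by rewrite divr_ge0 ?powR_ge0// ltW.
have mD : measurable_fun (setT : set (T2 * T2)) (EFin \o dens) by exact/measurable_EFinP.
have D0 z : (0 <= (EFin \o dens) z)%E by rewrite lee_fin.
apply: (@le_trans _ _ (\int[@leb2 R]_y \int[@leb2 R]_x (dens (x, y))%:E)%E); last first.
  apply: (@le_trans _ _ (\int[@leb2 R]_y (local_energy_const%:E * (enorm2 (g y) ^+ 2)%:E))%E).
    apply: ge0_le_integral.
    - exact: measurableT.
    - by move=> y _; apply: integral_ge0 => x _; rewrite lee_fin.
    - exact: (measurable_fun_fubini_tonelli_G (m1 := @leb2 R) (EFin \o dens) mD D0).
    - by apply: measurable_funeM; apply/measurable_EFinP; exact: measurable_funX.
    move=> y _; rewrite muleC.
    have wy := weight_gt0 y b1.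
    pose t := distortion b / weight b y; have t0 : 0 < t by rewrite divr_gt0.
    apply: (@le_trans _ _ (\int[@leb2 R]_x ((enorm2 (g y) ^+ 2 * (distortion b * weight b y) `^ (1 - th))%:E *
        (power_kernel th t (sqdist x y))%:E))%E).
      apply: ge0_le_integral.
      - exact: measurableT.
      - by move=> x _; rewrite lee_fin.
      - by apply/measurable_EFinP; exact: (measurableT_comp measurable_dens (pair2_measurable y)).
      - apply: measurable_funeM; apply/measurable_EFinP; apply: measurable_sqdist_comp.
        exact: measurable_power_kernel.
      - move=> x _; rewrite -EFinM lee_fin -mulrA; apply: ler_wpM2l; first exact: sqr_ge0.
        have wx := weight_gt0 x b1.
        rewrite [X in _ * X <= _]/power_kernel /=; case: ifPn => [h|_]; last first.
          by rewrite mulr0 mulr_ge0 ?powR_ge0 ?power_kernel_ge0.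
        have [h1 h2] := weight_disc b1 h.
        apply: ler_pM; rewrite ?powR_ge0//.
          by apply: ge0_ler_powR; rewrite ?nnegrE ?(ltW wx)// ?mulr_ge0 ?(ltW k0) ?(ltW wy)// ltW.
        rewrite /power_kernel (sqdistC x y) (lt_le_trans h)// /t.
        by rewrite ler_pdivlMr// mulrC ler_pdivrMr.
    rewrite ge0_integralZl//; last 3 first.
    - by apply/measurable_EFinP; apply: measurable_sqdist_comp; exact: measurable_power_kernel.
    - by move=> x _; rewrite lee_fin power_kernel_ge0.
    - by rewrite lee_fin mulr_ge0 ?sqr_ge0 ?powR_ge0.
    apply: le_trans (lee_wpmul2l _ (integral_power_kernel y th1 t0)) _.
      by rewrite lee_fin mulr_ge0 ?sqr_ge0 ?powR_ge0.
    rewrite -!EFinM lee_fin -mulrA ler_wpM2l ?sqr_ge0// /local_energy_const /t.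
    rewrite !powRM ?invr_ge0 ?(ltW k0) ?(ltW wy)//.
    have W0 : 0 < weight b y `^ (1 - th) by exact: powR_gt0.
    have -> : (weight b y)^-1 `^ (1 - th) = (weight b y `^ (1 - th))^-1.
      by rewrite -(powR_inv1 (ltW wy)) -powRrM mulN1r powRN.
    rewrite le_eqVlt; apply/orP; left; apply/eqP.
    move: (weight b y `^ (1 - th)) W0 => W W0; move: (@pi R) => q; field.
    by rewrite !gt_eqF.
  rewrite ge0_integralZl//; last 2 first.
  - by apply/measurable_EFinP; exact: measurable_funX.
  - by move=> y _; rewrite lee_fin sqr_ge0.
  by rewrite -[leRHS]mule1; apply: lee_wpmul2l.
rewrite le_eqVlt; apply/orP; left; apply/eqP.
exact: (@fubini_tonelli _ _ T2 T2 R (@leb2 R) (@leb2 R) (EFin \o dens) mD D0).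
Qed.

Lemma riesz_local_energy (de : R) x : 0 < de -> (local_energy b th g x < +oo)%E ->
  (\int[@leb2 R]_y (enorm2 (g y) * riesz (weight b x)^-1 (sqdist y x))%:E <=
   (Num.sqrt ((1 + de) * ((4 * pi * th)^-1 *
      ln (1 + (fine (local_energy b th g x) / weight b x + 1) / de))))%:E)%E.
Proof.
move=> de0 fin; have wx := weight_gt0 x b1.
have G0 := local_energy_ge0 x.
have GE : (fine (local_energy b th g x))%:E = local_energy b th g x by rewrite fineK// ge0_fin_numE.
set G := fine _ in GE *; have G0' : 0 <= G by rewrite /G fine_ge0.
(* Stripping the weight factor recovers the bare energy integral; with [r = 1 / weight b x],
   [r^th F] is then [G / weight b x]. *)
pose F := weight b x `^ (th - 1) * G.
have -> : G / weight b x = (weight b x)^-1 `^ th * F.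
  rewrite /F mulrA (_ : _ * _ `^ (th - 1) = (weight b x)^-1) 1?mulrC//.
  rewrite -(powR_inv1 (ltW wx)) -powRrM mulN1r -powRD; last by rewrite (gt_eqF wx) implybT.
  by congr (_ `^ _); ring.
apply: riesz_potential_bound => //.
- by rewrite invr_gt0.
- by move=> y; exact: sqrtr_ge0.
- by rewrite /F mulr_ge0 ?powR_ge0.
rewrite /F EFinM GE -ge0_integralZl//.
- rewrite le_eqVlt; apply/orP; left; apply/eqP; apply: eq_integral => y _.
  have h : weight b x `^ (th - 1) * weight b x `^ (1 - th) = 1.
    rewrite -powRD; last by rewrite (gt_eqF wx) implybT.
    by rewrite addrA subrK subrr powRr0.
  by rewrite -EFinM; congr EFin; rewrite mulrCA [X in _ = _ * X]mulrA h mul1r.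
- by apply/measurable_EFinP; exact: (measurableT_comp measurable_dens (pair1_measurable x)).
- by move=> y _; rewrite lee_fin; exact: (dens_ge0 (x, y)).
- by rewrite lee_fin powR_ge0.
Qed.

End local_energy.
End weights.

(** * A pointwise majorant of the function *)

Section envelope.
Variable R : realType.
Local Notation T2 := (measurableTypeR R * measurableTypeR R)%type.
Implicit Types (u : R * R -> R) (g : R * R -> R * R) (x : R * R).

(** The bound of the mollifications with the scale [e] gone. [fine] sends an infinite local energy
    to 0, which happens only on a null set once the energy is integrable. *)
Definition envelope (b th de D : R) g x : R := D + Num.sqrt ((1 + de) *
  ((4 * pi * th)^-1 * ln (1 + (fine (local_energy b th g x) / weight b x + 1) / de))).

(** The disc radius shrinks as [x] goes to infinity; this bound gives a mollification scale valid on
    a whole box. *)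
Lemma weight_box (b : R) N x : 1 < b -> box N x -> weight b x <= ln (b + 2 * N%:R).
Proof.
move=> b1 /boxP[/ler_normlP[h1 h1'] /ler_normlP[h2 h2']].
have N0 : 0 <= N%:R :> R by [].
have e0 : 0 <= enorm2 x by exact: sqrtr_ge0.
have : enorm2 x <= 2 * N%:R.
  rewrite -[leRHS](ger0_norm (mulr_ge0 _ N0))// -sqrtr_sqr; apply: ler_wsqrtr.
  by nra.
by move=> h; rewrite /weight ler_ln ?posrE; lra.
Qed.

Section envelope_properties.
Variables (b th de D : R) (g : R * R -> R * R).
Hypotheses (b1 : 1 < b) (th0 : 0 < th) (th1 : th < 1) (de0 : 0 < de) (D0 : 0 <= D)
  (mg : measurable_fun (setT : set T2) (fun y => enorm2 (g y)))
  (g1 : (\int[@leb2 R]_y (enorm2 (g y) ^+ 2)%:E <= 1)%E).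
Local Notation LE := (local_energy b th g).

Lemma integrable_local_energy : (@leb2 R).-integrable setT LE.
Proof.
apply/integrableP; split; first exact: measurable_local_energy.
apply: le_lt_trans (ltry (local_energy_const b th)).
have -> : (\int[@leb2 R]_x `|LE x| = \int[@leb2 R]_x LE x)%E.
  by apply: eq_integral => x _; rewrite gee0_abs// local_energy_ge0.
exact: integral_local_energy.
Qed.

Lemma integrable_fine_local_energy : (@leb2 R).-integrable setT (EFin \o (fun x => fine (LE x))).
Proof.
have i := integrable_local_energy.
apply: (@le_integrable _ _ _ (@leb2 R) setT measurableT _ _ _ _ i).
  by apply/measurable_EFinP; apply: measurableT_comp => //; exact: measurable_local_energy.
by move=> x _ /=; case: (LE x) => [r| |] /=; rewrite ?lexx ?leey.
Qed.

Let L x : R := ln (1 + (fine (LE x) / weight b x + 1) / de).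
Let c : R := (1 + de) * (4 * pi * th)^-1.

Let GE0 x : 0 <= fine (LE x) / weight b x.
Proof. by rewrite divr_ge0 ?fine_ge0 ?local_energy_ge0// ltW// weight_gt0. Qed.

Let L0 x : 0 <= L x.
Proof.
rewrite /L ln_ge0// lerDl; apply: divr_ge0; last exact: ltW.
by rewrite addr_ge0.
Qed.

Let c0 : 0 < c.
Proof.
have d : 0 < de := de0; rewrite /c mulr_gt0//; first lra.
by rewrite invr_gt0 (mulr_gt0 (mulr_gt0 _ (@pi_gt0 R)) th0).
Qed.

Lemma envelope_ge0 x : 0 <= envelope b th de D g x.
Proof. by rewrite addr_ge0// sqrtr_ge0. Qed.

Lemma measurable_envelope : measurable_fun (setT : set T2) (envelope b th de D g).
Proof.
apply: measurable_funD => //.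
apply: measurable_fcomp; last exact: (continuous_measurable_fun (@sqrt_continuous R)).
apply: measurable_funM => //; apply: measurable_funM => //.
apply: measurable_fcomp; last exact: measurable_ln.
apply: measurable_funD => //; apply: measurable_funM => //; apply: measurable_funD => //.
apply: measurable_funM.
  by apply: measurableT_comp => //; exact: measurable_local_energy.
apply: measurable_pos_inv; first exact: measurable_weightf.
by move=> x; exact: weight_gt0.
Qed.

(** By [sqrt t <= 1 + t] and [ln (1 + y) <= y] the envelope is at most an affine function of the
    local energy, which is integrable. *)
Lemma loc_integrable2_envelope : loc_integrable2 (envelope b th de D g).
Proof.
apply: loc_integrable2P; first exact: measurable_envelope.
move=> n.
pose K1 : R := D + 1 + c / de; pose K2 : R := c / de / ln b.
have lb : 0 < ln b by rewrite ln_gt0.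
have K20 : 0 <= K2 by rewrite (divr_ge0 (divr_ge0 (ltW c0) (ltW de0)) (ltW lb)).
have i : (@leb2 R).-integrable (@box R n) (fun x => (K1%:E + K2%:E * (fine (LE x))%:E)%E).
  apply: integrableD => //; first exact: measurable_box.
  - exact: (loc_integrable2_box n (continuous_loc_integrable2 (@cst_continuous _ _ (K1 : R)))).
  - apply: integrableZl; first exact: measurable_box.
    by apply: (integrableS measurableT) => //; [exact: measurable_box|exact: integrable_fine_local_energy].
apply: (@le_integrable _ _ _ (@leb2 R) _ (measurable_box n) _ _ _ _ i).
  by apply: measurable_funTS; apply/measurable_EFinP; exact: measurable_envelope.
move=> x _; rewrite abse_EFin ger0_norm ?envelope_ge0//.
apply: le_trans (_ : _ <= (K1 + K2 * fine (LE x))%:E)%E _; last by rewrite lee_fin ler_norm.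
rewrite lee_fin /envelope mulrA -/c -/(L x).
have sq (t : R) : 0 <= t -> Num.sqrt t <= 1 + t.
  by move=> t0; have := sqr_sqrtr t0; have := sqrtr_ge0 t; nra.
have Lx : L x <= (fine (LE x) / weight b x + 1) / de.
  apply: le_ln1Dx; apply: lt_le_trans (_ : 0 <= _); first by rewrite ltrN10.
  by apply: divr_ge0; [rewrite addr_ge0|exact: ltW].
have Gx : fine (LE x) / weight b x <= fine (LE x) / ln b.
  rewrite ler_wpM2l ?fine_ge0 ?local_energy_ge0// lef_pV2 ?posrE ?weight_gt0//.
  exact: weight_ge.
have s1 := sq _ (mulr_ge0 (ltW c0) (L0 x)).
have s2 : c * L x <= c * ((fine (LE x) / ln b + 1) / de).
  rewrite ler_pM2l//; apply: le_trans Lx _.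
  by rewrite ler_pM2r ?invr_gt0// lerD2r.
have -> : K1 + K2 * fine (LE x) = D + (1 + c * ((fine (LE x) / ln b + 1) / de)).
  by rewrite /K1 /K2; ring.
by rewrite lerD2l (le_trans s1)// lerD2l.
Qed.

Lemma ae_le_envelope u : loc_integrable2 u -> is_weak_gradient u g ->
  (forall x, `| \int[@leb2 R]_y (u y * moll (weight b x)^-1 (sqdist y x))%R | <= D) ->
  {ae (@leb2 R), forall x, `|u x| <= envelope b th de D g x}.
Proof.
move=> lu wg hD; apply: moll_ae_le => //.
- exact: loc_integrable2_envelope.
- exact: envelope_ge0.
move=> N; have N0 : 0 <= N%:R :> R by [].
have w0 : 0 < ln (b + 2 * N%:R) by rewrite ln_gt0//; have bb := b1; lra.
exists ((ln (b + 2 * N%:R))^-1 / 2); first by rewrite divr_gt0// invr_gt0.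
move=> e e0 eN; apply: (ae_mono (integrable_ae measurableT integrable_local_energy)) => x.
move=> /(_ I) fin xN.
have er : e <= (weight b x)^-1 / 2.
  apply: (le_trans (ltW eN)); rewrite ler_wpM2r// lef_pV2 ?posrE ?weight_gt0//.
  exact: weight_box.
rewrite -lee_fin; apply: le_trans (weak_gradient_moll x lu wg e0 er) _.
rewrite EFinD leeD// ?lee_fin//.
by apply: riesz_local_energy => //; rewrite -ge0_fin_numE// local_energy_ge0.
Qed.

(** One factor [1 + de] comes from splitting the square of [D + S], the other is already inside the
    envelope. Under the hypothesis the exponent coming from [S] is at most the logarithm itself, so
    its exponential is affine in the local energy. *)
Lemma expR_envelope (al t : R) x : 0 < al -> al * (1 + de) ^+ 2 <= 4 * pi * th ->
  `|t| <= envelope b th de D g x ->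
  expR (al * t ^+ 2) <= expR (al * (1 + de^-1) * D ^+ 2) *
    (1 + (fine (LE x) / weight b x + 1) / de).
Proof.
move=> al0 hal; rewrite /envelope mulrA -/c -/(L x); set S := Num.sqrt _ => ht.
have S2 : S ^+ 2 = c * L x by rewrite sqr_sqrtr// mulr_ge0// ltW.
have S0 : 0 <= S by exact: sqrtr_ge0.
have Z0 : 0 < 1 + (fine (LE x) / weight b x + 1) / de.
  rewrite ltr_wpDr//; apply: divr_ge0; last exact: ltW.
  by rewrite addr_ge0.
have LE1 : expR (L x) = 1 + (fine (LE x) / weight b x + 1) / de := lnK Z0.
rewrite -LE1 -expRD ler_expR.
have t2 : t ^+ 2 <= (D + S) ^+ 2.
  by rewrite -[t ^+ 2]real_normK ?num_real// lerXn2r ?nnegrE// addr_ge0.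
have y : (D + S) ^+ 2 <= (1 + de^-1) * D ^+ 2 + (1 + de) * S ^+ 2.
  (* Young's inequality, with the large constant on the bounded part [D] and a constant close to 1
     on [S]. *)
  rewrite -subr_ge0 (_ : _ - _ = de * (de^-1 * D - S) ^+ 2); last by field; rewrite gt_eqF.
  by rewrite mulr_ge0 ?sqr_ge0// ltW.
have h : al * ((1 + de) * S ^+ 2) <= L x.
  rewrite S2 (_ : al * _ = al * (1 + de) ^+ 2 / (4 * pi * th) * L x); last by rewrite /c; ring.
  have pt : 0 < 4 * (pi : R) * th := mulr_gt0 (mulr_gt0 (ltac:(by []) : 0 < 4) (@pi_gt0 R)) th0.
  by rewrite ler_piMl// ler_pdivrMr// mul1r.
have : al * t ^+ 2 <= al * ((1 + de^-1) * D ^+ 2 + (1 + de) * S ^+ 2).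
  by rewrite ler_pM2l// (le_trans t2).
by rewrite mulrDr [al * (_ * D ^+ 2)]mulrA; lra.
Qed.

End envelope_properties.

(** This is [ln z <= z - 1] at [z = k t^2], with [k = 2 eta / p] chosen so that
    [p / 2 * k = eta]. *)
Lemma powR_le_expR_sqr (p eta : R) : 0 < p -> 0 < eta ->
  exists2 C : R, 0 < C & forall t, 1 <= t -> t `^ p <= C * expR (eta * t ^+ 2).
Proof.
move=> p0 eta0; pose k := 2 * eta / p.
have k0 : 0 < k by rewrite divr_gt0// mulr_gt0.
exists (expR (p / 2 * (- 1 - ln k))); first exact: expR_gt0.
move=> t t1; have t0 : 0 < t by lra.
rewrite -expRD /powR gt_eqF// ler_expR.
have h := ln_le_sub1 (mulr_gt0 k0 (exprn_gt0 2 t0)).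
rewrite lnM ?posrE ?exprn_gt0// lnXn// in h.
have hk : p / 2 * (k * t ^+ 2) = eta * t ^+ 2 by rewrite /k; field; rewrite gt_eqF.
have -> : p * ln t = p / 2 * (ln t *+ 2) by rewrite -mulr_natr; field.
rewrite -hk -mulrDr ler_pM2l ?divr_gt0//; lra.
Qed.

End envelope.

(** * Uniform bound on the unit ball *)

Section subcritical.
Variable R : realType.
Local Notation T2 := (measurableTypeR R * measurableTypeR R)%type.
Implicit Types (u : R * R -> R).

Lemma DL_unit_ball (b p : R) u : 1 < b -> 0 < p ->
  (DLspace b p `&` [set u | (DLnorm b p u ^+ 2 <= 1)%E]) u ->
  exists g, [/\ loc_integrable2 u, is_weak_gradient u g,
    (\int[@leb2 R]_y (enorm2 (g y) ^+ 2)%:E <= 1)%E &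
    (\int[@leb2 R]_x (`|u x| `^ p * weight b x)%:E <= 1)%E].
Proof.
move=> b1 p0 [[lu [g wg] _ _] h]; exists g.
have {}h : (DLnorm b p u ^+ 2 <= 1)%E := h; rewrite sqr_DLnorm in h.
have gn0 : (0 <= gradient_norm u ^+ 2)%E by rewrite expe_ge0//; exact: Lnorm_ge0.
have wn0 : (0 <= weighted_norm b p u ^+ 2)%E by rewrite expe_ge0//; exact: poweR_ge0.
split => //.
  by rewrite -(sqr_gradient_norm wg); apply: le_trans h; rewrite leeDl.
have {}h : (weighted_norm b p u ^+ 2 <= 1)%E by apply: le_trans h; rewrite leeDr.
have : (weighted_norm b p u <= 1)%E.
  move: h; have : (0 <= weighted_norm b p u)%E by exact: poweR_ge0.
  case: (weighted_norm b p u) => [r| |]//; rewrite ?lee_fin => r0.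
  by rewrite -expr2 expr_le1.
rewrite /weighted_norm; set X := (\int[_]_x _)%E => hX.
have X0 : (0 <= X)%E.
  by apply: integral_ge0 => x _; rewrite lee_fin mulr_ge0 ?powR_ge0//; exact: weight_ge0.
have -> : X = poweR (poweR X p^-1) p by rewrite -poweRrM mulVf ?gt_eqF// poweRe1.
rewrite -(poweR1r p); apply: gt0_ler_poweR (ltW p0) _ _ _ _ hX.
- by rewrite in_itv/= leey andbT poweR_ge0.
- by rewrite in_itv/= leey andbT.
Qed.

(** Where [|u| <= 1] the exponential is bounded and the weighted norm suffices. Where [|u| > 1] the
    power of [u] is absorbed into a slightly larger exponent and the envelope takes over. *)
Lemma TM_bounded (p b alpha : R) : 1 < p -> 1 < b -> alpha < 4 * pi ->
  exists C : R, forall u, (DLspace b p `&` [set u | (DLnorm b p u ^+ 2 <= 1)%E]) u ->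
    (TM_functional b p alpha u <= C%:E)%E.
Proof.
move=> p1 b1 al; have p0 : 0 < p by lra.
have pi40 : 0 < 4 * (pi : R) by rewrite mulr_gt0// pi_gt0.
(* A positive exponent, even for negative [alpha], strictly between [alpha] and [4 pi]; the gap
   [al' - alpha] absorbs the [p]-th power. *)
pose al' := (Num.max 0 alpha + 4 * pi) / 2.
have m0 : 0 <= Num.max 0 alpha by rewrite le_max lexx.
have m1 : alpha <= Num.max 0 alpha by rewrite le_max lexx orbT.
have m2 : Num.max 0 alpha < 4 * pi by rewrite gt_max pi40 al.
have al0 : 0 < al' by rewrite /al'; lra.
have al1 : alpha < al' by rewrite /al'; lra.
have al2 : al' < 4 * pi by rewrite /al'; lra.
pose q := al' / (4 * pi).
have q0 : 0 < q by rewrite divr_gt0.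
have q1 : q < 1 by rewrite ltr_pdivrMr// mul1r.
(* The requirement is [q (1 + de)^2 <= th]: the slack [th - q] equals [3 de], and
   [(1 + de)^2 - 1 <= 3 de]. *)
pose de := (1 - q) / 6; pose th := (1 + q) / 2.
have de0 : 0 < de by rewrite /de; lra.
have th0 : 0 < th by rewrite /th; lra.
have th1 : th < 1 by rewrite /th; lra.
have hal : al' * (1 + de) ^+ 2 <= 4 * pi * th.
  have -> : al' = 4 * pi * q by rewrite /q mulrC mulfVK ?gt_eqF.
  by rewrite -(mulrA (4 * pi)) ler_pM2l// /th /de; nra.
have [D D0 HD] := average_bound b1 p1.
have [C1 C10 HC1] := powR_le_expR_sqr p0 (ltac:(by rewrite subr_gt0) : 0 < al' - alpha).
pose K0 := expR (al' * (1 + de^-1) * D ^+ 2).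
(* [A] multiplies the weighted norm and covers both the region [|u| <= 1] and the constant part of
   the envelope bound; [B] multiplies the local energy. *)
pose A := expR `|alpha| + C1 * K0 * (1 + de^-1).
pose B := C1 * K0 / de.
have K00 : 0 < K0 by exact: expR_gt0.
have B0 : 0 <= B := divr_ge0 (mulr_ge0 (ltW C10) (ltW K00)) (ltW de0).
have A1 : 0 <= C1 * K0 * (1 + de^-1) 
  by rewrite mulr_ge0 ?addr_ge0 ?invr_ge0 ?(ltW de0)// mulr_ge0 ?(ltW K00) ?(ltW C10).
have A0 : 0 <= A by rewrite addr_ge0// expR_ge0.
exists (A + B * local_energy_const b th) => u /(DL_unit_ball b1 p0)[g [lu wg g1 u1]].
have mu := loc_integrable2_measurable lu.
have mg : measurable_fun (setT : set T2) (fun y => enorm2 (g y)).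
  by case: wg => l1 l2 _; apply: measurable_enorm2; exact: loc_integrable2_measurable.
have ae := ae_le_envelope b1 th0 th1 de0 D0 mg g1 lu wg (HD u lu u1).
have aefin := integrable_ae measurableT (integrable_local_energy b1 th1 mg g1).
rewrite /TM_functional.
have LE0 x := local_energy_ge0 b th g x.
apply: (@le_trans _ _ (\int[@leb2 R]_x (A%:E * (`|u x| `^ p * weight b x)%:E +
    B%:E * local_energy b th g x))%E).
  apply: ae_ge0_le_integral => //.
  - by move=> x _; rewrite lee_fin !mulr_ge0 ?powR_ge0 ?expR_ge0//; exact: weight_ge0.
  - exact: measurable_TM.
  - move=> x _; rewrite adde_ge0// mule_ge0 ?lee_fin// mulr_ge0 ?powR_ge0//; exact: weight_ge0.
  - apply: emeasurable_funD; apply: measurable_funeM; first exact: measurable_weighted_powR.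
    exact: measurable_local_energy.
  apply: (ae_mono2 ae aefin) => x hx /(_ I) fx _.
  rewrite -(fineK fx) -!EFinM -EFinD lee_fin.
  have F0 : 0 <= fine (local_energy b th g x) by rewrite fine_ge0.
  set F := fine _ in F0 hx *.
  have wx : 0 < weight b x by exact: weight_gt0.
  rewrite -/(weight b x) mulrAC; set W := weight b x in wx *.
  have up : 0 <= `|u x| `^ p by exact: powR_ge0.
  have BF : 0 <= B * F by rewrite mulr_ge0.
  have [ux|ux] := leP `|u x| 1.
    have e1 : expR (alpha * u x ^+ 2) <= A.
      apply: (@le_trans _ _ (expR `|alpha|)); last by rewrite lerDl.
      rewrite ler_expR; apply: le_trans (ler_norm _) _; rewrite normrM ler_piMr//.
      by rewrite normrX expr_le1.
    rewrite mulrC; apply: (@le_trans _ _ (A * (`|u x| `^ p * W))); last by rewrite lerDl.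
    by rewrite ler_wpM2r// mulr_ge0// ltW.
  have h1 : `|u x| `^ p * expR (alpha * u x ^+ 2) <= C1 * expR (al' * u x ^+ 2).
    have -> : al' * u x ^+ 2 = (al' - alpha) * u x ^+ 2 + alpha * u x ^+ 2 by ring.
    rewrite expRD mulrA ler_wpM2r ?expR_ge0//.
    by rewrite -[u x ^+ 2]real_normK ?num_real//; apply: HC1; exact: ltW.
  have h2 := expR_envelope b1 th0 de0 D0 al0 hal hx.
  rewrite -/K0 -/F -/W in h2.
  (* This charges the constant part of the bound, not integrable against the weight on its own, to
     the weighted norm. *)
  have up1 : 1 <= `|u x| `^ p.
    by rewrite -[leLHS](powRr0 `|u x|) ler_powR// ltW.
  rewrite mulrAC.
  apply: (@le_trans _ _ (C1 * (K0 * (1 + (F / W + 1) / de)) * W)).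
    by rewrite ler_pM2r//; apply: le_trans h1 _; rewrite ler_pM2l.
  have -> : C1 * (K0 * (1 + (F / W + 1) / de)) * W = C1 * K0 * (1 + de^-1) * W + B * F.
    by rewrite /B; field; rewrite !gt_eqF.
  rewrite lerD2r; apply: (@le_trans _ _ (A * W)).
    by rewrite ler_pM2r// /A lerDr expR_ge0.
  by rewrite ler_wpM2l// ler_peMl// ltW.
rewrite ge0_integralD//; last 4 first.
- by move=> x _; rewrite mule_ge0 ?lee_fin// mulr_ge0 ?powR_ge0//; exact: weight_ge0.
- by apply: measurable_funeM; exact: measurable_weighted_powR.
- by move=> x _; rewrite mule_ge0 ?lee_fin.
- by apply: measurable_funeM; exact: measurable_local_energy.
rewrite ge0_integralZl//; last 2 first.
- exact: measurable_weighted_powR.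
- by move=> x _; rewrite lee_fin mulr_ge0 ?powR_ge0//; exact: weight_ge0.
rewrite ge0_integralZl//; last exact: measurable_local_energy.
rewrite [leRHS](_ : _ = A%:E + B%:E * (local_energy_const b th)%:E)%E//; apply: leeD.
  by rewrite -[leRHS]mule1; exact: lee_wpmul2l.
by apply: lee_wpmul2l; rewrite ?lee_fin//; exact: integral_local_energy.
Qed.

End subcritical.

Theorem theorem2p5 (R : realType) (p b : R) (hp : 2 < p) (hb : 1 < b) :
  (forall alpha : R, alpha < 4 * pi -> (TM_sup b p alpha < +oo)%E) /\
  (forall alpha : R, 4 * pi < alpha -> TM_sup b p alpha = +oo%E).
Proof.
split => alpha al; last exact: TM_sup_infty.
have [C HC] := TM_bounded (lt_trans (ltac:(lra) : 1 < 2) hp) hb al.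
apply: le_lt_trans (ltry C); apply: ge_ereal_sup => _ [u hu <-]; exact: HC.
Qed.
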